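(* Let $\mathcal{M}\subset\mathbb{R}^n$ be a locally symmetric $C^2$ submanifold of $\mathbb{R}^n$ of dimension $d$. Then $\lambda^{-1}(\mathcal{M})=\{X\in\mathbf{S}^n:\lambda(X)\in\mathcal{M}\}$ is a $C^2$ submanifold of $\mathbf{S}^n$, and its dimension is $$\dim\lambda^{-1}(\mathcal{M})=d+\sum_{1\le i<j\le \kappa_*+m_*}|I_i^*|\,|I_j^*|,$$ where $\sigma_*$ is a characteristic permutation of $\mathcal{M}$ and $P(\sigma_* )=\{I_1^*,\dots,I^*_{\kappa_*+m_*}\}$ is its orbit partition.
   Context: $\mathbf{S}^n$ is the space of real symmetric $n\times n$ matrices; $\lambda(X)\in\mathbb{R}^n$ is the vector of eigenvalues of $X$ with multiplicity, ordered nonincreasingly. $\Sigma^n$ is the group of permutations of $\mathbb{N}_n=\{1,\dots,n\}$, acting on $\mathbb{R}^n$ by $(\sigma x)_i=x_{\sigma^{-1}(i)}$. For $\sigma\in\Sigma^n$, $P(\sigma)$ is the partition of $\mathbb{N}_n$ into the orbits of $\sigma$ (the supports of the nontrivial cycles and the singletons of fixed points). For $x\in\mathbb{R}^n$, $P(x)$ is the partition of $\mathbb{N}_n$ in which $i,j$ lie in the same set iff $x_i=x_j$. $\Delta(\sigma)=\{x\in\mathbb{R}^n:P(x)=P(\sigma)\}$. $\mathbb{R}^n_{\ge}=\{x:x_1\ge\cdots\ge x_n\}$; $B(x,\delta)$ is the open Euclidean ball. A set $S\subset\mathbb{R}^n$ is locally symmetric if $S\cap\mathbb{R}^n_{\ge}\neq\emptyset$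 and for every $x\in S$ there is $\delta>0$ with $\sigma(S\cap B(x,\delta))=S\cap B(x,\delta)$ for all $y\in S\cap B(x,\delta)$ and all $\sigma\in\Sigma^n$ with $\sigma y=y$. A locally symmetric $C^2$ submanifold is a connected $C^2$ submanifold of $\mathbb{R}^n$ without boundary that is a locally symmetric set. A characteristic permutation of $\mathcal{M}$ is a $\sigma_*\in\Sigma^n$ such that there exist $\bar x\in\mathcal{M}$ and $\delta>0$ with $\mathcal{M}\cap B(\bar x,\delta)\subset\Delta(\sigma_* )$ (such a permutation exists and its partition $P(\sigma_* )$ is determined by $\mathcal{M}$); $\kappa_*$ is the number of singleton sets in $P(\sigma_* )$ and $m_*$ the number of sets with at least two elements. *)

(* Defs.v *)
From HB Require Import structures.
From mathcomp Require Import all_boot all_order all_algebra all_fingroup.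
From mathcomp Require Import all_classical all_reals all_analysis.
Set Implicit Arguments. Unset Strict Implicit. Unset Printing Implicit Defensive.
Import Order.TTheory GRing.Theory Num.Theory.
Import numFieldNormedType.Exports.
Local Open Scope classical_set_scope.
Local Open Scope ring_scope.

Section Defs.
Variable R : realType.

Definition ebasis (p : nat) (k : 'I_p) : 'rV[R]_p := delta_mx 0 k.

Definition partial (p : nat) (k : 'I_p) (g : 'rV[R]_p -> R) (w : 'rV[R]_p) : R :=
  'D_(ebasis k) g w.

Definition C2_on (p : nat) (W : set 'rV[R]_p) (g : 'rV[R]_p -> R) : Prop :=
  [/\ forall w, W w -> {for w, continuous g},
      forall k w, W w -> derivable g w (ebasis k),
      forall k w, W w -> {for w, continuous (partial k g)},
      forall k l w, W w -> derivable (partial k g) w (ebasis l)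
    & forall k l w, W w -> {for w, continuous (partial l (partial k g))}].

Definition jacobian (D a b : nat) (phi : 'rV[R]_D -> 'M[R]_(a, b)) (w : 'rV[R]_D)
  : 'M[R]_(D, a * b) :=
  \matrix_(k < D, l < a * b) partial k (fun v => (mxvec (phi v)) 0 l) w.

(* S is an (embedded, boundaryless) C^2 submanifold of dimension D of the
   Euclidean space 'M[R]_(a,b) : every point of S has a C^2 local
   parametrization by an open subset of R^D which is an immersion and a
   homeomorphism onto a relatively open piece of S. *)
Definition C2_submanifold (a b : nat) (S : set 'M[R]_(a, b)) (D : nat) : Prop :=
  forall X, S X ->
  exists (U : set 'M[R]_(a, b)) (W : set 'rV[R]_D) (phi : 'rV[R]_D -> 'M[R]_(a, b)),
  [/\ open U, U X, open W,
      (forall i j, C2_on W (fun w => phi w i j))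
    & (forall w1 w2, W w1 -> W w2 -> phi w1 = phi w2 -> w1 = w2)] /\
  [/\ phi @` W = S `&` U,
      (forall w, W w -> \rank (jacobian phi w) = D)
    & (forall V : set 'rV[R]_D, open V ->
         exists O : set 'M[R]_(a, b), open O /\ phi @` (W `&` V) = O `&` phi @` W)].

Definition symmetric (n : nat) (X : 'M[R]_n) : Prop := X^T = X.

Definition is_eigvals (n : nat) (X : 'M[R]_n) (x : 'rV[R]_n) : Prop :=
  (forall i j : 'I_n, (i <= j)%N -> x 0 j <= x 0 i) /\
  char_poly X = \prod_(i < n) ('X - (x 0 i)%:P).

Definition eigvals (n : nat) (X : 'M[R]_n) : 'rV[R]_n :=
  xget 0 [set x | is_eigvals X x].

Definition eig_preimage (n : nat) (M : set 'rV[R]_n) : set 'M[R]_n :=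
  [set X | symmetric X /\ M (eigvals X)].

Definition eball (n : nat) (x : 'rV[R]_n) (delta : R) : set 'rV[R]_n :=
  [set y | \sum_(i < n) (y 0 i - x 0 i) ^+ 2 < delta ^+ 2].

Definition pact (n : nat) (s : {perm 'I_n}) (x : 'rV[R]_n) : 'rV[R]_n :=
  \row_i x 0 ((s^-1)%g i).

Definition nonincr (n : nat) : set 'rV[R]_n :=
  [set x | forall i j : 'I_n, (i <= j)%N -> x 0 j <= x 0 i].

Definition locally_symmetric (n : nat) (S : set 'rV[R]_n) : Prop :=
  (S `&` @nonincr n !=set0) /\
  forall x, S x -> exists2 delta : R, 0 < delta &
    forall y (s : {perm 'I_n}), (S `&` eball x delta) y -> pact s y = y ->
      pact s @` (S `&` eball x delta) = S `&` eball x delta.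

Definition loc_sym_C2_submanifold (n : nat) (M : set 'rV[R]_n) (d : nat) : Prop :=
  [/\ connected M, C2_submanifold M d & locally_symmetric M].

Definition val_partition (n : nat) (x : 'rV[R]_n) : {set {set 'I_n}} :=
  ([set [set j | x 0 j == x 0 i] | i : 'I_n])%SET.

Definition Delta (n : nat) (s : {perm 'I_n}) : set 'rV[R]_n :=
  [set x | val_partition x = porbits s].

Definition characteristic_perm (n : nat) (M : set 'rV[R]_n) (s : {perm 'I_n}) : Prop :=
  exists xbar, M xbar /\ exists2 delta : R, 0 < delta &
    M `&` eball xbar delta `<=` Delta s.

End Defs.

Definition cross_card (n : nat) (s : {perm 'I_n}) : nat :=
  let I := enum (porbits s) in
  (\sum_(i < size I) \sum_(j < size I | (i < j)%N)
      #|nth finset.set0 I i| * #|nth finset.set0 I j|)%N.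

(* Main.v *)
(** Let [X] be in the preimage and [xb] its vector of eigenvalues. Near [xb], [M] is the image of
    a [C^2] retraction [rho] whose fibres are orthogonal to the tangent space; local symmetry makes
    [rho] commute with the transpositions that fix [xb]. Write [Pi] for the orthogonal projection
    onto the tangent space and [eta x := rho x - xb - (x - xb) Pi]. Then [eta] has zero derivative
    at [xb], is constant on the blocks of equal entries of [xb] and invariant under their
    permutations, and [x + eta x] lies in [M] iff [x - xb] is tangent.

    By the theorem of Lewis and Sendov a [C^2] function of the eigenvalues which is invariant under
    the transpositions fixing a point lifts to a [C^2] function of the matrix. This is proved by
    computing the first two derivatives at matrices with simple spectrum on generic lines and
    extending them continuously by compactness of the orthogonal group.

    Hence [Y + diag (eta (lambda Y))], with [Y] block diagonal and symmetric, conjugated by the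
    Cayley transform of an off-block skew matrix, is a [C^2] local diffeomorphism; it carries a
    linear space onto the preimage of [M] near [diag xb], and conjugation moves [diag xb] to [X].

    The dimension of that linear space is read off the blocks. For [i], [j] in one block,
    [e_i - e_j] is either normal or tangent to [M] at [xb]; the first case means that [y_i = y_j]
    for all [y] in [M] near [xb]. This relation is open and closed along the connected set [M], so
    it is the orbit relation of the characteristic permutation. *)

(* Eigenvectors cannot be chosen continuously where eigenvalues collide. Derivatives are therefore
   written with an arbitrary orthogonal [Q] diagonalizing [X]; they are shown not to depend on [Q],
   and this independence together with compactness gives their continuity.

   The retraction [rho] is only equivariant, so its coordinates do not lift to functions of the
   matrix. Each coordinate of [eta] is invariant, hence lifts, and constancy on blocks makes
   [diag (eta)] commute with every orthogonal matrix that respects the blocks: adding it shifts the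
   eigenvalues and keeps the eigenvectors.

   The condition that the eigenvalues of a block diagonal [Y], minus [xb], be tangent is linear in
   [Y] although eigenvalues are not. In a block which is a single orbit, tangent vectors are
   constant, so the block of [Y] is scalar. In any other block, normal vectors are constant, so only
   the trace of the block enters.

   Submanifolds are taken in the space of all square matrices; the chart thus needs as many
   parameters as there are entries, and the extra ones measure the failure of symmetry. *)
Require Import Defs.
From HB Require Import structures.
From mathcomp Require Import all_boot all_order all_algebra all_fingroup.
From mathcomp Require Import all_classical all_reals all_analysis.
From mathcomp Require Import ring lra.
Set Implicit Arguments. Unset Strict Implicit. Unset Printing Implicit Defensive.
Import Order.TTheory GRing.Theory Num.Theory.
Import numFieldNormedType.Exports.
Local Open Scope classical_set_scope.
Local Open Scope ring_scope.
(** * Continuity and differentiability *)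

Section MatrixTopology.
Variable R : realType.

Lemma le_mx_norm m n (A : 'M[R]_(m, n)) i j : `|A i j| <= `|A|.
Proof.
rewrite [leRHS]/Num.Def.normr/= mx_normrE.
exact: (le_bigmax _ (fun ij : 'I_m * 'I_n => `|A ij.1 ij.2|) (i, j)).
Qed.

Lemma mx_norm_le m n (A : 'M[R]_(m, n)) e :
  0 <= e -> (forall i j, `|A i j| <= e) -> `|A| <= e.
Proof.
by move=> e0 Ae; rewrite [leLHS]/Num.Def.normr/= mx_normrE bigmax_le//= => -[i j] _.
Qed.

Lemma cvg_sumr (T : Type) (F : set_system T) (FF : Filter F) (I : Type) (r : seq I)
    (P : pred I) (f : I -> T -> R) (l : I -> R) :
  (forall i, P i -> f i x @[x --> F] --> l i) ->
  (\sum_(i <- r | P i) f i x) @[x --> F] --> \sum_(i <- r | P i) l i.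
Proof.
move=> fl; elim: r => [|i r IH].
  by under eq_fun do rewrite big_nil; rewrite big_nil; exact: cvg_cst.
under eq_fun do rewrite big_cons; rewrite big_cons.
by case: ifP => // Pi; apply: cvgD => //; exact: fl.
Qed.

Lemma cvg_mxP (T : Type) (F : set_system T) (FF : Filter F) m n (f : T -> 'M[R]_(m, n)) (l : 'M[R]_(m, n)) :
  f x @[x --> F] --> l <-> (forall i j, f x i j @[x --> F] --> l i j).
Proof.
split=> [fl i j|fl].
  apply/cvgrPdist_le => e e0; near=> x.
  apply: (@le_trans _ _ `|l - f x|); last first.
    by near: x; move/cvgrPdist_le : fl; apply.
  by apply: le_trans (le_mx_norm (l - f x) i j); rewrite !mxE.
apply/cvgrPdist_le => e e0.
have H : \forall x \near F, forall i j, `|l i j - f x i j| <= e.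
  apply: filter_forall => i; apply: filter_forall => j.
  by move/cvgrPdist_le : (fl i j); apply.
near=> x; apply: mx_norm_le => [|i j]; first exact: ltW.
by rewrite !mxE; move: i j; near: x.
Unshelve. all: by end_near. Qed.

Lemma cvg_mulmx (T : Type) (F : set_system T) (FF : Filter F) m n p
   (f : T -> 'M[R]_(m, n)) (g : T -> 'M[R]_(n, p)) (a : 'M[R]_(m, n)) (b : 'M[R]_(n, p)) :
  f x @[x --> F] --> a -> g x @[x --> F] --> b ->
  (f x *m g x) @[x --> F] --> a *m b.
Proof.
move=> /cvg_mxP fa /cvg_mxP gb; apply/cvg_mxP => i j.
under eq_fun do rewrite mxE; rewrite mxE; apply: cvg_sumr => k _.
exact: cvgM.
Qed.

Lemma cvg_trmx (T : Type) (F : set_system T) (FF : Filter F) m n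
   (f : T -> 'M[R]_(m, n)) (a : 'M[R]_(m, n)) :
  f x @[x --> F] --> a -> (f x)^T @[x --> F] --> a^T.
Proof.
move=> /cvg_mxP fa; apply/cvg_mxP => i j.
by under eq_fun do rewrite mxE; rewrite mxE; apply: fa.
Qed.

Section ContinuousAt.
Variables (T : topologicalType) (x0 : T).

Lemma cont_distP (g : T -> R) : {for x0, continuous g} <->
  (forall e, 0 < e -> \forall x \near x0, `|g x0 - g x| <= e).
Proof. exact: (@cvgrPdist_le _ _ _ (nbhs x0)). Qed.

Lemma cont_near (g g' : T -> R) : (\forall x \near x0, g x = g' x) ->
  {for x0, continuous g} -> {for x0, continuous g'}.
Proof.
move=> E cg; rewrite /prop_for /continuous_at -(nbhs_singleton E).
by apply: cvg_trans cg; apply: near_eq_cvg.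
Qed.

Lemma cont_cst (U : topologicalType) (c : U) : {for x0, continuous (fun=> c : U)}.
Proof. exact: cvg_cst. Qed.

Lemma cont_mxP m n (f : T -> 'M[R]_(m, n)) :
  {for x0, continuous f} <-> forall i j, {for x0, continuous (fun x => f x i j)}.
Proof. exact: (@cvg_mxP _ (nbhs x0)). Qed.

Lemma cont_add (f g : T -> R) : {for x0, continuous f} -> {for x0, continuous g} ->
  {for x0, continuous (fun x => f x + g x)}.
Proof. exact: continuousD. Qed.

Lemma cont_opp (f : T -> R) : {for x0, continuous f} -> {for x0, continuous (fun x => - f x)}.
Proof. exact: continuousN. Qed.

Lemma cont_mul (f g : T -> R) : {for x0, continuous f} -> {for x0, continuous g} ->
  {for x0, continuous (fun x => f x * g x)}.
Proof. exact: continuousM. Qed.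

Lemma cont_inv (f : T -> R) : f x0 != 0 -> {for x0, continuous f} ->
  {for x0, continuous (fun x => (f x)^-1)}.
Proof. by move=> f0 cf; exact: cvgV. Qed.

Lemma cont_sum (I : Type) (r : seq I) (P : pred I) (f : I -> T -> R) :
  (forall i, P i -> {for x0, continuous (f i)}) ->
  {for x0, continuous (fun x => \sum_(i <- r | P i) f i x)}.
Proof. exact: (@cvg_sumr _ (nbhs x0)). Qed.

Lemma cont_mulmx m n p (f : T -> 'M[R]_(m, n)) (g : T -> 'M[R]_(n, p)) :
  {for x0, continuous f} -> {for x0, continuous g} ->
  {for x0, continuous (fun x => f x *m g x)}.
Proof. exact: (@cvg_mulmx _ (nbhs x0)). Qed.

Lemma cont_trmx m n (f : T -> 'M[R]_(m, n)) :
  {for x0, continuous f} -> {for x0, continuous (fun x => (f x)^T)}.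
Proof. exact: (@cvg_trmx _ (nbhs x0)). Qed.

Lemma cont_addmx m n (f g : T -> 'M[R]_(m, n)) :
  {for x0, continuous f} -> {for x0, continuous g} ->
  {for x0, continuous (fun x => f x + g x)}.
Proof. exact: continuousD. Qed.

End ContinuousAt.

Lemma cont_coord m n (A : 'M[R]_(m, n)) i j : {for A, continuous (fun B : 'M[R]_(m, n) => B i j)}.
Proof. exact: coord_continuous. Qed.

End MatrixTopology.

Section OneDim.
Variable R : realType.

Lemma MVT_norm_le (u du : R -> R) (a b e : R) :
  (forall t : R, Num.min a b <= t <= Num.max a b -> is_derive t 1 u (du t) /\ `|du t| <= e) ->
  `|u b - u a| <= e * `|b - a|.
Proof.
wlog ab : a b / a <= b.
  move=> H; have /orP[/H//|ba Hd] := le_total a b.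
  rewrite distrC [`|b - a|]distrC; apply: H => // t.
  by move: (Hd t); rewrite (min_idPl ba) (max_idPr ba) (min_idPr ba) (max_idPl ba).
rewrite (min_idPl ab) (max_idPr ab) => Hd.
have [t|t|c] := @MVT_segment R u du a b ab.
- by rewrite in_itv/= => /andP[at_ tb]; apply: (Hd t _).1; rewrite !ltW.
- apply: derivable_within_continuous => x; rewrite in_itv/= => /Hd [] dx _.
  exact: (@ex_derive _ _ _ _ _ _ _ dx).
rewrite in_itv/= => /Hd [_ dc] ->; rewrite normrM ler_wpM2r//.
Qed.

Lemma is_derive_line (V W : normedModType R) (g : V -> W) (z v : V) (t : R) dg :
  is_derive (z + t *: v) v g dg -> is_derive t 1 (fun s : R => g (z + s *: v)) dg.
Proof.
move=> [dg1 dg2].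
have E : (fun h : R => h^-1 *: (((fun s : R => g (z + s *: v)) \o shift t) (h *: 1) -
   g (z + t *: v))) = (fun h : R => h^-1 *: ((g \o shift (z + t *: v)) (h *: v) - g (z + t *: v))).
  apply/funext => h /=; congr (_ *: (g _ - _)).
  by rewrite [h *: 1]mulr1 scalerDl addrCA addrA.
by split; rewrite /derivable /derive /= in dg1 dg2 *; rewrite E.
Qed.

Lemma is_deriveP (V W : normedModType R) (f : V -> W) a v df :
  is_derive a v f df <->
  (fun h : R => h^-1 *: (f (h *: v + a) - f a)) @ 0^' --> df.
Proof.
split=> [[df1 df2]|H].
  by move: df1; rewrite /derivable -df2 /derive.
split; first by apply/cvg_ex; exists df.
exact: cvg_lim H.
Qed.

End OneDim.

Section C1.
Variable R : realType.

Definition C1_on p (W : set 'rV[R]_p) (g : 'rV[R]_p -> R) : Prop :=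
  (forall k w, W w -> derivable g w (ebasis R k)) /\
  (forall k w, W w -> {for w, continuous (partial k g)}).

(** Only partial derivatives are given, so the passage from [y] to [x] changes one coordinate at a
    time and the mean value inequality is applied on each segment. Letting both points vary (strict
    differentiability) is what the chain rule, the inverse function theorem and the divided
    differences of the gradient need. *)
Lemma C1_strict p (W : set 'rV[R]_p) g w0 : open W -> C1_on W g -> W w0 ->
  forall e, 0 < e -> \forall d \near 0^'+, forall x y, `|x - w0| < d -> `|y - w0| < d ->
   W x /\ `|g x - g y - \sum_k (x - y) 0 k * partial k g w0| <= e * `|x - y|.
Proof.
move=> oW [dg cg] Ww0 e e0.
have p0 : 0 < (p.+1%:R : R) by [].
(* There are [p] coordinate steps; [p.+1] keeps the quotient meaningful when [p = 0]. *)
pose e' := e / p.+1%:R; have e'0 : 0 < e' by rewrite divr_gt0.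
have : \forall w \near w0, W w /\ forall k, `|partial k g w0 - partial k g w| <= e'.
  near=> w; split; first by near: w; apply: open_nbhs_nbhs.
  near: w; apply: filter_forall => k.
  by have /cvgrPdist_le := cg k w0 Ww0; apply.
move=> /nbhs_ballP [r /= r0 Hr].
near=> d => x y xd yd.
have dr : d < r by near: d; exact: nbhs_right_lt.
have inr w : `|w - w0| < d -> W w /\ forall k, `|partial k g w0 - partial k g w| <= e'.
  by move=> wd; apply: Hr; rewrite -ball_normE /= distrC; exact: lt_trans dr.
split; first exact: (inr x xd).1.
have d0 : 0 < d by near: d; exact: nbhs_right_gt.
pose z (m : nat) : 'rV[R]_p := \row_k (if (k < m)%N then x 0 k else y 0 k).
pose c k := partial k g w0.
have zx : z p = x by apply/rowP => k; rewrite mxE ltn_ord.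
have zy : z 0%N = y by apply/rowP => k; rewrite mxE ltn0.
have step (k : 'I_p) : `|g (z k.+1) - g (z k) - (x - y) 0 k * c k| <= e' * `|x - y|.
  pose s := (x - y) 0 k.
  have zS : z k.+1 = z k + s *: ebasis R k.
    apply/rowP => j; rewrite !mxE ltnS eqxx /= /s !mxE.
    case: (ltngtP j k) => [jk|jk|/val_inj ->].
    - by rewrite (_ : (j == k) = false) ?mulr0 ?addr0//; apply/negP => /eqP E; rewrite E ltnn in jk.
    - by rewrite (_ : (j == k) = false) ?mulr0 ?addr0//; apply/negP => /eqP E; rewrite E ltnn in jk.
    - by rewrite eqxx mulr1 addrC subrK.
  (* Without its linear term the function has derivative at most [e']; the segment stays in the ball
     of the sup norm, which is a product of intervals. *)
  pose u (t : R) := g (z k + t *: ebasis R k) - t * c k.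
  have := @MVT_norm_le R u (fun t => partial k g (z k + t *: ebasis R k) - c k) 0 s e'.
  rewrite /u scale0r addr0 -zS mul0r !subr0 => H.
  rewrite -addrA [- g _ + _]addrC addrA; apply: le_trans (H _) _; last first.
    by rewrite ler_wpM2l ?(ltW e'0)// /s; apply: le_mx_norm.
  move=> t tb.
  have [Wt ct] : W (z k + t *: ebasis R k) /\
     forall k', `|partial k' g w0 - partial k' g (z k + t *: ebasis R k)| <= e'.
    apply: inr; have [xw yw] : (forall j, `|x 0 j - w0 0 j| < d) /\ (forall j, `|y 0 j - w0 0 j| < d).
      by split=> j; [apply: le_lt_trans xd|apply: le_lt_trans yd];
         apply: le_trans (le_mx_norm _ 0 j); rewrite !mxE.
    pose M : R := Num.max `|x - w0| `|y - w0|.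
    have xM j : `|x 0 j - w0 0 j| <= M.
      rewrite /M le_max; apply/orP; left; apply: le_trans (le_mx_norm _ 0 j); by rewrite !mxE.
    have yM j : `|y 0 j - w0 0 j| <= M.
      rewrite /M le_max; apply/orP; right; apply: le_trans (le_mx_norm _ 0 j); by rewrite !mxE.
    apply: (@le_lt_trans _ _ M); last by rewrite /M gt_max xd yd.
    apply: mx_norm_le => [|i j]; first by rewrite /M le_max normr_ge0.
    rewrite !mxE !ord1 eqxx /=; case: (altP (j =P k)) => [->|jk]; last first.
      by rewrite mulr0 addr0; case: ifP.
    rewrite ltnn mulr1; move: tb (xM k) (yM k); rewrite /s !mxE !ler_norml.
    move: (x 0 k) (y 0 k) (w0 0 k) (M) => a b c0 M'.
    have /orP[ab|ab] := le_total 0 (a - b).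
      by rewrite (min_idPl ab) (max_idPr ab) => /andP[? ?] /andP[? ?] /andP[? ?]; apply/andP; split; lra.
    rewrite (min_idPr ab) (max_idPl ab) => /andP[? ?] /andP[? ?] /andP[? ?]; apply/andP; split; lra.
  split; last by rewrite distrC; exact: ct.
  apply: is_deriveB.
    by apply: is_derive_line; apply: DeriveDef => //; exact: dg.
  have -> : (fun t => t * c k) = (fun t => c k *: t) by apply/funext => ?; rewrite [RHS]mulrC.
  by apply: is_derive_eq; rewrite [LHS]mulr1.
have -> : g x - g y = \sum_(k < p) (g (z k.+1) - g (z k)).
  rewrite -zx -zy -(big_mkord xpredT (fun k => g (z k.+1) - g (z k))).
  by rewrite telescope_sumr // zx zy.
rewrite -sumrB; apply: le_trans (ler_norm_sum _ _ _) _.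
apply: (@le_trans _ _ (\sum_(k < p) e' * `|x - y|)); first by apply: ler_sum => k _; apply: step.
rewrite sumr_const card_ord -mulr_natr mulrAC ler_wpM2r// /e' -mulrA ger_pMr//.
by rewrite mulrC ler_pdivrMr// mul1r ler_nat.
Unshelve. all: by end_near. Qed.

(** The outer map is strictly differentiable at [f w], while the inner one needs only a derivative
    in the direction [v]. This is the form that suits [lam], whose coordinates come with directional
    derivatives at simple spectra. *)
Lemma strict_derive_comp (V : normedModType R) q (g : 'rV[R]_q -> R) (dg : 'I_q -> R)
   (f : V -> 'rV[R]_q) w v (df : 'rV[R]_q) :
  (forall e, 0 < e -> exists2 d, 0 < d & forall x y, `|x - f w| < d -> `|y - f w| < d ->
   `|g x - g y - \sum_k (x - y) 0 k * dg k| <= e * `|x - y|) ->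
  (forall l, is_derive w v (fun x => f x 0 l) (df 0 l)) ->
  is_derive w v (g \o f) (\sum_l df 0 l * dg l).
Proof.
move=> Hs Hf; apply/is_deriveP.
pose D (h : R) := h^-1 *: (f (h *: v + w) - f w).
have Dl : D h @[h --> 0^'] --> df.
  apply/cvg_mxP => i j; rewrite ord1; have /is_deriveP := Hf j.
  by apply: cvg_trans; apply: near_eq_cvg; near=> h; rewrite /D !mxE.
have hD : (h *: D h) @[h --> 0^'] --> (0 : 'rV[R]_q).
  rewrite -[0 in X in _ --> X](scale0r df); apply: cvgZ => //.
  by apply: cvg_within.
set L := \sum_l _.
have S : (\sum_l (D h) 0 l * dg l) @[h --> 0^'] --> L.
  apply: cvg_sumr => l _; apply: cvgM; last exact: cvg_cst.
  by move/cvg_mxP : Dl; apply.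
apply/cvgrPdist_le => e e0.
have e2 : 0 < e / 2 by rewrite divr_gt0.
pose K := `|df| + 1; have K0 : 0 < K by rewrite ltr_wpDl.
have eK : 0 < e / 2 / K by rewrite divr_gt0.
have [d d0 Hd2] := Hs _ eK.
near=> h.
have h0 : h != 0 by near: h; exact: nbhs_dnbhs_neq.
have fD : f (h *: v + w) - f w = h *: D h by rewrite /D scalerA divff// scale1r.
have hd : `|f (h *: v + w) - f w| < d.
  rewrite fD; near: h; move/cvgrPdist_lt : hD => /(_ d d0).
  by apply: filterS => h; rewrite sub0r normrN.
have {Hd2} := Hd2 _ (f w) hd; rewrite [`|f w - f w|](_ : _ = 0) ?subrr ?normr0// => /(_ d0).
have DK : `|D h| <= K.
  near: h; move/cvgrPdist_le : Dl => /(_ 1 ltr01); apply: filterS => h Hh.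
  rewrite /K -[D h](subrKC df); apply: le_trans (ler_normD _ _) _.
  by rewrite lerD2l distrC.
set G := g _ - g _; move=> HG.
have -> : h^-1 *: ((g \o f) (h *: v + w) - (g \o f) w) = h^-1 * G by [].
have HS : `|L - \sum_l (D h) 0 l * dg l| <= e / 2.
  by near: h; move/cvgrPdist_le : S; apply.
have -> : L - h^-1 * G = (L - \sum_l (D h) 0 l * dg l) -
   h^-1 * (G - \sum_k (f (h *: v + w) - f w) 0 k * dg k).
  have E : h^-1 * (\sum_k (f (h *: v + w) - f w) 0 k * dg k) =
     \sum_l (D h) 0 l * dg l.
    by rewrite mulr_sumr; apply: eq_bigr => k _; rewrite fD mxE !mulrA mulVf// mul1r.
  by rewrite [in RHS]mulrBr E opprB addrA subrK.
apply: le_trans (ler_normB _ _) _; rewrite [leRHS](splitr e) lerD//.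
rewrite normrM normfV ler_pdivrMl ?normr_gt0//.
apply: le_trans HG _; rewrite fD normrZ mulrCA ler_wpM2l//.
by rewrite mulrAC ler_pdivrMr// ler_wpM2l// ltW.
Unshelve. all: by end_near. Qed.

Lemma C1_strict_at q (U : set 'rV[R]_q) (g : 'rV[R]_q -> R) x0 :
  open U -> C1_on U g -> U x0 ->
  forall e, 0 < e -> exists2 d, 0 < d & forall x y, `|x - x0| < d -> `|y - x0| < d ->
   `|g x - g y - \sum_k (x - y) 0 k * partial k g x0| <= e * `|x - y|.
Proof.
move=> oU cg Ux0 e e0; have Hd := C1_strict oU cg Ux0 e0.
near (0:R)^'+ => d.
have H : forall x y, `|x - x0| < d -> `|y - x0| < d -> U x /\
   `|g x - g y - \sum_k (x - y) 0 k * partial k g x0| <= e * `|x - y| by near: d.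
exists d; first by near: d; exact: nbhs_right_gt.
by move=> x y xd yd; have [] := H x y xd yd.
Unshelve. all: by end_near. Qed.

Lemma C1_derive_comp (V : normedModType R) q (U : set 'rV[R]_q) (g : 'rV[R]_q -> R)
   (f : V -> 'rV[R]_q) w v (df : 'rV[R]_q) :
  open U -> C1_on U g -> U (f w) ->
  (forall l, is_derive w v (fun x => f x 0 l) (df 0 l)) ->
  is_derive w v (g \o f) (\sum_l df 0 l * partial l g (f w)).
Proof.
by move=> oU cg Ufw; apply: strict_derive_comp; exact: (C1_strict_at oU cg Ufw).
Qed.

End C1.

(** * Closure of C^1 and C^2 functions under algebra and composition *)

Section C1closure.
Variable R : realType.

Section ClosedClass.
Variables (p : nat) (P : ('rV[R]_p -> R) -> Prop).
Hypothesis Pc : forall c, P (fun=> c).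
Hypothesis Pa : forall f g, P f -> P g -> P (fun w => f w + g w).
Hypothesis Pm : forall f g, P f -> P g -> P (fun w => f w * g w).

(** The class [P] is abstract because [C1_on W] and [C2_on W] are both instances; sums, determinants
    and adjugates are treated once for the two. *)
Lemma class_sum (I : Type) (r : seq I) (Q : pred I) (f : I -> 'rV[R]_p -> R) :
  (forall i, Q i -> P (f i)) -> P (fun w => \sum_(i <- r | Q i) f i w).
Proof.
move=> cf; elim: r => [|i r IH].
  by under eq_fun do rewrite big_nil.
under eq_fun do rewrite big_cons.
by case Qi: (Q i) => //; apply: Pa => //; exact: cf.
Qed.

Lemma class_prod (I : Type) (r : seq I) (Q : pred I) (f : I -> 'rV[R]_p -> R) :
  (forall i, Q i -> P (f i)) -> P (fun w => \prod_(i <- r | Q i) f i w).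
Proof.
move=> cf; elim: r => [|i r IH].
  by under eq_fun do rewrite big_nil.
under eq_fun do rewrite big_cons.
by case Qi: (Q i) => //; apply: Pm => //; exact: cf.
Qed.

Lemma class_mulmx m n q (A : 'rV[R]_p -> 'M[R]_(m, n)) (B : 'rV[R]_p -> 'M[R]_(n, q)) :
  (forall i j, P (fun w => A w i j)) -> (forall i j, P (fun w => B w i j)) ->
  forall i j, P (fun w => (A w *m B w) i j).
Proof.
move=> cA cB i j; under eq_fun do rewrite mxE.
by apply: class_sum => k _; apply: Pm.
Qed.

Lemma class_det n (A : 'rV[R]_p -> 'M[R]_n) :
  (forall i j, P (fun w => A w i j)) -> P (fun w => \det (A w)).
Proof.
move=> cA; rewrite /determinant; apply: class_sum => s _.
by apply: Pm => //; apply: class_prod => i _.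
Qed.

Lemma class_invmx n (A : 'rV[R]_p -> 'M[R]_n) :
  (forall i j, P (fun w => A w i j)) -> P (fun w => (\det (A w))^-1) ->
  forall i j, P (fun w => (\det (A w))^-1 * cofactor (A w) j i).
Proof.
move=> cA cd i j; apply: Pm => //; rewrite /cofactor; apply: Pm => //.
by apply: class_det => k l; under eq_fun do rewrite !mxE.
Qed.

End ClosedClass.

Lemma is_deriveV_fun (V : normedModType R) (f : V -> R) (x v : V) df : f x != 0 ->
  is_derive x v f df -> is_derive x v (fun x => (f x)^-1) (- ((f x)^-1 * (f x)^-1) * df).
Proof.
move=> fx0 [d1 d2]; split; first exact: derivableV.
by rewrite (deriveV fx0 d1) d2 -exprVn expr2 [LHS]/(_ * _).
Qed.

Lemma C1_intro p (W : set 'rV[R]_p) (g : 'rV[R]_p -> R) (dg : 'I_p -> 'rV[R]_p -> R) :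
  open W -> (forall k w, W w -> is_derive w (ebasis R k) g (dg k w)) ->
  (forall k w, W w -> {for w, continuous (dg k)}) -> C1_on W g.
Proof.
move=> oW Hd Hc; split=> k w Ww; first exact: (@ex_derive _ _ _ _ _ _ _ (Hd k w Ww)).
have E : \forall v \near w, dg k v = partial k g v.
  near=> v; rewrite /partial; have Wv : W v by near: v; exact: open_nbhs_nbhs.
  by have ->// := @derive_val _ _ _ _ _ _ _ (Hd k v Wv).
exact: (cont_near E (Hc k w Ww)).
Unshelve. all: by end_near. Qed.

Lemma C1_is_derive p (W : set 'rV[R]_p) g k w : C1_on W g -> W w ->
  is_derive w (ebasis R k) g (partial k g w).
Proof. by move=> [H _] Ww; apply: DeriveDef => //; exact: H. Qed.

Lemma C1_continuous p (W : set 'rV[R]_p) g w : open W -> C1_on W g -> W w ->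
  {for w, continuous g}.
Proof.
move=> oW cg Ww; apply/cont_distP => e e0.
have := C1_strict oW cg Ww (@ltr01 R).
move=> Hd; near (0:R)^'+ => d.
have d0 : 0 < d by near: d; exact: nbhs_right_gt.
have Hd2 x y : `|x - w| < d -> `|y - w| < d -> W x /\
   `|g x - g y - \sum_k (x - y) 0 k * partial k g w| <= 1 * `|x - y|.
  by move: x y; near: d.
pose K := 1 + \sum_k `|partial k g w|.
have K0 : 0 < K by rewrite ltr_pwDl// sumr_ge0.
have eK : 0 < e / K by rewrite divr_gt0.
near=> x.
have xd : `|x - w| < d.
  by near: x; have /cvgrPdist_lt : id x @[x --> w] --> w by []; move=> /(_ d d0);
     apply: filterS => x; rewrite distrC.
have xe : `|x - w| <= e / K.
  by near: x; have /cvgrPdist_le : id x @[x --> w] --> w by []; move=> /(_ _ eK);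
     apply: filterS => x; rewrite distrC.
have [|_] := Hd2 x w xd; first by rewrite subrr normr0.
rewrite mul1r => H; rewrite distrC.
rewrite -[g x - g w](subrK (\sum_k (x - w) 0 k * partial k g w)).
apply: le_trans (ler_normD _ _) _.
apply: (@le_trans _ _ (K * `|x - w|)); last by rewrite mulrC -ler_pdivlMr.
rewrite /K mulrDl mul1r lerD// mulr_suml; apply: le_trans (ler_norm_sum _ _ _) _.
by apply: ler_sum => k _; rewrite normrM mulrC ler_wpM2l// le_mx_norm.
Unshelve. all: by end_near. Qed.

Lemma C1_eq p (W : set 'rV[R]_p) g g' : open W -> (forall w, W w -> g w = g' w) ->
  C1_on W g -> C1_on W g'.
Proof.
move=> oW E cg; apply: (C1_intro (dg := fun k => partial k g)) => // k w Ww.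
  apply: near_eq_is_derive (C1_is_derive k cg Ww).
  by near=> v; apply: E; near: v; exact: open_nbhs_nbhs.
exact: (cg.2).
Unshelve. all: by end_near. Qed.

Lemma partial_eq p (W : set 'rV[R]_p) g g' k w : open W ->
  (forall w, W w -> g w = g' w) -> W w -> partial k g w = partial k g' w.
Proof.
move=> oW E Ww; apply: near_eq_derive.
by near=> v; apply: E; near: v; exact: open_nbhs_nbhs.
Unshelve. all: by end_near. Qed.

Lemma C1_sub p (W W' : set 'rV[R]_p) g : W' `<=` W -> C1_on W g -> C1_on W' g.
Proof. by move=> sub [H1 H2]; split=> k w /sub; [exact: H1|exact: H2]. Qed.

Lemma C1_comp_is_derive p q (W : set 'rV[R]_p) (U : set 'rV[R]_q)
    (f : 'rV[R]_p -> 'rV[R]_q) (g : 'rV[R]_q -> R) k w :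
  open U -> (forall l, C1_on W (fun w => f w 0 l)) ->
  C1_on U g -> W w -> U (f w) ->
  is_derive w (ebasis R k) (g \o f)
    (\sum_l partial k (fun w => f w 0 l) w * partial l g (f w)).
Proof.
move=> oU cf cg Ww Ufw.
have := @C1_derive_comp R _ q U g f w (ebasis R k)
  (\row_l partial k (fun w => f w 0 l) w) oU cg Ufw.
have -> : \sum_l partial k (fun w => f w 0 l) w * partial l g (f w) =
   \sum_l (\row_l partial k (fun w => f w 0 l) w) 0 l * partial l g (f w).
  by apply: eq_bigr => l _; rewrite mxE.
by apply => l; rewrite mxE; exact: C1_is_derive (cf l) Ww.
Qed.

Lemma C1_continuous_row p q (W : set 'rV[R]_p) (f : 'rV[R]_p -> 'rV[R]_q) w :
  open W -> (forall l, C1_on W (fun w => f w 0 l)) -> W w -> {for w, continuous f}.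
Proof.
by move=> oW cf Ww; apply/cont_mxP => i j; rewrite ord1; exact: C1_continuous (cf j) Ww.
Qed.

Lemma C1_comp p q (W : set 'rV[R]_p) (U : set 'rV[R]_q)
    (f : 'rV[R]_p -> 'rV[R]_q) (g : 'rV[R]_q -> R) :
  open W -> open U -> (forall l, C1_on W (fun w => f w 0 l)) ->
  C1_on U g -> (forall w, W w -> U (f w)) -> C1_on W (g \o f).
Proof.
move=> oW oU cf cg fWU.
apply: C1_intro (fun k w Ww => C1_comp_is_derive k oU cf cg Ww (fWU w Ww)) _ => // k w Ww.
apply: cont_sum => l _; apply: cont_mul; first exact: (cf l).2.
apply: (@continuous_comp _ _ _ f (partial l g)); last exact: cg.2 (fWU w Ww).
exact: C1_continuous_row cf Ww.
Qed.

Lemma C1_cst p (W : set 'rV[R]_p) (c : R) : open W -> C1_on W (fun=> c).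
Proof.
move=> oW; apply: (C1_intro (dg := fun _ _ => 0)) => // k w Ww.
exact: cst_continuous.
Qed.

Lemma C1_add p (W : set 'rV[R]_p) f g : open W -> C1_on W f -> C1_on W g ->
  C1_on W (fun w => f w + g w).
Proof.
move=> oW cf cg.
apply: (C1_intro (dg := fun k w => partial k f w + partial k g w)) => // k w Ww.
  by apply: is_deriveD; exact: C1_is_derive Ww.
by apply: cont_add; [exact: cf.2|exact: cg.2].
Qed.

Lemma C1_mul p (W : set 'rV[R]_p) f g : open W -> C1_on W f -> C1_on W g ->
  C1_on W (fun w => f w * g w).
Proof.
move=> oW cf cg.
apply: (C1_intro (dg := fun k w => f w *: partial k g w + g w *: partial k f w)) => // k w Ww.
  by apply: is_deriveM; exact: C1_is_derive Ww.
apply: cont_add.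
  by apply: cont_mul; [exact: (C1_continuous oW cf)|exact: cg.2].
by apply: cont_mul; [exact: (C1_continuous oW cg)|exact: cf.2].
Qed.

Lemma C1_inv p (W : set 'rV[R]_p) f : open W -> C1_on W f -> (forall w, W w -> f w != 0) ->
  C1_on W (fun w => (f w)^-1).
Proof.
move=> oW cf f0.
apply: (C1_intro (dg := fun k w => - ((f w)^-1 * (f w)^-1) * partial k f w)) => // k w Ww.
  by apply: is_deriveV_fun; [exact: f0|exact: C1_is_derive Ww].
have cfV : {for w, continuous (fun w => (f w)^-1)}.
  by apply: cont_inv; [exact: f0|exact: C1_continuous Ww].
by apply: cont_mul; [apply: cont_opp; exact: cont_mul|exact: cf.2].
Qed.

Lemma is_derive_coord p (w v : 'rV[R]_p) k : is_derive w v (fun w => w 0 k) (v 0 k).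
Proof.
apply/is_deriveP; apply: cvg_near_cst; near=> h.
have h0 : h != 0 by near: h; exact: nbhs_dnbhs_neq.
by rewrite !mxE addrK [LHS]mulrA mulVf// mul1r.
Unshelve. all: by end_near. Qed.

Lemma C1_sum p (W : set 'rV[R]_p) (I : Type) (r : seq I) (P : pred I) (f : I -> 'rV[R]_p -> R) :
  open W -> (forall i, P i -> C1_on W (f i)) -> C1_on W (fun w => \sum_(i <- r | P i) f i w).
Proof.
move=> oW cf.
exact: (@class_sum p (C1_on W) (fun c => C1_cst c oW) (fun f g => @C1_add p W f g oW) I r P f cf).
Qed.

Lemma C2P p (W : set 'rV[R]_p) g : open W ->
  C2_on W g <-> C1_on W g /\ forall k, C1_on W (partial k g).
Proof.
move=> oW; split=> [[H1 H2 H3 H4 H5]|[H1 H2]].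
  exact: (conj (conj H2 H3) (fun k => conj (H4 k) (H5 k))).
exact: (And5 (fun w Ww => C1_continuous oW H1 Ww) H1.1 H1.2 (fun k => (H2 k).1) (fun k => (H2 k).2)).
Qed.

Lemma C2_C1 p (W : set 'rV[R]_p) g : open W -> C2_on W g -> C1_on W g.
Proof. by move=> oW cg; exact: ((C2P g oW).1 cg).1. Qed.

Lemma C2_partial p (W : set 'rV[R]_p) g k : open W -> C2_on W g -> C1_on W (partial k g).
Proof. by move=> oW cg; exact: ((C2P g oW).1 cg).2. Qed.

(** Sums, products, inverses and composites are shown to be C^2 in this way: exhibit the gradient
    and recognize it as C^1, without computing second derivatives. *)
Lemma C2_intro p (W : set 'rV[R]_p) (g : 'rV[R]_p -> R) (dg : 'I_p -> 'rV[R]_p -> R) :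
  open W -> (forall k w, W w -> is_derive w (ebasis R k) g (dg k w)) ->
  (forall k, C1_on W (dg k)) -> C2_on W g.
Proof.
move=> oW Hd Hc; apply/(C2P g oW); split=> [|k].
  by apply: (C1_intro oW Hd) => k w Ww; exact: (C1_continuous oW (Hc k) Ww).
apply: (C1_eq oW _ (Hc k)) => w Ww.
by have := @derive_val _ _ _ _ _ _ _ (Hd k w Ww).
Qed.

Lemma C2_eq p (W : set 'rV[R]_p) g g' : open W -> (forall w, W w -> g w = g' w) ->
  C2_on W g -> C2_on W g'.
Proof.
move=> oW E cg; apply/(C2P g' oW); split; first exact: (C1_eq oW E (C2_C1 oW cg)).
move=> k; apply: (C1_eq oW _ (C2_partial k oW cg)) => w Ww.
exact: (partial_eq k oW E Ww).
Qed.

Lemma C2_sub p (W W' : set 'rV[R]_p) g : W' `<=` W -> C2_on W g -> C2_on W' g.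
Proof. by move=> sub [H1 H2 H3 H4 H5]; split=> [w|k w|k w|k l w|k l w] /sub; [exact: H1|exact: H2|exact: H3|exact: H4|exact: H5]. Qed.

Lemma C2_comp p q (W : set 'rV[R]_p) (U : set 'rV[R]_q)
    (f : 'rV[R]_p -> 'rV[R]_q) (g : 'rV[R]_q -> R) :
  open W -> open U -> (forall l, C2_on W (fun w => f w 0 l)) ->
  C2_on U g -> (forall w, W w -> U (f w)) -> C2_on W (g \o f).
Proof.
move=> oW oU cf cg fWU; have cf1 l := C2_C1 oW (cf l); have cg1 := C2_C1 oU cg.
apply: C2_intro (fun k w Ww => C1_comp_is_derive k oU cf1 cg1 Ww (fWU w Ww)) _ => // k.
apply: C1_sum => // l _; apply: C1_mul => //; first exact: C2_partial.
exact: (C1_comp oW oU cf1 (C2_partial l oU cg)).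
Qed.

Lemma C2_cst p (W : set 'rV[R]_p) (c : R) : open W -> C2_on W (fun=> c).
Proof.
move=> oW; apply: (C2_intro (dg := fun _ _ => 0)) => // k; exact: C1_cst.
Qed.

Lemma C2_coord p (W : set 'rV[R]_p) l : open W -> C2_on W (fun w => w 0 l).
Proof.
move=> oW; apply: (C2_intro (dg := fun k _ => ebasis R k 0 l)) => // k; last exact: C1_cst.
by move=> w Ww; exact: is_derive_coord.
Qed.

Lemma C2_add p (W : set 'rV[R]_p) f g : open W -> C2_on W f -> C2_on W g ->
  C2_on W (fun w => f w + g w).
Proof.
move=> oW cf cg; have cf1 := C2_C1 oW cf; have cg1 := C2_C1 oW cg.
apply: (C2_intro (dg := fun k w => partial k f w + partial k g w) oW).
  by move=> k w Ww; apply: is_deriveD; exact: C1_is_derive Ww.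
by move=> k; exact: (C1_add oW (C2_partial k oW cf) (C2_partial k oW cg)).
Qed.

Lemma C2_mul p (W : set 'rV[R]_p) f g : open W -> C2_on W f -> C2_on W g ->
  C2_on W (fun w => f w * g w).
Proof.
move=> oW cf cg; have cf1 := C2_C1 oW cf; have cg1 := C2_C1 oW cg.
apply: (C2_intro (dg := fun k w => f w *: partial k g w + g w *: partial k f w) oW).
  by move=> k w Ww; apply: is_deriveM; exact: C1_is_derive Ww.
move=> k; apply: (C1_add oW).
  exact: (C1_mul oW cf1 (C2_partial k oW cg)).
exact: (C1_mul oW cg1 (C2_partial k oW cf)).
Qed.

Lemma C2_inv p (W : set 'rV[R]_p) f : open W -> C2_on W f -> (forall w, W w -> f w != 0) ->
  C2_on W (fun w => (f w)^-1).
Proof.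
move=> oW cf f0; have cf1 := C2_C1 oW cf.
apply: (C2_intro (dg := fun k w => - ((f w)^-1 * (f w)^-1) * partial k f w) oW).
  by move=> k w Ww; apply: is_deriveV_fun; [exact: f0|exact: (C1_is_derive k cf1 Ww)].
have cV : C1_on W (fun w => (f w)^-1) by exact: (C1_inv oW cf1 f0).
move=> k; apply: (C1_mul oW _ (C2_partial k oW cf)).
apply: (C1_eq oW (g := fun w => -1 * ((f w)^-1 * (f w)^-1))); first by move=> w _; rewrite mulN1r.
exact: (C1_mul oW (C1_cst (-1) oW) (C1_mul oW cV cV)).
Qed.

Lemma C2_sum p (W : set 'rV[R]_p) (I : Type) (r : seq I) (P : pred I) (f : I -> 'rV[R]_p -> R) :
  open W -> (forall i, P i -> C2_on W (f i)) -> C2_on W (fun w => \sum_(i <- r | P i) f i w).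
Proof.
move=> oW cf.
exact: (@class_sum p (C2_on W) (fun c => C2_cst c oW) (fun f g => @C2_add p W f g oW) I r P f cf).
Qed.

Lemma invmxE n (A : 'M[R]_n) i j : A \in unitmx ->
  invmx A i j = (\det A)^-1 * cofactor A j i.
Proof. by move=> uA; rewrite /invmx uA !mxE. Qed.

Lemma C1_invmx p (W : set 'rV[R]_p) n (A : 'rV[R]_p -> 'M[R]_n) : open W ->
  (forall i j, C1_on W (fun w => A w i j)) -> (forall w, W w -> A w \in unitmx) ->
  forall i j, C1_on W (fun w => invmx (A w) i j).
Proof.
move=> oW cA uA i j.
apply: (C1_eq oW (g := fun w => (\det (A w))^-1 * cofactor (A w) j i)).
  by move=> w Ww; rewrite invmxE// uA.
have Pc c := C1_cst c oW; have Pa f g := @C1_add p W f g oW; have Pm f g := @C1_mul p W f g oW.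
apply: (class_invmx (P := C1_on W)) => //.
apply: C1_inv => //; first exact: (class_det (P := C1_on W)).
by move=> w /uA; rewrite unitmxE unitfE.
Qed.

Lemma C2_invmx p (W : set 'rV[R]_p) n (A : 'rV[R]_p -> 'M[R]_n) : open W ->
  (forall i j, C2_on W (fun w => A w i j)) -> (forall w, W w -> A w \in unitmx) ->
  forall i j, C2_on W (fun w => invmx (A w) i j).
Proof.
move=> oW cA uA i j.
apply: (C2_eq oW (g := fun w => (\det (A w))^-1 * cofactor (A w) j i)).
  by move=> w Ww; rewrite invmxE// uA.
have Pc c := C2_cst c oW; have Pa f g := @C2_add p W f g oW; have Pm f g := @C2_mul p W f g oW.
apply: (class_invmx (P := C2_on W)) => //.
apply: C2_inv => //; first exact: (class_det (P := C2_on W)).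
by move=> w /uA; rewrite unitmxE unitfE.
Qed.

Lemma C2_mulmx p (W : set 'rV[R]_p) m n q (A : 'rV[R]_p -> 'M[R]_(m, n)) (B : 'rV[R]_p -> 'M[R]_(n, q)) :
  open W -> (forall i j, C2_on W (fun w => A w i j)) -> (forall i j, C2_on W (fun w => B w i j)) ->
  forall i j, C2_on W (fun w => (A w *m B w) i j).
Proof.
move=> oW; apply: class_mulmx.
- by move=> c; exact: C2_cst.
- by move=> f g; exact: C2_add.
- by move=> f g; exact: C2_mul.
Qed.

End C1closure.

(** * The inverse function theorem *)

(** Joins completeness to the normed structure of matrices, as Banach's fixed point theorem in
    [newton_surj] requires. *)
HB.instance Definition _ (R : realType) (m n : nat) := Complete.on 'M[R]_(m, n).

Section InverseFunction.
Variable R : realType.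

Definition jac p q (f : 'rV[R]_p -> 'rV[R]_q) (w : 'rV[R]_p) : 'M[R]_(p, q) :=
  \matrix_(k, l) partial k (fun v => f v 0 l) w.

Lemma norm_mulmx_le m n q (v : 'M[R]_(m, n)) (A : 'M[R]_(n, q)) :
  `|v *m A| <= n%:R * `|A| * `|v|.
Proof.
apply: mx_norm_le => [|i j]; first by rewrite !mulr_ge0.
rewrite mxE; apply: le_trans (ler_norm_sum _ _ _) _.
apply: (@le_trans _ _ (\sum_(k < n) `|A| * `|v|)).
  by apply: ler_sum => k _; rewrite normrM mulrC ler_pM// le_mx_norm.
by rewrite sumr_const card_ord -mulrA mulr_natl.
Qed.

Lemma C1_strict_row p q (W : set 'rV[R]_p) (f : 'rV[R]_p -> 'rV[R]_q) w0 :
  open W -> (forall l, C1_on W (fun w => f w 0 l)) -> W w0 ->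
  forall e, 0 < e -> \forall d \near 0^'+, forall x y, `|x - w0| < d -> `|y - w0| < d ->
   `|f x - f y - (x - y) *m jac f w0| <= e * `|x - y|.
Proof.
move=> oW cf Ww0 e e0.
have H : \forall d \near 0^'+, forall l x y, `|x - w0| < d -> `|y - w0| < d -> W x /\
   `|f x 0 l - f y 0 l - \sum_k (x - y) 0 k * partial k (fun v => f v 0 l) w0| <= e * `|x - y|.
  by apply: filter_forall => l; exact: (C1_strict oW (cf l) Ww0 e0).
apply: filterS H => d H x y xd yd.
apply: mx_norm_le => [|i l]; first by rewrite mulr_ge0// ltW.
rewrite ord1 !mxE; have [_] := H l x y xd yd.
move=> Hl; apply: le_trans Hl; rewrite le_eqVlt; apply/orP; left; apply/eqP.
by congr (`|_ - _|); apply: eq_bigr => k _; rewrite !mxE.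
Qed.

(** The simplified Newton map [x + (y - f x) *m invmx A] contracts the closed ball by the factor
    [c * (2 * c)^-1 = 1/2], and the bound on [y - f x0] moves the centre by at most [r / 2], so the
    ball is mapped to itself. The fixed point solves [f x = y]. *)
Lemma newton_surj p (V : set 'rV[R]_p) (f : 'rV[R]_p -> 'rV[R]_p) (A : 'M[R]_p) (c : R) x0 y r :
  0 < c -> A \in unitmx -> (forall v : 'rV[R]_p, `|v *m invmx A| <= c * `|v|) ->
  (forall x x', V x -> V x' -> `|f x - f x' - (x - x') *m A| <= (2 * c)^-1 * `|x - x'|) ->
  0 < r -> (forall x, `|x - x0| <= r -> V x) -> `|y - f x0| <= r / (2 * c) ->
  exists2 x, `|x - x0| <= r & f x = y.
Proof.
move=> c0 uA Ac Vf r0 rV yr.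
pose B := [set x : 'rV[R]_p | `|x - x0| <= r].
pose h (x : 'rV[R]_p) := x + (y - f x) *m invmx A.
have hlip x x' : V x -> V x' -> `|h x - h x'| <= 2^-1 * `|x - x'|.
  move=> Vx Vx'.
  have -> : h x - h x' = - ((f x - f x' - (x - x') *m A) *m invmx A).
    rewrite /h [in RHS]mulmxBl mulmxK// !mulmxBl.
    move: (y *m _) (f x *m _) (f x' *m _) => a b b'.
    by apply/matrixP => i j; rewrite !mxE; ring.
  rewrite normrN; apply: le_trans (Ac _) _.
  apply: le_trans (ler_wpM2l (ltW c0) (Vf _ _ Vx Vx')) _.
  by rewrite mulrA invfM mulrCA divff ?mulr1// gt_eqF.
have Vx0 : V x0 by apply: rV; rewrite subrr normr0 ltW.
have hB : set_fun B B h.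
  move=> x Bx; rewrite /B /=.
  have -> : h x - x0 = (h x - h x0) + (y - f x0) *m invmx A by rewrite /h; rewrite opprD addrA subrK.
  apply: le_trans (ler_normD _ _) _.
  rewrite (splitr r) lerD//.
    apply: le_trans (hlip _ _ (rV _ Bx) Vx0) _.
    by rewrite mulrC ler_wpM2r.
  apply: le_trans (Ac _) _; apply: le_trans (ler_wpM2l (ltW c0) yr) _.
  by rewrite invfM mulrCA [c * _]mulrCA divff ?mulr1// gt_eqF.
have [hf hfE] : exists h' : {fun B >-> B}, forall x, B x -> h' x = h x.
  by exists (mkfun_fun hB).
have ctr : is_contraction hf.
  have h20 : 0 <= (2^-1 : R) by rewrite invr_ge0.
  exists (NngNum h20); split => /=; first by rewrite invf_lt1// ltr1n.
  by move=> [x x'] [/= Bx Bx']; rewrite !hfE//; apply: hlip; exact: rV.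
have clB : closed B.
  have -> : B = (fun x => `|x - x0|) @^-1` [set t | t <= r] by [].
  apply: closed_comp; last exact: closed_le.
  by move=> x _; apply: continuous_comp; [apply: continuousB => //; exact: cst_continuous|exact: norm_continuous].
have Bx0 : B x0 by rewrite /B /= subrr normr0 ltW.
have [x Bx xE] := banach_fixed_point ctr clB (ex_intro _ x0 Bx0).
exists x => //.
move: xE; rewrite hfE// /h => /eqP; rewrite -subr_eq0 opprD addrA subrr sub0r oppr_eq0 => /eqP H.
have := mulmxKV uA (y - f x); rewrite H mul0mx => /esym/eqP.
by rewrite subr_eq0 => /eqP ->.
Qed.

Lemma open_nball m n (w : 'M[R]_(m, n)) d : open [set x | `|x - w| < d].
Proof.
have -> : [set x | `|x - w| < d] = (fun x : 'M[R]_(m, n) => `|x - w|) @^-1` [set t | t < d] by [].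
apply: open_comp; last exact: open_lt.
by move=> x _; apply: continuous_comp; [apply: continuousB => //; exact: cst_continuous|exact: norm_continuous].
Qed.

Lemma near_nball m n (w : 'M[R]_(m, n)) (P : set 'M[R]_(m, n)) : (\forall x \near w, P x) ->
  exists2 d, 0 < d & forall x, `|x - w| < d -> P x.
Proof.
move=> /nbhs_ballP[d /= d0 H]; exists d => // x xd; apply: H.
by rewrite -ball_normE /= distrC.
Qed.

Lemma nball_near m n (w : 'M[R]_(m, n)) d : 0 < d -> \forall x \near w, `|x - w| < d.
Proof.
move=> d0; apply: open_nbhs_nbhs; split; first exact: open_nball.
by rewrite /= subrr normr0.
Qed.

Lemma openP m n (V : set 'M[R]_(m, n)) :
  open V <-> forall w, V w -> exists2 d, 0 < d & forall x, `|x - w| < d -> V x.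
Proof.
split=> [oV w Vw|H]; first by apply: near_nball; exact: open_nbhs_nbhs.
rewrite openE => w /H[d d0 dV]; rewrite /interior.
by apply: filterS (nball_near w d0) => x; exact: dV.
Qed.

Lemma C1_jac_unit p (W : set 'rV[R]_p) (f : 'rV[R]_p -> 'rV[R]_p) w0 :
  open W -> (forall l, C2_on W (fun w => f w 0 l)) -> W w0 -> jac f w0 \in unitmx ->
  \forall w \near w0, W w /\ jac f w \in unitmx.
Proof.
move=> oW cf Ww0 uA.
have cd : C1_on W (fun w => \det (jac f w)).
  apply: (class_det (P := C1_on W)).
  - by move=> c; exact: (C1_cst c oW).
  - by move=> u v; exact: (C1_add oW).
  - by move=> u v; exact: (C1_mul oW).
  - move=> i j; apply: (C1_eq oW _ (C2_partial i oW (cf j))) => w _.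
    by rewrite mxE.
have d0 : 0 < `|\det (jac f w0)|.
  by rewrite normr_gt0; move: uA; rewrite unitmxE unitfE.
have /cont_distP := C1_continuous oW cd Ww0.
have d2 : 0 < `|\det (jac f w0)| / 2 by rewrite divr_gt0.
move=> /(_ _ d2) H; near=> w; split; first by near: w; exact: open_nbhs_nbhs.
rewrite unitmxE unitfE; apply/negP => /eqP E.
have : `|\det (jac f w0) - \det (jac f w)| <= `|\det (jac f w0)| / 2 by near: w.
by rewrite E subr0 leNgt ltr_pdivrMr// ltr_pMr// ltr1n.
Unshelve. all: by end_near. Qed.

(** Strict differentiability of [f] bounds the error by a small multiple of the increment of [g];
    the Lipschitz bound on [g] turns this into a small multiple of [h]. *)
Lemma derive_inverse p q (f : 'rV[R]_p -> 'rV[R]_p) (g : 'rV[R]_p -> 'rV[R]_p) (F V W : set 'rV[R]_p)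
    y (c : R) :
  open W -> (forall l, C1_on W (fun w => f w 0 l)) -> W (g y) -> jac f (g y) \in unitmx ->
  open F -> F y -> (forall z, F z -> f (g z) = z) -> 0 < c ->
  (forall z z', F z -> F z' -> `|g z - g z'| <= c * `|z - z'|) ->
  forall v : 'rV[R]_p, is_derive y v (fun z => g z 0 q) ((v *m invmx (jac f (g y))) 0 q).
Proof.
move=> oW cf Wgy uJ oF Fy fg c0 glip v; set J := jac f (g y) in uJ *.
apply/is_deriveP/cvgrPdist_le => e e0.
(* [K] bounds multiplication by the inverse of [J] and [L] bounds the increment of [g] per unit of
   [h], so the error [e / (K * L)] for [f] becomes [e] for [g]. The added ones only ensure
   positivity. *)
pose K := p%:R * `|invmx J| + 1; have K0 : 0 < K by rewrite ltr_wpDl// mulr_ge0.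
pose L := c * (`|v| + 1); have L0 : 0 < L by rewrite mulr_gt0// ltr_wpDl.
have e'0 : 0 < e / (K * L) by rewrite divr_gt0// mulr_gt0.
have Hs := C1_strict_row oW cf Wgy e'0.
near (0:R)^'+ => d.
have d0 : 0 < d by near: d; exact: nbhs_right_gt.
have Hd : forall x x', `|x - g y| < d -> `|x' - g y| < d ->
   `|f x - f x' - (x - x') *m J| <= e / (K * L) * `|x - x'| by near: d.
have cl : (h *: v + y) @[h --> (0:R)^'] --> y.
  have -> : y = 0 *: v + y :> 'rV[R]_p by rewrite scale0r add0r.
  rewrite [in X in X --> _]scale0r [in X in X --> _]add0r.
  apply: cvgD; last exact: cvg_cst.
  by apply: cvgZr_tmp; exact: cvg_within.
have nF : \forall h \near (0:R)^', F (h *: v + y).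
  by apply: cl; exact: open_nbhs_nbhs.
have dc : 0 < d / c by rewrite divr_gt0.
have nD : \forall h \near (0:R)^', `|y - (h *: v + y)| < d / c.
  by move/cvgrPdist_lt : cl; apply.
near=> h.
have h0 : h != 0 by near: h; exact: nbhs_dnbhs_neq.
have Fh : F (h *: v + y) by near: h.
have nDh : `|y - (h *: v + y)| < d / c by near: h.
set yh := h *: v + y in Fh nDh *.
have yhy : yh - y = h *: v by rewrite /yh addrK.
have glh : `|g yh - g y| <= c * (`|h| * `|v|) by rewrite -normrZ -yhy; exact: glip.
have gd : `|g yh - g y| < d.
  apply: le_lt_trans (glip _ _ Fh Fy) _; rewrite mulrC -ltr_pdivlMr//.
  by rewrite distrC.
have := Hd _ (g y) gd; rewrite subrr normr0 => /(_ d0).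
rewrite !fg// yhy => H.
have E : (v *m invmx J) 0 q - h^-1 *: (g yh 0 q - g y 0 q) =
   h^-1 * (((h *: v - (g yh - g y) *m J) *m invmx J) 0 q).
  rewrite mulmxBl mulmxK// -scalemxAl; move: (v *m _) => a.
  by rewrite !mxE [_ *: _]/(_ * _) mulrBr mulrA mulVf// mul1r.
rewrite E normrM normfV ler_pdivrMl ?normr_gt0//.
apply: le_trans (le_mx_norm _ _ _) _; apply: le_trans (norm_mulmx_le _ _) _.
apply: (@le_trans _ _ (K * (e / (K * L) * (c * (`|h| * `|v|))))).
  apply: ler_pM => //; first by rewrite /K lerDl.
  by apply: le_trans H _; rewrite ler_wpM2l// ltW.
have -> : K * (e / (K * L) * (c * (`|h| * `|v|))) = `|h| * e * (c * `|v| / L).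
  by field; rewrite !gt_eqF.
rewrite ler_piMr ?mulr_ge0 ?(ltW e0)// ler_pdivrMr// mul1r /L ler_wpM2l ?(ltW c0)//.
by rewrite lerDl.
Unshelve. all: by end_near. Qed.

Lemma inverse_function p (W : set 'rV[R]_p) (f : 'rV[R]_p -> 'rV[R]_p) w0 :
  open W -> (forall l, C2_on W (fun w => f w 0 l)) -> W w0 -> jac f w0 \in unitmx ->
  exists (V : set 'rV[R]_p) (g : 'rV[R]_p -> 'rV[R]_p),
  [/\ open V, V w0, V `<=` W & forall w, V w -> jac f w \in unitmx] /\
  [/\ forall w, V w -> g (f w) = w,
      forall V' : set 'rV[R]_p, open V' -> V' `<=` V -> open (f @` V') &
      forall l, C2_on (f @` V) (fun y => g y 0 l)].
Proof.
move=> oW cf Ww0 uA; have cf1 l := C2_C1 oW (cf l); set A := jac f w0 in uA.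
pose c := p%:R * `|invmx A| + 1; have c0 : 0 < c by rewrite ltr_wpDl// mulr_ge0.
have e0 : 0 < (2 * c)^-1 by rewrite invr_gt0 mulr_gt0.
(* [c] bounds multiplication by the inverse of [A]. An error [(2 * c)^-1] costs at most half of the
   expansion that [A] guarantees: [f] stays injective with Lipschitz inverse, and [newton_surj]
   applies. *)
have Hs := C1_strict_row oW cf1 Ww0 e0.
have [r r0 Hr] := near_nball (C1_jac_unit oW cf Ww0 uA).
near (0:R)^'+ => d.
have d0 : 0 < d by near: d; exact: nbhs_right_gt.
have dr : d < r by near: d; exact: nbhs_right_lt.
have Vf0 : forall x x', `|x - w0| < d -> `|x' - w0| < d ->
    `|f x - f x' - (x - x') *m A| <= (2 * c)^-1 * `|x - x'| by near: d.
pose V := [set x | `|x - w0| < d].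
have Vf : forall x x', V x -> V x' -> `|f x - f x' - (x - x') *m A| <= (2 * c)^-1 * `|x - x'| by exact: Vf0.
have oV : open V by exact: open_nball.
have VW : V `<=` W by move=> x Vx; apply: (Hr x _).1; exact: lt_trans dr.
have VJ x : V x -> jac f x \in unitmx by move=> Vx; apply: (Hr x _).2; exact: lt_trans dr.
have Ac (v : 'rV[R]_p) : `|v *m invmx A| <= c * `|v|.
  by apply: le_trans (norm_mulmx_le _ _) _; rewrite ler_wpM2r// lerDl.
have low x x' : V x -> V x' -> `|x - x'| <= 2 * c * `|f x - f x'|.
  move=> Vx Vx'; have := Vf _ _ Vx Vx'; set D := f x - f x' => HD.
  have : `|x - x'| <= c * (`|D| + (2 * c)^-1 * `|x - x'|).
    rewrite -{1}[x - x'](mulmxK uA); apply: le_trans (Ac _) _; rewrite ler_wpM2l ?(ltW c0)//.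
    rewrite -[_ *m A](subKr D); apply: le_trans (ler_normB _ _) _.
    by rewrite lerD2l.
  rewrite mulrDr mulrA invfM mulrCA divff ?gt_eqF// mulr1.
  move: (`|x - x'|) (c * `|D|) (mulrA 2 c `|D|) => a b <-; lra.
have surj x0 y r' : 0 < r' -> (forall x, `|x - x0| <= r' -> V x) -> `|y - f x0| <= r' / (2 * c) ->
  exists2 x, `|x - x0| <= r' & f x = y by exact: (@newton_surj p V f A c x0 y r' c0 uA Ac Vf).
have fopen V' : open V' -> V' `<=` V -> open (f @` V').
  move=> oV' V'V; apply/openP => _ [x V'x <-].
  have [t t0 Ht] := (openP V').1 oV' x V'x.
  have t20 : 0 < t / 2 by rewrite divr_gt0.
  exists (t / 2 / (2 * c)); first by rewrite divr_gt0// mulr_gt0.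
  have tV' z : `|z - x| <= t / 2 -> V' z.
    by move=> zx; apply: Ht; apply: le_lt_trans zx _; rewrite ltr_pdivrMr// ltr_pMr// ltr1n.
  move=> y yd; have [z zx <-] := surj x y (t / 2) t20 (fun z zx => V'V _ (tV' _ zx)) (ltW yd).
  by exists z => //; exact: tV'.
pose g y := xget w0 [set x | V x /\ f x = y].
have gf x : V x -> g (f x) = x.
  move=> Vx; rewrite /g; case: xgetP => [x' _ [Vx' E]|/(_ x)]; last by move=> H; exfalso; exact: H.
  by apply/eqP; rewrite -subr_eq0 -normr_le0; apply: le_trans (low _ _ Vx' Vx) _; rewrite E subrr normr0 mulr0.
have c20 : 0 < 2 * c by rewrite mulr_gt0.
have oF : open (f @` V) by exact: fopen.
have fg y : (f @` V) y -> V (g y) /\ f (g y) = y by move=> [x Vx <-]; rewrite gf.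
have glip z z' : (f @` V) z -> (f @` V) z' -> `|g z - g z'| <= 2 * c * `|z - z'|.
  by move=> /fg[V1 E1] /fg[V2 E2]; rewrite -{2}E1 -{2}E2; exact: low.
have gd k l y : (f @` V) y -> is_derive y (ebasis R k) (fun z => g z 0 l) (invmx (jac f (g y)) k l).
  move=> Fy; have [Vg E] := fg _ Fy.
  have := @derive_inverse p l f g (f @` V) V W y (2 * c) oW cf1 (VW _ Vg) (VJ _ Vg) oF Fy
    (fun z Fz => (fg z Fz).2) c20 glip (ebasis R k).
  by rewrite -rowE mxE.
have cinv k l : C1_on V (fun w => invmx (jac f w) k l).
  apply: (C1_invmx oV _ VJ) => i j.
  apply: (C1_eq oV _ (C1_sub VW (C2_partial i oW (cf j)))) => w _.
  by rewrite mxE.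
have cg y : (f @` V) y -> {for y, continuous g}.
  move=> Fy; apply/(@cvgrPdist_le _ _ _ (nbhs y)) => e e0'.
  have ec : 0 < e / (2 * c) by rewrite divr_gt0.
  have H1 : \forall z \near y, (f @` V) z by exact: open_nbhs_nbhs.
  have H2 := nball_near y ec.
  apply: filterS2 H1 H2 => z Fz yz; apply: le_trans (glip _ _ Fy Fz) _.
  by rewrite mulrC -ler_pdivlMr// distrC ltW.
have cg1 l : C1_on (f @` V) (fun y => g y 0 l).
  apply: (C1_intro oF (fun k y Fy => gd k l y Fy)) => k y Fy.
  apply: (@continuous_comp _ _ _ g (fun w => invmx (jac f w) k l)); first exact: cg.
  exact: (C1_continuous oV (cinv k l) (fg y Fy).1).
exists V, g; split; first by split=> //; rewrite /V /= subrr normr0.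
(* The jacobian of [g] is the inverse of [jac f] taken along [g]; now that [g] is C^1, so is this
   jacobian, and [g] is C^2. *)
split=> // l; apply: (C2_intro oF (fun k y Fy => gd k l y Fy)) => k.
exact: (C1_comp oF oV cg1 (cinv k l) (fun y Fy => (fg y Fy).1)).
Unshelve. all: by end_near. Qed.

End InverseFunction.

(** * Spectral decomposition *)

Section Spectral.
Variables (R : realType) (n : nat).
Implicit Types (X Q : 'M[R]_n) (x : 'rV[R]_n).

(** The order of [x] is part of the notion, so that [x] is determined by [X] ([eigvalsE]), while [Q]
    is not. *)
Definition eigsys X Q x := [/\ Q^T *m Q = 1%:M, X = Q *m diag_mx x *m Q^T & nonincr x].

Lemma orthC Q : Q^T *m Q = 1%:M -> Q *m Q^T = 1%:M.
Proof. exact: mulmx1C. Qed.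

Lemma eigsys_diag X Q x : eigsys X Q x -> Q^T *m X *m Q = diag_mx x.
Proof.
by move=> [oQ -> _]; rewrite !mulmxA oQ mul1mx -mulmxA oQ mulmx1.
Qed.

Lemma orth_entry Q i j : Q^T *m Q = 1%:M -> `|Q i j| <= 1.
Proof.
move=> /matrixP/(_ j j); rewrite !mxE eqxx /= => H.
rewrite -[leRHS]normr1 -(ler_pXn2r (n := 2))// ?nnegrE// -!normrX.
rewrite expr1n normr1 ger0_norm ?sqr_ge0// -[leRHS](H : _ = 1).
rewrite (bigD1 i)//= mxE expr2 lerDl sumr_ge0// => k _.
by rewrite mxE -expr2 sqr_ge0.
Qed.

Lemma vec_mx_continuous m p : continuous (@vec_mx R m p).
Proof.
move=> v; apply/cont_mxP => i j.
have -> : (fun x : 'rV[R]_(m * p) => vec_mx x i j) = fun x : 'rV[R]_(m * p) => x 0 (mxvec_index i j).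
  by apply/funext => x; rewrite mxE.
exact: cont_coord.
Qed.

Lemma cont_id_mx m p (A : 'M[R]_(m, p)) : {for A, continuous (fun B : 'M[R]_(m, p) => B)}.
Proof. by []. Qed.

Lemma closed_mx_eq (T : topologicalType) m p (f : T -> 'M[R]_(m, p)) (c : 'M[R]_(m, p)) :
  (forall x : T, {for x, continuous f}) -> closed [set x | f x = c].
Proof.
move=> cf.
have -> : [set x | f x = c] = (fun x : T => `|f x - c|) @^-1` [set t | t <= 0].
  apply/seteqP; split=> x /=; first by move=> ->; rewrite subrr normr0.
  by rewrite normr_le0 subr_eq0 => /eqP.
apply: closed_comp; last exact: closed_le.
move=> x _; apply: continuous_comp; last exact: norm_continuous.
by apply: continuousB; [exact: cf|exact: cst_continuous].
Qed.

Lemma compact_orth : compact [set Q : 'M[R]_n | Q^T *m Q = 1%:M].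
Proof.
have -> : [set Q : 'M[R]_n | Q^T *m Q = 1%:M] =
   vec_mx @` [set v : 'rV[R]_(n * n) | (vec_mx v)^T *m vec_mx v = 1%:M].
  apply/seteqP; split=> [Q /= oQ|Q /= [v vQ <-]//].
  by exists (mxvec Q) => //=; rewrite mxvecK.
apply: continuous_compact.
  by apply: continuous_subspaceT; exact: vec_mx_continuous.
apply: bounded_closed_compact.
  exists 1; split=> // M M1 v /= vo; apply: le_trans (ltW M1).
  apply: mx_norm_le => // i j; rewrite ord1.
  case/mxvec_indexP: j => a b.
  by have := orth_entry a b vo; rewrite mxE.
apply: closed_mx_eq => v; apply: cont_mulmx; last exact: vec_mx_continuous.
by apply: cont_trmx; exact: vec_mx_continuous.
Qed.

Section Rotation.
Variables (Q : 'M[R]_n) (i j : 'I_n) (u v : R).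
Hypotheses (ij : i != j) (uv : u ^+ 2 + v ^+ 2 = 1).

(** A Givens rotation with cosine [u] and sine [v] applied to the columns [i] and [j] of [Q]. *)
Definition rot2 : 'M[R]_n := \matrix_(a, k) (if k == i then u * Q a i + v * Q a j
  else if k == j then u * Q a j - v * Q a i else Q a k).

Lemma formE (Y P : 'M[R]_n) k l : (P^T *m Y *m P) k l = \sum_a \sum_b P a k * Y a b * P b l.
Proof.
rewrite mxE exchange_big /=; apply: eq_bigr => b _; rewrite mxE mulr_suml.
by apply: eq_bigr => a _; rewrite mxE.
Qed.

Let B (Y : 'M[R]_n) k l := (Q^T *m Y *m Q) k l.

Lemma rot2_form (Y : 'M[R]_n) k l : (rot2^T *m Y *m rot2) k l =
  (if k == i then u else if k == j then - v else 1) * (if l == i then u else if l == j then - v else 1) *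
    B Y (if k == j then i else k) (if l == j then i else l) +
  (if k == i then u else if k == j then - v else 1) * (if l == i then v else if l == j then u else 0) *
    B Y (if k == j then i else k) j +
  (if k == i then v else if k == j then u else 0) * (if l == i then u else if l == j then - v else 1) *
    B Y j (if l == j then i else l) +
  (if k == i then v else if k == j then u else 0) * (if l == i then v else if l == j then u else 0) *
    B Y j j.
Proof.
rewrite /B !formE !mulr_sumr -!big_split /=; apply: eq_bigr => a _.
rewrite !mulr_sumr -!big_split /=; apply: eq_bigr => b _; rewrite !mxE.
have [ki|ki] := eqVneq k i; have [li|li] := eqVneq l i; rewrite ?ki ?li ?(negbTE ij);
  by [ring | case: eqVneq => _; ring | case: eqVneq => _; case: eqVneq => _; ring].
Qed.

Lemma rot2_orth : Q^T *m Q = 1%:M -> rot2^T *m rot2 = 1%:M.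
Proof.
move=> oQ; apply/matrixP => k l.
have := rot2_form 1%:M k l; rewrite !mulmx1 => ->.
have BE a b : B 1%:M a b = (a == b)%:R by rewrite /B mulmx1 oQ mxE.
rewrite !BE mxE eqxx; have E : v * v = 1 - u * u by move: uv; rewrite !expr2 => <-; ring.
have ji : (j == i) = false by rewrite eq_sym (negbTE ij).
have [->|ki] := eqVneq k i; have [->|li] := eqVneq l i; rewrite ?eqxx ?(negbTE ij) ?ji /=.
- by rewrite ?eqxx ?(negbTE ij) ?ji /=; ring: E.
- have [lj|lj] := eqVneq l j; rewrite ?eqxx ?(negbTE ij) ?ji /=; first by ring.
  by rewrite !(eq_sym _ l) (negbTE li) (negbTE lj) /=; ring.
- rewrite (negbTE ki); have [kj|kj] := eqVneq k j; rewrite ?eqxx ?(negbTE ij) ?ji /=; first by ring.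
  by rewrite (negbTE ki) (negbTE kj) /=; ring.
- have [kj|kj] := eqVneq k j; have [lj|lj] := eqVneq l j; rewrite ?kj ?lj ?eqxx ?(negbTE ij) ?ji /=.
  + by ring: E.
  + by rewrite !(eq_sym _ l) (negbTE li) (negbTE lj) /=; ring.
  + by rewrite (negbTE ki) (negbTE kj) /=; ring.
  + by rewrite !(eq_sym j) (negbTE kj) (negbTE lj) /=; ring.
Qed.

End Rotation.

Lemma offdiag0_diag_mx (B : 'M[R]_n) : (forall i j, i != j -> B i j = 0) ->
  B = diag_mx (\row_i B i i).
Proof.
move=> B0; apply/matrixP => i j; rewrite !mxE; have [<-|ij] := eqVneq i j; first by rewrite mulr1n.
by rewrite mulr0n B0.
Qed.

(** Maximize the diagonal of [Q^T *m X *m Q], weighted by strictly decreasing [w], over the compact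
    orthogonal group. Maximality against plane rotations kills the entries off the diagonal and,
    thanks to the weights, sorts the diagonal as well. *)
Lemma spectral X : Defs.symmetric X -> exists Q x, eigsys X Q x.
Proof.
move=> sX; pose w (i : 'I_n) : R := (n - i)%:R.
pose phi Q := \sum_i w i * (Q^T *m X *m Q) i i.
have cphi : continuous phi.
  move=> Q; apply: cont_sum => i _; apply: cont_mul; first exact: cont_cst.
  apply: ((cont_mxP _ _).1 _ i i).
  apply: cont_mulmx; last exact: cont_id_mx.
  apply: cont_mulmx; last exact: cont_cst.
  by apply: cont_trmx; exact: cont_id_mx.
have ne : [set Q : 'M[R]_n | Q^T *m Q = 1%:M] !=set0 by exists 1%:M; rewrite /= trmx1 mulmx1.
have [Q0 oQ0 maxQ] := @compact_EVT_max _ _ phi _ ne compact_orth (continuous_subspaceT cphi).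
rewrite inE /= in oQ0.
pose B := Q0^T *m X *m Q0.
have Bs : B^T = B by rewrite /B !trmx_mul trmxK sX mulmxA.
have Bsym k l : B k l = B l k by rewrite -[in LHS]Bs mxE.
(* The rotation changes [phi] by [(w i - w j) * (2 * u * v * B i j - v ^+ 2 * (B i i - B j j))],
   which cannot be positive at the maximum. *)
have key (i j : 'I_n) u v : (i < j)%N -> u ^+ 2 + v ^+ 2 = 1 ->
   2 * u * v * B i j <= v ^+ 2 * (B i i - B j j).
  move=> ij uv; have nij : i != j by rewrite neq_ltn ij.
  have := maxQ (rot2 Q0 i j u v); rewrite inE /= => /(_ (rot2_orth nij uv oQ0)).
  have ji : (j == i) = false by rewrite eq_sym (negbTE nij).
  rewrite /phi (bigD1 i)//= (bigD1 j) ?ji//= [leRHS](bigD1 i)//= [X in _ <= _ + X](bigD1 j) ?ji//=.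
  have -> : \sum_(k < n | (k != i) && (k != j)) w k * ((rot2 Q0 i j u v)^T *m X *m rot2 Q0 i j u v) k k
     = \sum_(k < n | (k != i) && (k != j)) w k * (Q0^T *m X *m Q0) k k.
    apply: eq_bigr => k /andP[ki kj]; congr (_ * _).
    by rewrite rot2_form// (negbTE ki) (negbTE kj); ring.
  rewrite !rot2_form// !eqxx (negbTE nij) ji -/B (Bsym j i).
  have wij : w j < w i.
    by rewrite /w ltr_nat ltn_sub2l// (leq_ltn_trans _ (ltn_ord j)) // ltnW.
  rewrite !addrA lerD2r => H.
  rewrite -(ler_pM2l (x := w i - w j)) ?subr_gt0//.
  have {uv}uv : u * u = 1 - v * v by move: uv; rewrite !expr2 => <-; ring.
  rewrite -subr_ge0; rewrite -subr_ge0 in H; move: H; congr (0 <= _).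
  by ring: uv.
have key2 (i j : 'I_n) a b : (i < j)%N -> 2 * a * b * B i j <= b ^+ 2 * (B i i - B j j).
  move=> ij; pose s := a ^+ 2 + b ^+ 2.
  have [s0|s0] := eqVneq s 0.
    have /andP[/eqP a0 /eqP b0] : (a == 0) && (b == 0).
      by move/eqP: s0; rewrite /s paddr_eq0 ?sqr_ge0// !sqrf_eq0.
    by rewrite a0 b0 !expr2 !(mul0r,mulr0).
  have sp : 0 < s by rewrite lt_neqAle eq_sym s0 addr_ge0 ?sqr_ge0.
  have r0 : 0 < Num.sqrt s by rewrite sqrtr_gt0.
  have := key i j (a / Num.sqrt s) (b / Num.sqrt s) ij.
  rewrite !expr_div_n sqr_sqrtr ?(ltW sp)// -mulrDl divff// => /(_ erefl).
  have -> : 2 * (a / Num.sqrt s) * (b / Num.sqrt s) = 2 * a * b / s.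
    by rewrite -[in RHS](sqr_sqrtr (ltW sp)); field; rewrite gt_eqF.
  by rewrite mulrAC [leRHS]mulrAC ler_pM2r// invr_gt0.
have Bge (i j : 'I_n) : (i < j)%N -> B j j <= B i i.
  by move=> ij; have := key2 i j 0 1 ij; rewrite mulr0 !mul0r expr1n mul1r subr_ge0.
have Boff (i j : 'I_n) : (i < j)%N -> B i j = 0.
  (* With [d = B i i - B j j >= 0] and [b = B i j], this choice gives
     [2 * (d + 1) * b ^+ 2 <= d * b ^+ 2], hence [b = 0]. *)
  move=> ij; have d0 := Bge i j ij; have := key2 i j (B i i - B j j + 1) (B i j) ij.
  move: d0; rewrite -subr_ge0; move: (B i i - B j j) (B i j) => d b d0 H.
  apply/eqP; rewrite -sqrf_eq0 eq_le sqr_ge0 andbT; nra.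
pose x := \row_i B i i.
have Bd : B = diag_mx x.
  apply: offdiag0_diag_mx => k l kl.
  by case: (ltngtP k l) => [|lk|/val_inj E];
     [exact: Boff | rewrite Bsym; exact: Boff | rewrite E eqxx in kl].
exists Q0, x; split=> //.
  by rewrite -Bd /B !mulmxA orthC// mul1mx -mulmxA orthC// mulmx1.
move=> i j; rewrite leq_eqVlt => /orP[/eqP/val_inj->//|ij].
have xE k : x 0 k = B k k by rewrite mxE.
by rewrite !xE Bge.
Qed.

Lemma char_poly_conj Q (D : 'M[R]_n) : Q^T *m Q = 1%:M -> char_poly (Q *m D *m Q^T) = char_poly D.
Proof.
move=> oQ; rewrite /char_poly /char_poly_mx.
have oQ' := orthC oQ.
pose P := map_mx (@polyC R) Q.
have PT : P^T = map_mx (@polyC R) Q^T by apply/matrixP => i j; rewrite !mxE.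
have PP : P *m P^T = 1%:M by rewrite PT /P -map_mxM oQ' map_mx1.
have -> : 'X%:M - map_mx (@polyC R) (Q *m D *m Q^T) = P *m ('X%:M - map_mx (@polyC R) D) *m P^T.
  have PX : P *m 'X%:M *m P^T = 'X%:M by rewrite scalar_mxC -mulmxA PP mulmx1.
  by rewrite mulmxBr mulmxBl PX PT /P !map_mxM.
by rewrite !det_mulmx mulrAC -det_mulmx PP det1 mul1r.
Qed.

Lemma is_eigvals_eigsys X Q x : eigsys X Q x -> is_eigvals X x.
Proof.
move=> [oQ -> sx]; split=> //; rewrite char_poly_conj// char_poly_trig ?diag_mx_is_trig//.
by apply: eq_bigr => i _; rewrite mxE eqxx mulr1n.
Qed.

(** Equal products have the same multiset of roots, and a sorted list is determined by its
    multiset. *)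
Lemma nonincr_inj x y : nonincr x -> nonincr y ->
  \prod_(i < n) ('X - (x 0 i)%:P) = \prod_(i < n) ('X - (y 0 i)%:P) -> x = y.
Proof.
move=> sx sy E; pose s (z : 'rV[R]_n) := [seq z 0 i | i <- enum 'I_n].
have srt z : nonincr z -> sorted (fun a b : R => b <= a) (s z).
  move=> sz; apply: pairwise_sorted; rewrite pairwise_map.
  have : sorted ltn (map val (enum 'I_n)) by rewrite val_enum_ord iota_ltn_sorted.
  rewrite sorted_map sorted_pairwise; last by move=> a b c; exact: ltn_trans.
  by apply: sub_pairwise => i j /= ij; apply: sz; exact: ltnW.
have pe : perm_eq (s x) (s y) by apply: prod_XsubC_eq; rewrite !big_map -!big_enum in E *.
have Es : s x = s y.
  apply: (@sorted_eq _ (fun a b : R => b <= a)) => //; try exact: srt.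
    by move=> a b c ba cb; exact: le_trans cb ba.
  by move=> a b /andP[ba ab]; apply/eqP; rewrite eq_le ab ba.
apply/rowP => i; have := congr1 (fun t => nth 0 t i) Es.
by rewrite /s !(nth_map i 0) ?size_enum_ord// !nth_ord_enum.
Qed.

Lemma eigvalsE X Q x : eigsys X Q x -> eigvals X = x.
Proof.
move=> H; rewrite /eigvals; case: xgetP => [y _ [sy Ey]|/(_ x)]; last first.
  by move=> F; exfalso; apply: F; exact: is_eigvals_eigsys H.
have [sx Ex] := is_eigvals_eigsys H.
by apply: nonincr_inj => //; rewrite -Ey -Ex.
Qed.

Lemma eigvals_spec X : Defs.symmetric X -> exists Q, eigsys X Q (eigvals X).
Proof. by move=> /spectral[Q [x H]]; exists Q; rewrite (eigvalsE H). Qed.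

Lemma nearS (T : topologicalType) (x : T) (P Q : T -> Prop) : (forall z, P z -> Q z) ->
  (\forall z \near x, P z) -> \forall z \near x, Q z.
Proof. by move=> PQ; apply: filterS. Qed.

Lemma near_forall (T : topologicalType) (x : T) (I : finType) (P : I -> T -> Prop) :
  (forall i, \forall z \near x, P i z) -> \forall z \near x, forall i, P i z.
Proof. exact: filter_forall. Qed.

Lemma near_and (T : topologicalType) (x : T) (P Q : T -> Prop) :
  (\forall z \near x, P z) -> (\forall z \near x, Q z) -> \forall z \near x, P z /\ Q z.
Proof. exact: filterI. Qed.

Lemma cont_gt0 (T : topologicalType) (g : T -> R) (x0 : T) :
  {for x0, continuous g} -> 0 < g x0 -> \forall z \near x0, 0 < g z.
Proof.
move=> /cont_distP cg g0; have g2 : 0 < g x0 / 2 by rewrite divr_gt0.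
apply: filterS (cg _ g2) => z; rewrite ler_norml => /andP[_]; lra.
Qed.

Lemma cont_neq0 (T : topologicalType) (g : T -> R) (x0 : T) :
  {for x0, continuous g} -> g x0 != 0 -> \forall z \near x0, g z != 0.
Proof.
move=> cg; rewrite neq_lt => /orP[g0|g0].
  have := cont_gt0 (cont_opp cg); rewrite oppr_gt0 => /(_ g0).
  by apply: filterS => z; rewrite oppr_gt0 => /lt_eqF ->.
by apply: filterS (cont_gt0 cg g0) => z /gt_eqF ->.
Qed.

Lemma cont_form (z0 : 'M[R]_n * 'M[R]_n) i j :
  {for z0, continuous (fun z : 'M[R]_n * 'M[R]_n => (z.1^T *m z.2 *m z.1) i j)}.
Proof.
apply: ((cont_mxP _ _).1 _ i j); apply: cont_mulmx; last exact: cvg_fst.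
by apply: cont_mulmx; [apply: cont_trmx; exact: cvg_fst|exact: cvg_snd].
Qed.

(* Compactness of the orthogonal group replaces continuity of eigenvectors, which fails
   at multiple eigenvalues. *)
Lemma eig_near X0 (P : 'M[R]_n -> 'M[R]_n -> Prop) :
  (forall Q0, eigsys X0 Q0 (eigvals X0) -> \forall z \near (Q0, X0), P z.2 z.1) ->
  \forall X \near X0, forall Q, eigsys X Q (eigvals X) -> P X Q.
Proof.
move=> H; have /compact_near_coveringP := compact_orth.
move=> /(_ _ (nbhs X0) (fun X Q => eigsys X Q (eigvals X) -> P X Q) _) K.
have {}K : \forall X \near X0, [set Q : 'M[R]_n | Q^T *m Q = 1%:M] `<=`
   (fun Q => eigsys X Q (eigvals X) -> P X Q).
  apply: K => Q0 /= oQ0.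
  have [E|nE] := pselect (eigsys X0 Q0 (eigvals X0)).
    by apply: (nearS _ (H _ E)) => z Pz _.
  (* Either an entry of [B] off the diagonal is nonzero or two diagonal entries are in the wrong
     order. Both conditions are open, so no pair close to [(Q0, X0)] is an eigensystem. *)
  suff : \forall z \near (Q0, X0), ~ eigsys z.2 z.1 (eigvals z.2).
    by apply: nearS => z nz /nz.
  pose B := Q0^T *m X0 *m Q0.
  have [/existsP[i /existsP[j /andP[ij Bij]]]|/existsPn Bd] :=
    boolP [exists i, exists j, (i != j) && (B i j != 0)].
    apply: (nearS _ (cont_neq0 (@cont_form (Q0, X0) i j) Bij)) => z nz /eigsys_diag Ez.
    by move: nz; rewrite Ez mxE (negbTE ij) mulr0n eqxx.
  have [/existsP[i /existsP[j /andP[ij Bij]]]|/existsPn Bs] :=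
    boolP [exists i : 'I_n, exists j : 'I_n, (i <= j)%N && (B i i < B j j)].
    have cg := cont_add (@cont_form (Q0, X0) j j) (cont_opp (@cont_form (Q0, X0) i i)).
    have := cont_gt0 cg; rewrite subr_gt0 => /(_ Bij).
    apply: nearS => z nz Ez; move: nz; rewrite (eigsys_diag Ez) !mxE !eqxx !mulr1n.
    by case: Ez => _ _ /(_ i j ij) => H1 H2; move: H1; rewrite leNgt -subr_gt0 H2.
  exfalso; apply: nE.
  have Bdiag : B = diag_mx (\row_i B i i).
    apply: offdiag0_diag_mx => i j ij.
    by have /existsPn/(_ j) := Bd i; rewrite ij /= negbK => /eqP.
  have E : eigsys X0 Q0 (\row_i B i i).
    split=> //.
      by rewrite -Bdiag /B !mulmxA orthC// mul1mx -mulmxA orthC// mulmx1.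
    have xE k : (\row_i B i i) 0 k = B k k by rewrite mxE.
    move=> i j ij; rewrite !xE leNgt.
    by have /existsPn/(_ j) := Bs i; rewrite ij.
  by rewrite (eigvalsE E).
by apply: filterS K => X K Q E; apply: K => //; case: E.
Qed.

(** The eigenvalues are the diagonal of [Q^T *m X *m Q], which is continuous in the pair [(Q, X)];
    [eig_near] then supplies the closeness of eigenbases. *)
Lemma eigvals_cont X0 e : Defs.symmetric X0 -> 0 < e ->
  \forall X \near X0, Defs.symmetric X -> `|eigvals X - eigvals X0| <= e.
Proof.
move=> sX0 e0.
have := @eig_near X0 (fun X Q => `|eigvals X - eigvals X0| <= e \/
   ~ eigsys X Q (eigvals X)).
have H Q0 : eigsys X0 Q0 (eigvals X0) -> \forall z \near (Q0, X0),
    `|eigvals z.2 - eigvals X0| <= e \/ ~ eigsys z.2 z.1 (eigvals z.2).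
  move=> E0.
  have : \forall z \near (Q0, X0), forall i, `|(Q0^T *m X0 *m Q0) i i - (z.1^T *m z.2 *m z.1) i i| <= e.
    apply: near_forall => i; have /cont_distP := @cont_form (Q0, X0) i i.
    exact.
  apply: nearS => z Hz.
  have [E|] := pselect (eigsys z.2 z.1 (eigvals z.2)); last by right.
  left; apply: mx_norm_le => [|k i]; first exact: ltW.
  have E1 : (Q0^T *m X0 *m Q0) i i = eigvals X0 0 i by rewrite (eigsys_diag E0) mxE eqxx mulr1n.
  have E2 : (z.1^T *m z.2 *m z.1) i i = eigvals z.2 0 i by rewrite (eigsys_diag E) mxE eqxx mulr1n.
  have := Hz i; rewrite E1 E2 distrC.
  by rewrite ord1 mxE [X in _ -> `|_ + X| <= _]mxE.
move=> /(_ H); apply: filterS => X HX /eigvals_spec[Q E].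
by have [//|] := HX Q E.
Qed.

End Spectral.

(** * Lifting symmetric functions to matrices *)

Section SymmetricFunction.
Variables (R : realType) (n : nat).
Implicit Types (x : 'rV[R]_n).

Definition sw (i j : 'I_n) x : 'rV[R]_n := \row_k x 0 (tperm i j k).

Lemma sw_linear i j (h : R) v x : sw i j (h *: v + x) = h *: sw i j v + sw i j x.
Proof. by apply/rowP => k; rewrite !mxE. Qed.

Lemma sw_ebasis i j k : sw i j (ebasis R k) = ebasis R (tperm i j k).
Proof.
by apply/rowP => l; rewrite !mxE !eqxx /= -(inj_eq (@perm_inj _ (tperm i j))) tpermK.
Qed.

Lemma sw_fix i j x : x 0 i = x 0 j -> sw i j x = x.
Proof. by move=> E; apply/rowP => k; rewrite !mxE; case: tpermP => [->|->|]. Qed.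

Lemma cont_sw i j x : {for x, continuous (sw i j)}.
Proof.
apply/cont_mxP => a k.
have -> : (fun x => sw i j x a k) = fun x : 'rV[R]_n => x 0 (tperm i j k).
  by apply/funext => y; rewrite mxE.
exact: cont_coord.
Qed.

Lemma partial_sw (g : 'rV[R]_n -> R) i j k x :
  partial k (g \o sw i j) x = partial (tperm i j k) g (sw i j x).
Proof.
rewrite /partial /derive -sw_ebasis.
have -> // : (fun h : R => h^-1 *: (((g \o sw i j) \o shift x) (h *: ebasis R k) - (g \o sw i j) x)) =
  (fun h : R => h^-1 *: ((g \o shift (sw i j x)) (h *: sw i j (ebasis R k)) - g (sw i j x))).
by apply/funext => h /=; rewrite sw_linear.
Qed.

Definition edif (i j : 'I_n) : 'rV[R]_n := ebasis R i - ebasis R j.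

Lemma edif_dot (v : 'rV[R]_n) i j : (v *m (edif i j)^T) 0 0 = v 0 i - v 0 j.
Proof.
rewrite mxE (eq_bigr (fun k => v 0 k * (k == i)%:R - v 0 k * (k == j)%:R)).
  rewrite sumrB (bigD1 i)//= eqxx mulr1 big1 ?addr0; last by move=> k /negbTE ->; rewrite mulr0.
  by rewrite (bigD1 j)//= eqxx mulr1 big1 ?addr0// => k /negbTE ->; rewrite mulr0.
by move=> k _; rewrite !mxE eqxx /= mulrBr.
Qed.

Lemma sub_sw i j (v : 'rV[R]_n) : v - sw i j v = (v 0 i - v 0 j) *: edif i j.
Proof.
apply/rowP => k; rewrite !mxE eqxx /=; case: tpermP => [->|->|].
- rewrite eqxx; case: eqVneq => [->|_]; first by rewrite subrr mul0r.
  by rewrite subr0 mulr1.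
- rewrite eqxx; case: eqVneq => [->|_]; first by rewrite !subrr mul0r.
  by rewrite sub0r mulrN1 opprB.
- by move=> /eqP/negbTE -> /eqP/negbTE ->; rewrite !subr0 mulr0 subrr.
Qed.

Definition strict_grad (U : set 'rV[R]_n) (g : 'rV[R]_n -> R) (dg : 'I_n -> 'rV[R]_n -> R) :=
  forall x e, U x -> 0 < e -> exists2 d, 0 < d & forall y z, `|y - x| < d -> `|z - x| < d ->
    `|g y - g z - \sum_k (y - z) 0 k * dg k x| <= e * `|y - z|.

Variables (U : set 'rV[R]_n) (g : 'I_n -> 'rV[R]_n -> R) (hess : 'I_n -> 'I_n -> 'rV[R]_n -> R).
Hypothesis cg : forall k x, U x -> {for x, continuous (g k)}.
Hypothesis ch : forall k l x, U x -> {for x, continuous (hess k l)}.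
Hypothesis gst : forall k, strict_grad U (g k) (hess k).
Hypothesis grad_sw_near : forall x i j k, U x -> x 0 i = x 0 j ->
  \forall y \near x, g (tperm i j k) (sw i j y) = g k y.
Hypothesis hess_sw : forall x i j k l, U x -> x 0 i = x 0 j ->
  hess (tperm i j k) (tperm i j l) x = hess k l x.

Lemma grad_eq x i j : U x -> x 0 i = x 0 j -> g i x = g j x.
Proof.
move=> Ux E; have := nbhs_singleton (grad_sw_near j Ux E).
by rewrite sw_fix// tpermR.
Qed.

(** The divided difference of the gradient, completed by its limit where the two coordinates
    agree. *)
Definition dd (i j : 'I_n) x : R :=
  if x 0 i == x 0 j then hess i i x - hess i j x else (g i x - g j x) / (x 0 i - x 0 j).

(** Where [x 0 i = x 0 j], symmetry turns [g j y] into [g i (sw i j y)]. The numerator is then an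
    increment of [g i] between [y] and [sw i j y], whose difference is
    [(y 0 i - y 0 j) *: edif i j], and strict differentiability gives the limit. *)
Lemma dd_cont i j x : i != j -> U x -> {for x, continuous (dd i j)}.
Proof.
move=> ij Ux.
have cx : {for x, continuous (fun y : 'rV[R]_n => y 0 i - y 0 j)}.
  by apply: cont_add; [exact: cont_coord|apply: cont_opp; exact: cont_coord].
have [E|nE] := eqVneq (x 0 i) (x 0 j); last first.
  have nE' : x 0 i - x 0 j != 0 by rewrite subr_eq0.
  apply: (cont_near (g := fun y => (g i y - g j y) / (y 0 i - y 0 j))).
    apply: (nearS _ (cont_neq0 cx nE')) => y; rewrite subr_eq0 /dd.
    by case: eqVneq.
  apply: (cont_mul (f := fun y => g i y - g j y) (g := fun y : 'rV[R]_n => (y 0 i - y 0 j)^-1)).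
    exact: (cont_add (@cg i x Ux) (cont_opp (@cg j x Ux))).
  exact: (cont_inv (f := fun y : 'rV[R]_n => y 0 i - y 0 j) nE' cx).
apply/cont_distP => e e0; rewrite /dd E eqxx.
set c0 := hess i i x - hess i j x.
have H1 : \forall y \near x, `|c0 - (hess i i y - hess i j y)| <= e.
  have /cont_distP := cont_add (@ch i i x Ux) (cont_opp (@ch i j x Ux)).
  exact.
have [d d0 Hd] := gst i Ux e0.
have H3 : \forall y \near x, `|y - x| < d by exact: nball_near.
have H4 : \forall y \near x, `|sw i j y - x| < d.
  have := @cont_sw i j x; rewrite /prop_for /continuous_at (sw_fix E) => cs.
  exact: (cs _ (nball_near x d0)).
have H5 := grad_sw_near j Ux E.
apply: (nearS _ (near_and H1 (near_and H3 (near_and H4 H5)))) => y [Y1 [Y3 [Y4 Y5]]].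
case: eqVneq => // nE.
have := Hd y (sw i j y) Y3 Y4.
have -> : g i (sw i j y) = g j y by rewrite -Y5 tpermR.
have -> : \sum_k (y - sw i j y) 0 k * hess i k x = (y 0 i - y 0 j) * c0.
  transitivity ((y 0 i - y 0 j) * ((\row_k hess i k x) *m (edif i j)^T) 0 0); last by rewrite edif_dot !mxE.
  by rewrite sub_sw [X in _ * X]mxE mulr_sumr; apply: eq_bigr => k _; rewrite !mxE; ring.
have nE' : 0 < `|y 0 i - y 0 j| by rewrite normr_gt0 subr_eq0.
have -> : `|y - sw i j y| = `|y 0 i - y 0 j|.
  rewrite sub_sw normrZ (_ : `|edif i j| = 1) ?mulr1//.
  apply/eqP; rewrite eq_le; apply/andP; split.
    apply: mx_norm_le => // a b; rewrite !mxE ord1 eqxx /=.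
    have [->|bi] := eqVneq b i; first by rewrite (negbTE ij) subr0 normr1.
    by case: eqVneq; rewrite ?subr0 ?normr0// sub0r normrN normr1.
  have := le_mx_norm (edif i j) 0 i.
  by rewrite !mxE !eqxx /= (negbTE ij) subr0 normr1.
move=> H; rewrite -(ler_pM2r nE') -normrM mulrBl divfK ?subr_eq0// distrC.
by rewrite [c0 * _]mulrC.
Qed.

Definition Gform (E : 'M[R]_n) x (Q : 'M[R]_n) : R := \sum_j g j x * (Q^T *m E *m Q) j j.

(** The second derivative of the lifted function in the directions [E] and [E'], in the eigenbasis
    [Q] (formula of Lewis and Sendov): the Hessian couples the diagonal entries, the divided
    differences act on the others. *)
Definition Hform (E E' : 'M[R]_n) x (Q : 'M[R]_n) : R :=
  \sum_i \sum_j (Q^T *m E *m Q) i j *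
    (if i == j then \sum_l hess i l x * (Q^T *m E' *m Q) l l
     else dd i j x * (Q^T *m E' *m Q) i j).

(** * Independence of the derivative formulas from the eigenbasis *)

Section Invariance.
Variables (x : 'rV[R]_n) (W : 'M[R]_n).
Hypotheses (Ux : U x) (oW : W^T *m W = 1%:M) (Wx : forall i j, W i j != 0 -> x 0 i = x 0 j).

Definition bconst (v : 'I_n -> R) := forall i j, x 0 i = x 0 j -> v i = v j.

(** A block constant diagonal matrix commutes with [W], so the trace of its product with [h] is
    unchanged by the conjugation. *)
Lemma inv_diag v (h : 'M[R]_n) : bconst v ->
  \sum_j v j * (W^T *m h *m W) j j = \sum_j v j * h j j.
Proof.
move=> bv; pose V : 'rV[R]_n := \row_j v j.
have tE (A : 'M[R]_n) : \sum_j v j * A j j = \tr (diag_mx V *m A).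
  by apply: eq_bigr => j _; rewrite mul_diag_mx !mxE.
have WV : W *m diag_mx V = diag_mx V *m W.
  apply/matrixP => i j; rewrite mul_mx_diag mul_diag_mx !mxE.
  have [->|/Wx E] := eqVneq (W i j) 0; first by rewrite mul0r mulr0.
  by rewrite (bv _ _ E) mulrC.
rewrite !tE mulmxA mxtrace_mulC !mulmxA WV -[_ *m W *m W^T]mulmxA orthC// mulmx1.
by [].
Qed.

(** Entrywise multiplication by a block constant table commutes with conjugation by [W], which mixes
    only indices of one block. *)
Lemma inv_had (al : 'I_n -> 'I_n -> R) (h h' : 'M[R]_n) :
  (forall i, bconst (al i)) -> (forall j, bconst (al ^~ j)) ->
  \sum_i \sum_j (W^T *m h *m W) i j * (al i j * (W^T *m h' *m W) i j) =
  \sum_i \sum_j h i j * (al i j * h' i j).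
Proof.
move=> b1 b2; pose had (A : 'M[R]_n) := \matrix_(i, j) (al i j * A i j).
have tE (A B : 'M[R]_n) : \sum_i \sum_j A i j * (al i j * B i j) = \tr (A^T *m had B).
  rewrite exchange_big; apply: eq_bigr => j _; rewrite mxE; apply: eq_bigr => i _.
  by rewrite !mxE.
have HW (A : 'M[R]_n) : had (W^T *m A *m W) = W^T *m had A *m W.
  apply/matrixP => p q; rewrite mxE !formE mulr_sumr; apply: eq_bigr => i _.
  rewrite mulr_sumr; apply: eq_bigr => j _; rewrite mxE.
  have [->|/Wx Ei] := eqVneq (W i p) 0; first by rewrite !mul0r mulr0.
  have [->|/Wx Ej] := eqVneq (W j q) 0; first by rewrite !mulr0.
  by rewrite (b1 p _ _ (esym Ej)) (b2 j _ _ (esym Ei)); ring.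
rewrite !tE HW !trmx_mul trmxK -!mulmxA (mulmxA W) orthC// mul1mx.
by rewrite mxtrace_mulC !mulmxA -!mulmxA orthC// mulmx1.
Qed.

(** Every other index [j] of the block of [i] gives the same value ([epsE]), so the picked one does
    not matter; the value [0] for a block with one element is immaterial. *)
Definition eps i := if [pick j | (j != i) && (x 0 j == x 0 i)] is Some j
  then hess i i x - hess i j x else 0.

Lemma epsE i j : j != i -> x 0 j = x 0 i -> eps i = hess i i x - hess i j x.
Proof.
move=> ji E; rewrite /eps; case: pickP => [k /andP[ki /eqP Ek]|/(_ j)]; last by rewrite ji E eqxx.
congr (_ - _); have Ekj : x 0 k = x 0 j by rewrite Ek E.
by rewrite -(hess_sw i k Ux Ekj) tpermL tpermD.
Qed.

Lemma inv_Gform E Q : Gform E x (Q *m W) = Gform E x Q.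
Proof.
rewrite /Gform; have -> : (Q *m W)^T *m E *m (Q *m W) = W^T *m (Q^T *m E *m Q) *m W.
  by rewrite trmx_mul !mulmxA.
by apply: inv_diag => i j; exact: grad_eq.
Qed.

Let cc i j := if i == j then hess i i x - eps i else hess i j x.
Let al i j := if i == j then eps i else dd i j x.

(** Inside a block the Hessian takes one value on the diagonal and another off it, so it is not
    block constant. Moving the difference [eps] from the diagonal of the Hessian ([cc]) to the
    diagonal of the divided differences ([al]) makes both tables block constant, ready for
    [inv_diag] and [inv_had]. *)
Lemma HformE E E' Q : Hform E E' x Q =
  \sum_i (\sum_j cc i j * (Q^T *m E' *m Q) j j) * (Q^T *m E *m Q) i i +
  \sum_i \sum_j (Q^T *m E *m Q) i j * (al i j * (Q^T *m E' *m Q) i j).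
Proof.
rewrite /Hform; set h := Q^T *m E *m Q; set h' := Q^T *m E' *m Q.
rewrite -big_split /=; apply: eq_bigr => i _.
rewrite (bigD1 i)//= eqxx [\sum_j h i j * _](bigD1 i)//= /al eqxx.
rewrite [X in _ + X = _](eq_bigr (fun j => h i j * (dd i j x * h' i j))); last by move=> j jn; rewrite eq_sym (negbTE jn).
rewrite [X in _ = _ + (_ + X)](eq_bigr (fun j => h i j * (dd i j x * h' i j))); last by move=> j jn; rewrite eq_sym (negbTE jn).
rewrite addrA; congr (_ + _).
rewrite (bigD1 i)//= [\sum_j cc i j * _](bigD1 i)//= /cc eqxx.
rewrite [X in _ = (_ + X) * _ + _](eq_bigr (fun j => hess i j x * h' j j)); last by move=> j jn; rewrite eq_sym (negbTE jn).
by ring.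
Qed.

Lemma cc_b1 i : bconst (cc i).
Proof.
move=> p q Epq; have [->//|pq] := eqVneq p q.
rewrite /cc; have [->|ip] := eqVneq i p.
  by rewrite (negbTE pq) (epsE (j := q)) ?subKr// eq_sym.
have [->|iq] := eqVneq i q; first by rewrite (epsE (j := p)) ?subKr.
by rewrite -(hess_sw i p Ux Epq) tpermL tpermD// eq_sym.
Qed.

Lemma cc_b2 j : bconst (cc ^~ j).
Proof.
move=> p q Epq; have [->//|pq] := eqVneq p q.
rewrite /cc; have [<-|jp] := eqVneq p j.
  rewrite eq_sym (negbTE pq) (epsE (j := q)) ?subKr// ?[_ == p]eq_sym//.
  by rewrite -(hess_sw p q Ux Epq) tpermL tpermR.
have [<-|jq] := eqVneq q j.
  by rewrite (epsE (j := p)) ?subKr// -(hess_sw p q Ux Epq) tpermL tpermR.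
by rewrite -(hess_sw p j Ux Epq) tpermL tpermD.
Qed.

Lemma dd_sym i j : dd i j x = dd j i x.
Proof.
rewrite /dd eq_sym; have [E|nE] := eqVneq (x 0 j) (x 0 i).
  by rewrite -(hess_sw i i Ux E) -(hess_sw i j Ux E) tpermL tpermR.
by rewrite -[_ - x 0 j]opprB -[_ - g j x]opprB invrN mulrNN.
Qed.

Lemma al_b1 i : bconst (al i).
Proof.
move=> p q Epq; have [->//|pq] := eqVneq p q.
rewrite /al; have [->|ip] := eqVneq i p.
  by rewrite (negbTE pq) /dd Epq eqxx (epsE (j := q)) // eq_sym.
have [->|iq] := eqVneq i q.
  by rewrite /dd Epq eqxx (epsE (j := p)).
rewrite /dd Epq; case: eqVneq => E; last by rewrite (grad_eq Ux Epq).
by rewrite -(hess_sw i p Ux Epq) tpermL tpermD// eq_sym.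
Qed.

Lemma al_b2 j : bconst (al ^~ j).
Proof.
have alC p q : al p q = al q p by rewrite /al eq_sym; case: eqVneq => [->//|_]; exact: dd_sym.
by move=> p q Epq; rewrite alC [RHS]alC; exact: al_b1.
Qed.

Lemma inv_Hform E E' Q : Hform E E' x (Q *m W) = Hform E E' x Q.
Proof.
rewrite !HformE.
have QW (D : 'M[R]_n) : (Q *m W)^T *m D *m (Q *m W) = W^T *m (Q^T *m D *m Q) *m W.
  by rewrite trmx_mul !mulmxA.
rewrite !QW; congr (_ + _); last by apply: inv_had; [exact: al_b1|exact: al_b2].
set h := Q^T *m E *m Q; set h' := Q^T *m E' *m Q.
rewrite (eq_bigr (fun i => (\sum_j cc i j * h' j j) * (W^T *m h *m W) i i)).
    apply: (@inv_diag (fun i => \sum_j cc i j * h' j j)) => i j Eij; apply: eq_bigr => k _.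
  by rewrite (@cc_b2 k i j Eij).
by move=> i _; rewrite (@inv_diag (cc i) h' (@cc_b1 i)).
Qed.

End Invariance.

(** Both bases diagonalize [X], so [Q^T *m Q'] commutes with [diag_mx x] and mixes only equal
    eigenvalues. *)
Lemma eigsys_commute X Q Q' x : eigsys X Q x -> eigsys X Q' x ->
  [/\ Q' = Q *m (Q^T *m Q'), (Q^T *m Q')^T *m (Q^T *m Q') = 1%:M &
    forall i j, (Q^T *m Q') i j != 0 -> x 0 i = x 0 j].
Proof.
move=> [oQ EX sx] [oQ' EX' _]; split.
- by rewrite mulmxA orthC// mul1mx.
- by rewrite trmx_mul trmxK -mulmxA (mulmxA Q) orthC// mul1mx.
- move=> i j.
  have E : diag_mx x *m (Q^T *m Q') = (Q^T *m Q') *m diag_mx x.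
    transitivity (Q^T *m X *m Q').
      by rewrite EX !mulmxA oQ mul1mx.
    by rewrite EX' -!mulmxA oQ' mulmx1.
  move: E; move: (Q^T *m Q') => W /matrixP/(_ i j).
  by rewrite mul_diag_mx mul_mx_diag !mxE [RHS]mulrC => E nz; exact: (mulIf nz).
Qed.

Lemma Gform_eig E X Q Q' x : U x -> eigsys X Q x -> eigsys X Q' x -> Gform E x Q' = Gform E x Q.
Proof.
move=> Ux e1 e2; have [E' o w] := eigsys_commute e1 e2; rewrite [in LHS]E'.
exact: (inv_Gform Ux o w).
Qed.

Lemma Hform_eig E E' X Q Q' x : U x -> eigsys X Q x -> eigsys X Q' x ->
  Hform E E' x Q' = Hform E E' x Q.
Proof.
move=> Ux e1 e2; have [E1 o w] := eigsys_commute e1 e2; rewrite [in LHS]E1.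
exact: (inv_Hform Ux o w).
Qed.

End SymmetricFunction.

Lemma cont_pair (T U V : topologicalType) (f : T -> U) (g : T -> V) (x : T) :
  {for x, continuous f} -> {for x, continuous g} -> {for x, continuous (fun z => (f z, g z))}.
Proof. by move=> cf cg; exact: cvg_pair. Qed.

Lemma cvg_eq_dnbhs (R : realType) (f g : R -> R) (l : R) : (\forall t \near 0^', f t = g t) ->
  f t @[t --> 0^'] --> l -> g t @[t --> 0^'] --> l.
Proof. by move=> E; apply: cvg_trans; apply: near_eq_cvg. Qed.

Lemma orth_colsum (R : realType) n (A : 'M[R]_n) k : A^T *m A = 1%:M ->
  A k k * A k k = 1 - \sum_(i | i != k) A i k * A i k.
Proof.
move=> /(congr1 (fun A : 'M[R]_n => A k k)); rewrite !mxE eqxx (bigD1 k)//= mxE.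
rewrite (eq_bigr (fun i => A i k * A i k)) => [H|i _]; last by rewrite mxE.
by rewrite -[1]H addrK.
Qed.

Section EigenContinuity.
Variables (R : realType) (n : nat).
Implicit Types (X Q E : 'M[R]_n) (x : 'rV[R]_n).

(** Symmetrizing extends the eigenvalues to all square matrices, where every partial derivative
    makes sense. *)
Definition symp X : 'M[R]_n := 2^-1 *: (X + X^T).
Definition lam X : 'rV[R]_n := eigvals (symp X).

Lemma symp_sym X : Defs.symmetric (symp X).
Proof. by rewrite /Defs.symmetric /symp linearZ /= linearD /= trmxK addrC. Qed.

Lemma symp_id X : Defs.symmetric X -> symp X = X.
Proof.
move=> sX; apply/matrixP => i j; have E : X j i = X i j by rewrite -[in LHS]sX mxE.
by rewrite !mxE E; field.
Qed.

Lemma symp_linear (h : R) X E : symp (h *: E + X) = h *: symp E + symp X.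
Proof. by apply/matrixP => i j; rewrite !mxE; ring. Qed.

Lemma cont_symp X : {for X, continuous symp}.
Proof.
apply/cont_mxP => i j.
have -> : (fun Y => symp Y i j) = (fun Y : 'M[R]_n => 2^-1 * (Y i j + Y j i)).
  by apply/funext => Y; rewrite !mxE.
apply: cont_mul; first exact: cont_cst.
by apply: cont_add; exact: cont_coord.
Qed.

Lemma lam_spec X : exists Q, eigsys (symp X) Q (lam X).
Proof. exact: eigvals_spec (symp_sym X). Qed.

Lemma cont_lam X : {for X, continuous lam}.
Proof.
apply/cont_mxP => a j; apply/cont_distP => e e0.
have H := @eigvals_cont R n (symp X) e (symp_sym X) e0.
have := @cont_symp X _ H; apply: nearS => Y /(_ (symp_sym Y)) HY.
rewrite distrC; apply: le_trans HY.
by have := le_mx_norm (lam Y - lam X) a j; rewrite !mxE.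
Qed.

(** Meant for expressions with the same value at every eigenbasis: near [X0] each eigenbasis is
    close to one of [X0], so the value is close to [c] whichever is chosen. *)
Lemma eig_cont X0 (Phi : 'rV[R]_n -> 'M[R]_n -> R) c :
  (forall Q0, eigsys X0 Q0 (eigvals X0) -> Phi (eigvals X0) Q0 = c /\
     {for (eigvals X0, Q0), continuous (fun z : 'rV[R]_n * 'M[R]_n => Phi z.1 z.2)}) ->
  forall e, 0 < e -> \forall X \near X0, forall Q, eigsys X Q (eigvals X) ->
     `|c - Phi (eigvals X) Q| <= e.
Proof.
move=> H e e0.
(* On eigensystems this recovers the eigenvalues, and it is visibly continuous in the pair. *)
pose dg (z : 'M[R]_n * 'M[R]_n) : 'rV[R]_n := \row_i (z.1^T *m z.2 *m z.1) i i.
have dgE X Q x : eigsys X Q x -> dg (Q, X) = x.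
  by move=> /eigsys_diag E; apply/rowP => i; rewrite mxE E mxE eqxx mulr1n.
have := @eig_near R n X0 (fun X Q => `|c - Phi (dg (Q, X)) Q| <= e).
have K Q0 : eigsys X0 Q0 (eigvals X0) -> \forall z \near (Q0, X0), `|c - Phi (dg (z.1, z.2)) z.1| <= e.
  move=> E0; have [Ec cP] := H Q0 E0.
  have cdg : {for (Q0, X0), continuous (fun z : 'M[R]_n * 'M[R]_n => (dg z, z.1))}.
    apply: cont_pair; last exact: cvg_fst.
    apply: (cont_mxP _ dg).2 => a i.
    have -> : (fun z => dg z a i) = (fun z : 'M[R]_n * 'M[R]_n => (z.1^T *m z.2 *m z.1) i i).
      by apply/funext => z; rewrite mxE.
    exact: cont_form.
  have cP2 : {for (Q0, X0), continuous (fun z : 'M[R]_n * 'M[R]_n => Phi (dg z) z.1)}.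
    apply: (@continuous_comp _ _ _ (fun z : 'M[R]_n * 'M[R]_n => (dg z, z.1))
      (fun z : 'rV[R]_n * 'M[R]_n => Phi z.1 z.2)); first exact: cdg.
    by rewrite /= (dgE _ _ _ E0); exact: cP.
  have /cont_distP := cP2; move=> /(_ e e0); rewrite /= (dgE _ _ _ E0) Ec.
  by apply: nearS => -[].
by move=> /(_ K); apply: filterS => X HX Q E; have := HX Q E; rewrite (dgE _ _ _ E).
Qed.

(** Compute [Q^T *m (t *: E + X) *m P] and [Q^T *m X *m P] from the two decompositions and subtract.
    This exact identity is the source of the perturbation limits below. *)
Lemma eigsys_move X E Q x t P y : eigsys X Q x -> eigsys (t *: E + X) P y ->
  forall i j, (Q^T *m P) i j * (y 0 j - x 0 i) = t * \sum_k (Q^T *m E *m Q) i k * (Q^T *m P) k j.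
Proof.
move=> [oQ EX _] [oP EY _] i j.
have K : (Q^T *m P) *m diag_mx y - diag_mx x *m (Q^T *m P) = t *: ((Q^T *m E *m Q) *m (Q^T *m P)).
  have -> : Q^T *m P *m diag_mx y = Q^T *m (t *: E + X) *m P.
    by rewrite EY -!mulmxA oP mulmx1.
  have -> : diag_mx x *m (Q^T *m P) = Q^T *m X *m P by rewrite EX !mulmxA oQ mul1mx.
  rewrite -mulmxBl -mulmxBr addrK -[in RHS]mulmxA (mulmxA Q) orthC// mul1mx.
  by rewrite -scalemxAr -scalemxAl.
have := congr1 (fun A : 'M[R]_n => A i j) K.
move: (Q^T *m P) (Q^T *m E *m Q) => W h.
by rewrite mul_mx_diag mul_diag_mx !mxE mulrBr => <-; rewrite [x 0 i * _]mulrC.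
Qed.

End EigenContinuity.

(** * Perturbation at a simple spectrum *)

Section SimpleSpectrum.
Variables (R : realType) (n : nat) (X E Q : 'M[R]_n) (x : 'rV[R]_n).
Hypotheses (eX : eigsys X Q x) (sE : Defs.symmetric E).
Hypothesis xinj : forall i j, i != j -> x 0 i != x 0 j.
Variables (P : R -> 'M[R]_n) (y : R -> 'rV[R]_n).
Hypothesis eY : forall t, eigsys (t *: E + X) (P t) (y t).
Let W t := Q^T *m P t.
Let h := Q^T *m E *m Q.

Let sX : Defs.symmetric X.
Proof.
case: eX => _ -> _; rewrite /Defs.symmetric !trmx_mul trmxK.
by rewrite tr_diag_mx mulmxA.
Qed.

Lemma ycvg i : y t 0 i @[t --> 0^'] --> x 0 i.
Proof.
apply/cvgrPdist_le => e e0.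
have H := eigvals_cont sX e0.
have cl : (t *: E + X) @[t --> (0:R)^'] --> X.
  have {2}-> : X = 0 *: E + X by rewrite scale0r add0r.
  apply: cvgD; last exact: cvg_cst.
  by apply: cvgZr_tmp; exact: cvg_within.
have H2 : \forall t \near (0:R)^', Defs.symmetric (t *: E + X) -> `|eigvals (t *: E + X) - eigvals X| <= e := cl _ H.
apply: filterS H2 => t Ht.
have sY : Defs.symmetric (t *: E + X) by rewrite /Defs.symmetric linearD /= linearZ /= sX sE.
have := Ht sY; rewrite (eigvalsE (eY t)) (eigvalsE eX) => Hn.
rewrite distrC; apply: le_trans Hn.
by have := le_mx_norm (y t - x) 0 i; rewrite !mxE.
Qed.

Let oW t : (W t)^T *m W t = 1%:M.
Proof.
have [oQ _ _] := eX; have [oP _ _] := eY t.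
by rewrite /W trmx_mul trmxK -mulmxA (mulmxA Q) orthC// mul1mx.
Qed.

Let Wle t i j : `|W t i j| <= 1. Proof. exact: orth_entry. Qed.

Let Wmove t i j : W t i j * (y t 0 j - x 0 i) = t * \sum_k h i k * W t k j.
Proof. exact: (eigsys_move eX (eY t)). Qed.

Lemma cvg_bounded0 (u v : R -> R) (K : R) : (forall t, `|v t| <= K) ->
  u t @[t --> 0^'] --> 0 -> (u t * v t) @[t --> 0^'] --> (0:R).
Proof.
move=> vK u0; apply/cvgrPdist_le => e e0.
have K0 : 0 < `|K| + 1 by rewrite ltr_wpDl.
have eK : 0 < e / (`|K| + 1) by rewrite divr_gt0.
move/cvgrPdist_le : u0 => /(_ _ eK); apply: filterS => t; rewrite !sub0r !normrN normrM => H.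
rewrite -[leRHS](divfK (lt0r_neq0 K0)) ler_pM//.
by apply: le_trans (vK t) _; apply: le_trans (ler_norm _) _; rewrite lerDl.
Qed.

(** By [eigsys_move] the entry times the gap [y t 0 j - x 0 i] is of order [t], and the gap has a
    nonzero limit. *)
Lemma Woff i j : i != j -> W t i j @[t --> 0^'] --> (0:R).
Proof.
move=> ij; have xx := xinj ij.
have gap : (y t 0 j - x 0 i)^-1 @[t --> 0^'] --> (x 0 j - x 0 i)^-1.
  apply: cvgV; first by rewrite subr_eq0 eq_sym.
  by apply: cvgB; [exact: ycvg|exact: cvg_cst].
have nz : \forall t \near (0:R)^', y t 0 j - x 0 i != 0.
  have d0 : 0 < `|x 0 j - x 0 i| by rewrite normr_gt0 subr_eq0 eq_sym.
  have := @ycvg j; move/cvgrPdist_lt => /(_ _ d0); apply: filterS => t Ht.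
  apply/negP; rewrite subr_eq0 => /eqP Ey; move: Ht.
  by rewrite Ey ltxx.
have W0 : ((t * (y t 0 j - x 0 i)^-1) * \sum_k h i k * W t k j) @[t --> 0^'] --> (0:R).
  apply: (@cvg_bounded0 _ _ (\sum_k `|h i k|)).
    move=> t; apply: le_trans (ler_norm_sum _ _ _) _; apply: ler_sum => k _.
    by rewrite normrM ler_piMr.
  have t0 : (t : R) @[t --> 0^'] --> (0:R) by exact: cvg_within.
  have E0 : 0 * (x 0 j - x 0 i)^-1 = 0 :> R by rewrite mul0r.
  have H : (t * (y t 0 j - x 0 i)^-1) @[t --> 0^'] --> 0 * (x 0 j - x 0 i)^-1 by exact: (cvgM t0 gap).
  by rewrite E0 in H; exact: H.
apply: cvg_eq_dnbhs W0; apply: filterS nz => t nzt.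
by rewrite mulrAC -Wmove mulfK.
Qed.

(** An eigenvector is determined only up to sign, so [W t k k] need not converge; a product of two
    entries of one column does not see the sign. *)
Lemma Wprod l j k : (W t l k * W t j k) @[t --> 0^'] --> (((l == k) && (j == k))%:R : R).
Proof.
have [->|lk] /= := eqVneq l k; last first.
  by apply: (@cvg_bounded0 _ _ 1) => //; exact: Woff.
have [->|jk] /= := eqVneq j k; last first.
  by under eq_fun do rewrite mulrC; apply: (@cvg_bounded0 _ _ 1) => //; exact: Woff.
have S t : W t k k * W t k k = 1 - \sum_(i | i != k) W t i k * W t i k.
  exact: orth_colsum.
have cS : (1 - \sum_(i | i != k) W t i k * W t i k) @[t --> 0^'] --> 1 - \sum_(i < n | i != k) (0:R).
  apply: cvgB; first exact: cvg_cst.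
  by apply: cvg_sumr => i ik; apply: (@cvg_bounded0 _ _ 1) => //; exact: Woff.
rewrite big1 // subr0 in cS; apply: cvg_eq_dnbhs cS.
by apply: nearW => t; rewrite S.
Qed.

(** [eigsys_move] with [i = j], multiplied by [W t j j] so that only products within a column
    occur. *)
Lemma y_deriv j : t^-1 * (y t 0 j - x 0 j) @[t --> 0^'] --> h j j.
Proof.
have c1 : (\sum_k h j k * (W t k j * W t j j)) @[t --> 0^'] --> h j j.
  have -> : h j j = \sum_k h j k * (((k == j) && (j == j))%:R).
    rewrite (bigD1 j)//= eqxx mulr1 big1 ?addr0// => k /negbTE ->.
    by rewrite mulr0.
  by apply: cvg_sumr => k _; apply: cvgM; [exact: cvg_cst|exact: Wprod].
have c2 : (W t j j * W t j j)^-1 @[t --> 0^'] --> (1:R).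
  rewrite -[X in _ --> X]invr1; apply: cvgV; first exact: oner_neq0.
  by have := @Wprod j j j; rewrite eqxx.
have nz : \forall t \near (0:R)^', W t j j * W t j j != 0.
  have := @Wprod j j j; rewrite eqxx /= => /cvgrPdist_lt/(_ _ ltr01); apply: filterS => t Ht.
  by apply/negP => /eqP E0; move: Ht; rewrite E0 subr0 normr1 ltxx.
rewrite -[X in _ --> X]mulr1.
apply: cvg_eq_dnbhs (cvgM c1 c2).
near=> t; have t0 : t != 0 by near: t; exact: nbhs_dnbhs_neq.
have nzt : W t j j * W t j j != 0 by near: t.
apply: (mulIf nzt); rewrite /= divfK//.
have -> : \sum_k h j k * (W t k j * W t j j) = (t^-1 * (W t j j * (y t 0 j - x 0 j))) * W t j j.
  by rewrite Wmove mulKf// mulr_suml; apply: eq_bigr => k _; rewrite mulrA.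
by ring.
Unshelve. all: by end_near. Qed.

(** The derivative of the eigenprojections away from the index [i = k], again through products that
    do not see the sign. *)
Lemma Wquot i j k : i != k -> t^-1 * (W t i k * W t j k) @[t --> 0^'] -->
  (j == k)%:R * h i k / (x 0 k - x 0 i).
Proof.
move=> ik; have xx := xinj ik.
have gap : (y t 0 k - x 0 i)^-1 @[t --> 0^'] --> (x 0 k - x 0 i)^-1.
  apply: cvgV; first by rewrite subr_eq0 eq_sym.
  by apply: cvgB; [exact: ycvg|exact: cvg_cst].
have nz : \forall t \near (0:R)^', y t 0 k - x 0 i != 0.
  have d0 : 0 < `|x 0 k - x 0 i| by rewrite normr_gt0 subr_eq0 eq_sym.
  have := @ycvg k; move/cvgrPdist_lt => /(_ _ d0); apply: filterS => t Ht.
  apply/negP; rewrite subr_eq0 => /eqP Ey; move: Ht.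
  by rewrite Ey ltxx.
have c1 : (\sum_l h i l * (W t l k * W t j k)) @[t --> 0^'] --> (j == k)%:R * h i k.
  have -> : (j == k)%:R * h i k = \sum_l h i l * (((l == k) && (j == k))%:R).
    rewrite (bigD1 k)//= eqxx big1 ?addr0 1?mulrC// => l /negbTE ->.
    by rewrite mulr0.
  by apply: cvg_sumr => l _; apply: cvgM; [exact: cvg_cst|exact: Wprod].
apply: cvg_eq_dnbhs (cvgM c1 gap).
near=> t; have t0 : t != 0 by near: t; exact: nbhs_dnbhs_neq.
have nzt : y t 0 k - x 0 i != 0 by near: t.
apply: (mulIf nzt); rewrite /= divfK//.
have -> : \sum_l h i l * (W t l k * W t j k) = (t^-1 * (W t i k * (y t 0 k - x 0 i))) * W t j k.
  by rewrite Wmove mulKf// mulr_suml; apply: eq_bigr => l _; rewrite mulrA.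
by ring.
Unshelve. all: by end_near. Qed.

End SimpleSpectrum.

Lemma cvg_cont (T : Type) (F0 : set_system T) (V W : topologicalType) (f : T -> V) (F : V -> W) (x : V) :
  f t @[t --> F0] --> x -> {for x, continuous F} -> F (f t) @[t --> F0] --> F x.
Proof. by move=> cf cF; exact: cvg_comp cf cF. Qed.

(** * Lines that meet multiple spectra in finitely many points *)

Section GenericLines.
Variable R : realType.

(** Induction on the exceptional points: the interval is cut at each of them, and continuity is
    enough there. *)
Lemma MVT_finite (s : seq R) (u du : R -> R) (e : R) : 0 <= e -> forall a b, a <= b ->
  (forall t, a < t < b -> t \notin s -> is_derive t 1 u (du t) /\ `|du t| <= e) ->
  (forall t, a <= t <= b -> {for t, continuous u}) ->
  `|u b - u a| <= e * (b - a).
Proof.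
move=> e0; elim: s => [|r s IH] a b ab Hd Hc.
  move: ab; rewrite le_eqVlt => /orP[/eqP <-|ab]; first by rewrite !subrr normr0 mulr0.
  have [t| |c] := @MVT R u du a b ab.
  - by rewrite in_itv /= => /Hd/(_ isT)[].
  - apply: continuous_in_subspaceT => t; rewrite inE /= in_itv /=; exact: Hc.
  rewrite in_itv /= => /Hd/(_ isT)[_ dc] ->.
  by rewrite normrM ler_pM// ger0_norm// subr_ge0 ltW.
have [/andP[ar rb]|nr] := boolP (a < r < b).
  have -> : u b - u a = (u b - u r) + (u r - u a) by rewrite addrA subrK.
  apply: le_trans (ler_normD _ _) _.
  have -> : e * (b - a) = e * (b - r) + e * (r - a) by ring.
  apply: lerD; apply: IH; try exact: ltW.
  - move=> t /andP[rt tb] ts; apply: Hd; first by rewrite (lt_trans ar rt).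
    by rewrite inE negb_or ts gt_eqF.
  - by move=> t /andP[rt tb]; apply: Hc; rewrite (le_trans (ltW ar) rt).
  - move=> t /andP[at_ tr] ts; apply: Hd; first by rewrite at_ (lt_trans tr rb).
    by rewrite inE negb_or ts lt_eqF.
  - by move=> t /andP[at_ tr]; apply: Hc; rewrite at_ (le_trans tr (ltW rb)).
apply: IH => // t tab ts; apply: Hd => //; rewrite inE negb_or ts andbT.
by apply: contra nr => /eqP <-.
Qed.

Lemma MVT_finite_abs (s : seq R) (u du : R -> R) (e b : R) : 0 <= e ->
  (forall t, `|t| <= `|b| -> t \notin s -> is_derive t 1 u (du t) /\ `|du t| <= e) ->
  (forall t, `|t| <= `|b| -> {for t, continuous u}) ->
  `|u b - u 0| <= e * `|b|.
Proof.
move=> e0 Hd Hc; have [b0|b0] := leP 0 b.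
  rewrite (ger0_norm b0) -[X in e * X]subr0; apply: (MVT_finite (s := s) (du := du)) => //.
    move=> t /andP[t0 tb]; apply: Hd.
    by rewrite !ger0_norm// ltW.
  by move=> t /andP[t0 tb]; apply: Hc; rewrite !ger0_norm.
rewrite distrC (ltr0_norm b0) -[- b]sub0r.
apply: (MVT_finite (s := s) (du := du)) => //; first exact: ltW.
  move=> t /andP[t0 tb]; apply: Hd.
  by rewrite !ler0_norm ?lerN2 ?ltW.
by move=> t /andP[t0 tb]; apply: Hc; rewrite !ler0_norm ?lerN2// ltW.
Qed.

Lemma finite_roots_seq (p : {poly R}) : p != 0 -> exists s : seq R, forall t, root p t -> t \in s.
Proof.
have [m] := ubnP (size p); elim: m p => // m IH p sp p0.
have [[t rt]|nr] := pselect (exists t, root p t); last first.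
  by exists [::] => t rt; exfalso; apply: nr; exists t.
have /factor_theorem[q Eq] := rt.
have q0 : q != 0 by apply: contra_neq p0 => q0; rewrite Eq q0 mul0r.
have [|s Hs] := IH q _ q0.
  by move: sp; rewrite Eq size_Mmonic ?monicXsubC// size_XsubC addn2 /= ltnS.
exists (t :: s) => t'; rewrite Eq rootM root_XsubC inE => /orP[/Hs->|->//].
by rewrite orbT.
Qed.

Variable n : nat.

Fixpoint mxpow (S : pzRingType) k (A : 'M[S]_n) : 'M[S]_n :=
  if k is k'.+1 then A *m mxpow k' A else 1%:M.

(** The Hankel determinant of the power sums of the eigenvalues, that is, the discriminant of the
    characteristic polynomial. The ring is general so that a line of matrices can be taken as one
    matrix of polynomials. *)
Definition disc (S : comPzRingType) (A : 'M[S]_n) : S :=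
  \det (\matrix_(i < n, j < n) \tr (mxpow (i + j) A)).

Lemma map_mxpow (S S' : pzRingType) (phi : {rmorphism S -> S'}) k (A : 'M[S]_n) :
  map_mx phi (mxpow k A) = mxpow k (map_mx phi A).
Proof. by elim: k => [|k IH] /=; rewrite ?map_mx1// map_mxM IH. Qed.

Lemma map_disc (S S' : comPzRingType) (phi : {rmorphism S -> S'}) (A : 'M[S]_n) :
  phi (disc A) = disc (map_mx phi A).
Proof.
rewrite /disc -det_map_mx; congr (\det _); apply/matrixP => i j.
by rewrite !mxE -map_mxpow trace_map_mx.
Qed.

(** The Hankel matrix is a Vandermonde matrix times its transpose. *)
Lemma disc_eigsys (X Q : 'M[R]_n) x : eigsys X Q x ->
  disc X = (\prod_(i < n) \prod_(j < n | (i < j)%N) (x 0 j - x 0 i)) ^+ 2.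
Proof.
move=> [oQ EX _].
have pw k : mxpow k X = Q *m diag_mx (\row_i x 0 i ^+ k) *m Q^T.
  elim: k => [|k IH] /=.
    have -> : diag_mx (\row_i x 0 i ^+ 0) = 1%:M.
      by apply/matrixP => i j; rewrite !mxE expr0.
    by rewrite mulmx1 orthC.
  rewrite IH {1}EX -!mulmxA (mulmxA Q^T) oQ mul1mx (mulmxA (diag_mx x)); congr (_ *m (_ *m _)).
  rewrite mul_diag_mx; apply/matrixP => i j; rewrite !mxE exprS.
  by case: eqVneq => _; rewrite ?mulr0n ?mulr0 ?mulr1n.
have tr k : \tr (mxpow k X) = \sum_i x 0 i ^+ k.
  rewrite pw mxtrace_mulC mulmxA oQ mul1mx; apply: eq_bigr => i _.
  by rewrite !mxE eqxx mulr1n.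
rewrite -det_Vandermonde expr2 -{2}det_tr -det_mulmx /disc; congr (\det _).
apply/matrixP => i j; rewrite !mxE tr; apply: eq_bigr => k _.
by rewrite !mxE exprD.
Qed.

Lemma disc_simple (X Q : 'M[R]_n) x : eigsys X Q x ->
  (disc X != 0) <-> (forall i j, i != j -> x 0 i != x 0 j).
Proof.
move=> eX; rewrite (disc_eigsys eX) sqrf_eq0; split.
  move=> /prodf_neq0 H.
  suff K (i j : 'I_n) : (i < j)%N -> x 0 i != x 0 j.
    move=> i j ij; case: (ltngtP i j) => [|ji|/val_inj E]; first exact: K.
      by rewrite eq_sym; exact: K.
    by rewrite E eqxx in ij.
  move=> ij; have /prodf_neq0/(_ j ij) := H i isT.
  by rewrite subr_eq0 eq_sym.
move=> H; apply/prodf_neq0 => i _; apply/prodf_neq0 => j ij.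
by rewrite subr_eq0 H// eq_sym neq_ltn ij.
Qed.

Definition simple (X : 'M[R]_n) := forall i j, i != j -> lam X 0 i != lam X 0 j.

(** The discriminant along the line is a polynomial in [t] that does not vanish at [0]. *)
Lemma simple_line (X E : 'M[R]_n) : simple X ->
  exists s : seq R, forall t, t \notin s -> simple (X + t *: E).
Proof.
move=> sX.
pose A : 'M[{poly R}]_n := map_mx polyC (symp X) + 'X *: map_mx polyC (symp E).
pose p := disc A.
have pE t : p.[t] = disc (symp (X + t *: E)).
  rewrite -/(horner_eval t p) (map_disc (horner_eval t)); congr (disc _).
  rewrite addrC symp_linear /A; move: (symp X) (symp E) => SX SE; apply/matrixP => i j.
  rewrite !mxE /horner_eval /= -[LHS]/(_.[t]).
  by rewrite hornerD hornerC hornerM hornerX hornerC addrC.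
have [Q eX] := lam_spec X.
have p0 : p != 0.
  apply/eqP => E0; have := pE 0; rewrite E0 horner0 scale0r addr0 => /esym/eqP.
  by apply/negP; apply/(disc_simple eX).
have [s Hs] : exists s : seq R, forall t, root p t -> t \in s.
  exact: finite_roots_seq p0.
exists s => t ts; have [Qt eXt] := lam_spec (X + t *: E).
apply/(disc_simple eXt); rewrite -pE; apply: contra ts => /eqP E0; apply: Hs.
by rewrite rootE E0.
Qed.

Lemma symp_line (X E : 'M[R]_n) t : symp (X + t *: E) = t *: symp E + symp X.
Proof. by rewrite addrC symp_linear. Qed.

(** In an eigenbasis of [symp X], add multiples of a strictly decreasing vector: sorted eigenvalues
    that coincide are pulled apart and no two can meet. *)
Lemma simple_dense (X : 'M[R]_n) : exists P, forall t, 0 < t -> simple (X + t *: P).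
Proof.
have [Q [oQ EX sx]] := lam_spec X.
pose c : 'rV[R]_n := \row_i (n - i)%:R.
have cdec (i j : 'I_n) : (i < j)%N -> c 0 j < c 0 i.
  by move=> ij; rewrite !mxE ltr_nat ltn_sub2l// (ltn_trans ij (ltn_ord j)).
exists (Q *m diag_mx c *m Q^T) => t t0.
have sP : Defs.symmetric (Q *m diag_mx c *m Q^T).
  by rewrite /Defs.symmetric !trmx_mul trmxK tr_diag_mx mulmxA.
have dec (i j : 'I_n) : (i < j)%N -> (lam X + t *: c) 0 j < (lam X + t *: c) 0 i.
  move=> ij; rewrite [ltLHS]mxE [ltRHS]mxE; apply: ler_ltD; first by apply: sx; exact: ltnW.
  by rewrite [ltLHS]mxE [ltRHS]mxE ltr_pM2l// cdec.
have es : eigsys (symp (X + t *: (Q *m diag_mx c *m Q^T))) Q (lam X + t *: c).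
  split=> //.
    rewrite symp_line (symp_id sP) {1}EX linearD /= linearZ /= mulmxDr mulmxDl addrC.
    by rewrite -scalemxAr -scalemxAl.
  by move=> i j; rewrite leq_eqVlt => /orP[/eqP/val_inj->//|/dec/ltW].
move=> i j ij; rewrite /lam (eigvalsE es).
case: (ltngtP i j) => [/dec/gt_eqF->//|/dec/lt_eqF->//|/val_inj E].
by rewrite E eqxx in ij.
Qed.

(* Every point is a limit of points whose line in direction [E] meets the multiple spectra in
   finitely many points; the mean value inequality passes to the limit. *)
Lemma derive_generic (N : set 'M[R]_n) (F D : 'M[R]_n -> R) (E X0 : 'M[R]_n) :
  open N -> N X0 -> (forall X, N X -> {for X, continuous F}) ->
  (forall X, N X -> {for X, continuous D}) ->
  (forall X, N X -> simple X -> is_derive X E F (D X)) -> is_derive X0 E F (D X0).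
Proof.
move=> oN NX0 cF cD sD; apply/is_deriveP/cvgrPdist_le => e e0.
have /cont_distP/(_ e e0) nD := cD _ NX0.
have [r r0 Hr] := near_nball (near_and (open_nbhs_nbhs (conj oN NX0)) nD).
have r20 : 0 < r / 2 by rewrite divr_gt0.
have K0 : 0 < `|E| + 1 by rewrite ltr_wpDl.
have hE : \forall h \near (0:R)^', `|h| < r / 2 / (`|E| + 1).
  by apply: dnbhs0_lt; rewrite divr_gt0.
near=> h.
have h0 : h != 0 by near: h; exact: nbhs_dnbhs_neq.
have hr : `|h| < r / 2 / (`|E| + 1) by near: h.
have inr (X : 'M[R]_n) t : `|X - X0| < r / 2 -> `|t| <= `|h| -> `|X + t *: E - X0| < r.
  move=> Xr th; rewrite addrAC (splitr r); apply: le_lt_trans (ler_normD _ _) _.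
  apply: ltrD => //; rewrite normrZ; apply: (@le_lt_trans _ _ (`|h| * (`|E| + 1))).
    by apply: ler_pM => //; rewrite lerDl.
  by rewrite -ltr_pdivlMr.
have cline (X : 'M[R]_n) t : {for t, continuous (fun t : R => X + t *: E)}.
  by apply: cvgD; [exact: cvg_cst|apply: cvgZr_tmp; exact: cvg_id].
have main (X : 'M[R]_n) : `|X - X0| < r / 2 -> simple X ->
    `|F (X + h *: E) - F X - h * D X0| <= e * `|h|.
  move=> Xr sX; have [s Hs] := simple_line E sX.
  pose u (t : R) := F (X + t *: E) - t * D X0.
  have := @MVT_finite_abs s u (fun t => D (X + t *: E) - D X0) e h (ltW e0).
  rewrite /u scale0r addr0 mul0r subr0 addrAC; apply.
    move=> t th ts; have [NX Dt] := Hr _ (inr _ _ Xr th).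
    split; last by rewrite distrC.
    apply: is_deriveB; first by apply: is_derive_line; exact: (sD _ NX (Hs _ ts)).
    have -> : (fun t => t * D X0) = (fun t => D X0 *: t) by apply/funext => ?; rewrite [RHS]mulrC.
    by apply: is_derive_eq; rewrite [LHS]mulr1.
  move=> t th; have [NX Dt] := Hr _ (inr _ _ Xr th).
  apply: cont_add; last by apply: cont_opp; apply: cont_mul; [exact: cvg_id|exact: cont_cst].
  by apply: (@continuous_comp _ _ _ (fun t : R => X + t *: E) F); [exact: cline|exact: cF].
have lim : `|F (X0 + h *: E) - F X0 - h * D X0| <= e * `|h|.
  have [P sP] := simple_dense X0.
  have Zr : `|X0 - X0| < r / 2 by rewrite subrr normr0.
  have [Nh _] := Hr _ (inr X0 h Zr (lexx _)).
  have c0 : (X0 + t *: P) @[t --> (0:R)^'+] --> X0.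
    have {2}-> : X0 = X0 + 0 *: P by rewrite scale0r addr0.
    apply: cvgD; first exact: cvg_cst.
    by apply: cvgZr_tmp; exact: cvg_within.
  have c1 : (X0 + t *: P + h *: E) @[t --> (0:R)^'+] --> X0 + h *: E.
    by apply: cvgD => //; exact: cvg_cst.
  have cc : `|F (X0 + t *: P + h *: E) - F (X0 + t *: P) - h * D X0| @[t --> (0:R)^'+] -->
      `|F (X0 + h *: E) - F X0 - h * D X0|.
    apply: cvg_norm; apply: cvgB; last exact: cvg_cst.
    apply: cvgB.
      exact: (cvg_cont c1 (cF _ Nh)).
    exact: (cvg_cont c0 (cF _ NX0)).
  apply: (ler_cvg_to cc (cvg_cst _)).
  have nr : \forall t \near (0:R)^'+, `|X0 + t *: P - X0| < r / 2.
    exact: (c0 _ (nball_near X0 r20)).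
  near=> t; apply: main; first by near: t.
  by apply: sP; near: t; exact: nbhs_right_gt.
have -> : h^-1 *: (F (h *: E + X0) - F X0) = h^-1 * (F (X0 + h *: E) - F X0) by rewrite [h *: E + X0]addrC.
have -> : D X0 - h^-1 * (F (X0 + h *: E) - F X0) = - (h^-1 * (F (X0 + h *: E) - F X0 - h * D X0)).
  by field.
by rewrite normrN normrM normfV ler_pdivrMl ?normr_gt0// [leRHS]mulrC.
Unshelve. all: by end_near. Qed.

End GenericLines.

Lemma cont_comp (T V W : topologicalType) (f : T -> V) (g : V -> W) (x : T) :
  {for x, continuous f} -> {for f x, continuous g} -> {for x, continuous (fun z => g (f z))}.
Proof. exact: continuous_comp. Qed.

Lemma cont_fst (T V : topologicalType) (z : T * V) : {for z, continuous (@fst T V)}.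
Proof. exact: cvg_fst. Qed.

Lemma orth_trmul (R : realType) n (A B : 'M[R]_n) : A^T *m A = 1%:M -> B^T *m B = 1%:M ->
  (A^T *m B) *m (A^T *m B)^T = 1%:M.
Proof.
move=> oA oB; rewrite trmx_mul trmxK mulmxA -(mulmxA A^T) (orthC oB) mulmx1.
exact: oA.
Qed.

(** * First and second derivative of the lifted function *)

Section SpectralFunction.
Variables (R : realType) (n : nat) (U : set 'rV[R]_n) (f : 'rV[R]_n -> R).
Variables (g : 'I_n -> 'rV[R]_n -> R) (hess : 'I_n -> 'I_n -> 'rV[R]_n -> R).
Hypothesis oU : open U.
Hypothesis cf : forall x, U x -> {for x, continuous f}.
Hypothesis cg : forall k x, U x -> {for x, continuous (g k)}.
Hypothesis ch : forall k l x, U x -> {for x, continuous (hess k l)}.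
Hypothesis fst_ : strict_grad U f g.
Hypothesis gst : forall k, strict_grad U (g k) (hess k).
Hypothesis grad_sw_near : forall x i j k, U x -> x 0 i = x 0 j ->
  \forall y \near x, g (tperm i j k) (sw i j y) = g k y.
Hypothesis hess_sw : forall x i j k l, U x -> x 0 i = x 0 j ->
  hess (tperm i j k) (tperm i j l) x = hess k l x.

(** A choice of eigenbasis without any regularity; [GG] and [HH] are regular because their values do
    not depend on it. *)
Definition eigQ (X : 'M[R]_n) : 'M[R]_n := xget 1%:M [set Q | eigsys (symp X) Q (lam X)].

Lemma eigQP X : eigsys (symp X) (eigQ X) (lam X).
Proof.
have [Q eQ] := lam_spec X; rewrite /eigQ; case: xgetP => [Q' _ //|/(_ Q)].
by move=> H; exfalso; exact: H.
Qed.

Let N : set 'M[R]_n := [set X | U (lam X)].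

Lemma open_lam : open N.
Proof. by apply: open_comp => // X _; exact: cont_lam. Qed.

Definition GG (E X : 'M[R]_n) := Gform g (symp E) (lam X) (eigQ X).
Definition HH (E E' X : 'M[R]_n) := Hform g hess (symp E) (symp E') (lam X) (eigQ X).

Lemma cont_form2 (E : 'M[R]_n) (z0 : 'rV[R]_n * 'M[R]_n) i j :
  {for z0, continuous (fun z : 'rV[R]_n * 'M[R]_n => (z.2^T *m E *m z.2) i j)}.
Proof.
apply: ((cont_mxP _ _).1 _ i j); apply: cont_mulmx; last exact: cvg_snd.
by apply: cont_mulmx; [apply: cont_trmx; exact: cvg_snd|exact: cont_cst].
Qed.

Lemma cont_fst_comp (u : 'rV[R]_n -> R) (z0 : 'rV[R]_n * 'M[R]_n) :
  {for z0.1, continuous u} -> {for z0, continuous (fun z : 'rV[R]_n * 'M[R]_n => u z.1)}.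
Proof.
by move=> cu; exact: (cont_comp (@cont_fst _ _ z0) cu).
Qed.

Lemma eig_form_cont (Phi : 'rV[R]_n -> 'M[R]_n -> R) X0 : U (lam X0) ->
  (forall X Q Q' x, U x -> eigsys X Q x -> eigsys X Q' x -> Phi x Q' = Phi x Q) ->
  (forall x Q, U x -> {for (x, Q), continuous (fun z : 'rV[R]_n * 'M[R]_n => Phi z.1 z.2)}) ->
  {for X0, continuous (fun X => Phi (lam X) (eigQ X))}.
Proof.
move=> Ux inv cPhi; apply/cont_distP => e e0.
have := @eig_cont R n (symp X0) Phi (Phi (lam X0) (eigQ X0)) _ e e0.
have H : forall Q0, eigsys (symp X0) Q0 (eigvals (symp X0)) ->
   Phi (eigvals (symp X0)) Q0 = Phi (lam X0) (eigQ X0) /\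
   {for (eigvals (symp X0), Q0), continuous (fun z : 'rV[R]_n * 'M[R]_n => Phi z.1 z.2)}.
  move=> Q0 eQ0; split; last exact: cPhi.
  exact: (inv _ _ _ _ Ux (eigQP X0) eQ0).
move=> /(_ H) K; have := @cont_symp R n X0 _ K; apply: nearS => X; apply.
exact: eigQP.
Qed.

Lemma cont_GG E X0 : N X0 -> {for X0, continuous (GG E)}.
Proof.
move=> NX0; apply: (eig_form_cont NX0).
  by move=> X Q Q' x Ux e1 e2; exact: (Gform_eig grad_sw_near (symp E) Ux e1 e2).
move=> x Q Ux; apply: cont_sum => j _; apply: cont_mul; last exact: cont_form2.
exact: (@cont_fst_comp (g j) (x, Q) (@cg j x Ux)).
Qed.

Lemma cont_HH E E' X0 : N X0 -> {for X0, continuous (HH E E')}.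
Proof.
move=> NX0; apply: (eig_form_cont NX0).
  move=> X Q Q' x Ux e1 e2.
  exact: (Hform_eig grad_sw_near hess_sw (symp E) (symp E') Ux e1 e2).
move=> x Q Ux; apply: cont_sum => i _; apply: cont_sum => j _; apply: cont_mul; first exact: cont_form2.
have [->|ij] := eqVneq i j.
  apply: cont_sum => l _; apply: cont_mul; last exact: cont_form2.
  exact: (@cont_fst_comp (hess j l) (x, Q) (@ch j l x Ux)).
apply: cont_mul; last exact: cont_form2.
exact: (@cont_fst_comp (dd g hess i j) (x, Q) (dd_cont cg ch gst grad_sw_near ij Ux)).
Qed.

Lemma lam_derive X E j : simple X ->
  is_derive X E (fun X => lam X 0 j) (((eigQ X)^T *m symp E *m eigQ X) j j).
Proof.
move=> sX; apply/is_deriveP.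
have eY t : eigsys (t *: symp E + symp X) (eigQ (t *: E + X)) (lam (t *: E + X)).
  by rewrite -symp_linear; exact: eigQP.
exact: (y_deriv (eigQP X) (symp_sym E) sX eY).
Qed.

Lemma strict_lam_derive (F : 'rV[R]_n -> R) dF X E : strict_grad U F dF -> N X -> simple X ->
  is_derive X E (fun X => F (lam X))
    (\sum_l ((eigQ X)^T *m symp E *m eigQ X) l l * dF l (lam X)).
Proof.
move=> sF NX sX.
have := @strict_derive_comp R _ n F (dF ^~ (lam X)) (@lam R n) X E
  (\row_l ((eigQ X)^T *m symp E *m eigQ X) l l).
rewrite (eq_bigr (fun l => ((eigQ X)^T *m symp E *m eigQ X) l l * dF l (lam X))); last first.
  by move=> l _; rewrite mxE.
apply; first by move=> e e0; exact: sF.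
by move=> l; rewrite mxE; exact: lam_derive.
Qed.

Lemma derive_F X E : N X -> is_derive X E (fun X => f (lam X)) (GG E X).
Proof.
move=> NX; apply: (derive_generic open_lam NX).
- by move=> Y NY; exact: (cont_comp (@cont_lam R n Y) (cf NY)).
- exact: cont_GG.
- move=> Y NY sY; have := strict_lam_derive E fst_ NY sY.
  by rewrite /GG /Gform; under eq_bigr do rewrite mulrC.
Qed.

(** At a simple spectrum, [GG E] along the line is a combination of the sums [u t i k]; their
    difference quotients follow from [Wquot] and from the derivative of the gradient along the
    eigenvalues. [derive_generic] then covers multiple spectra. *)
Lemma derive_GG X E E' : N X -> is_derive X E' (GG E) (HH E E' X).
Proof.
move=> NX; apply: (@derive_generic R n N (GG E) (HH E E') E' X open_lam NX (@cont_GG E) (@cont_HH E E')).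
move=> {NX} {}X NX sX; apply/is_deriveP.
set Q := eigQ X; set x := lam X.
pose P t := eigQ (t *: E' + X); pose y t := lam (t *: E' + X).
pose W t := Q^T *m P t.
pose h1 := Q^T *m symp E *m Q; pose h := Q^T *m symp E' *m Q.
have eY t : eigsys (t *: symp E' + symp X) (P t) (y t).
  by rewrite -symp_linear; exact: eigQP.
have eX : eigsys (symp X) Q x by exact: eigQP.
have yc i := @ycvg R n _ _ _ _ eX (symp_sym E') P y eY i.
have wq i j k := @Wquot R n _ _ _ _ eX (symp_sym E') sX P y eY i j k.
have [oQ _ _] := eX.
have oW t : W t *m (W t)^T = 1%:M.
  by have [oP _ _] := eY t; exact: (orth_trmul oQ oP).
have PW t : P t = Q *m W t by rewrite /W mulmxA (orthC oQ) mul1mx.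
pose u t i k := \sum_j W t i j * W t k j * g j (y t).
have GGt t : GG E (t *: E' + X) = \sum_i \sum_k h1 i k * u t i k.
  rewrite /GG /Gform -/(P t) -/(y t) PW trmx_mul.
  have -> : (W t)^T *m Q^T *m symp E *m (Q *m W t) = (W t)^T *m h1 *m W t by rewrite /h1 !mulmxA.
  under eq_bigr do rewrite formE mulr_sumr.
  rewrite exchange_big; apply: eq_bigr => i _ /=.
  under eq_bigr do rewrite mulr_sumr.
  rewrite exchange_big; apply: eq_bigr => k _ /=; rewrite /u mulr_sumr.
  by apply: eq_bigr => j _; ring.
have GG0 : GG E X = \sum_i \sum_k h1 i k * ((i == k)%:R * g i x).
  rewrite /GG /Gform; apply: eq_bigr => i _; rewrite (bigD1 i)//= eqxx mul1r big1 ?addr0.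
    by rewrite mulrC.
  by move=> k /negbTE; rewrite eq_sym => ->; rewrite mul0r mulr0.
have du i k : t^-1 * (u t i k - (i == k)%:R * g i x) @[t --> 0^'] -->
   (if i == k then \sum_l hess i l x * h l l else dd g hess i k x * h i k).
  have gy j : g j (y t) @[t --> 0^'] --> g j x.
    have yy : y t @[t --> 0^'] --> x by apply/cvg_mxP => a b; rewrite ord1; exact: yc.
    exact: (cvg_cont yy (@cg j x NX)).
  have gd : t^-1 * (g i (y t) - g i x) @[t --> 0^'] --> \sum_l h l l * hess i l x.
    by have /is_deriveP := strict_lam_derive E' (gst i) NX sX.
  (* As [\sum_j W t i j * W t k j] is the Kronecker delta, [g j] may be replaced by [g j - g i].
     This removes the term [j = i], which [Wquot] does not cover. *)
  have E1 t : t^-1 * (u t i k - (i == k)%:R * g i x) =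
     \sum_(j | j != i) (t^-1 * (W t i j * W t k j)) * (g j (y t) - g i (y t)) +
     (i == k)%:R * (t^-1 * (g i (y t) - g i x)).
    have S : \sum_j W t i j * W t k j = (i == k)%:R.
      have := congr1 (fun A : 'M[R]_n => A i k) (oW t); rewrite [LHS]mxE [RHS]mxE => <-.
      by apply: eq_bigr => j _; rewrite [(W t)^T j k]mxE.
    have -> : \sum_(j | j != i) (t^-1 * (W t i j * W t k j)) * (g j (y t) - g i (y t)) =
       \sum_j (t^-1 * (W t i j * W t k j)) * (g j (y t) - g i (y t)).
      by rewrite [RHS](bigD1 i)//= subrr mulr0 add0r.
    rewrite (eq_bigr (fun j => t^-1 * (W t i j * W t k j * g j (y t)) -
        (t^-1 * g i (y t)) * (W t i j * W t k j))); last by move=> j _; ring.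
    rewrite sumrB -!mulr_sumr S -/(u t i k).
    by move: (g i (y t)) (g i x) (u t i k) (t^-1) ((i == k)%:R) => *; ring.
  have L : (\sum_(j | j != i) (t^-1 * (W t i j * W t k j)) * (g j (y t) - g i (y t)) +
     (i == k)%:R * (t^-1 * (g i (y t) - g i x))) @[t --> 0^'] -->
     \sum_(j | j != i) ((k == j)%:R * h i j / (x 0 j - x 0 i)) * (g j x - g i x) +
     (i == k)%:R * \sum_l h l l * hess i l x.
    apply: cvgD; last by apply: cvgM; [exact: cvg_cst|exact: gd].
    apply: cvg_sumr => j ji; apply: cvgM; first by apply: wq; rewrite eq_sym.
    by apply: cvgB; exact: gy.
  have -> : (if i == k then \sum_l hess i l x * h l l else dd g hess i k x * h i k) =
     \sum_(j | j != i) ((k == j)%:R * h i j / (x 0 j - x 0 i)) * (g j x - g i x) +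
     (i == k)%:R * \sum_l h l l * hess i l x.
    have [<-|ik] := eqVneq i k.
      rewrite [X in _ = X + _]big1; last by move=> j /negbTE; rewrite eq_sym => ->; rewrite !mul0r.
      by rewrite add0r mul1r; apply: eq_bigr => l _; rewrite mulrC.
    rewrite mul0r addr0 (bigD1 k)/=; last by rewrite eq_sym.
    rewrite eqxx mul1r [X in _ = _ + X]big1; last first.
      by move=> j /andP[_ /negbTE]; rewrite eq_sym => ->; rewrite !mul0r.
    rewrite addr0.
    have xik := sX _ _ ik; rewrite /dd (negbTE xik).
    have n1 : x 0 i - x 0 k != 0 by rewrite subr_eq0.
    have n2 : x 0 k - x 0 i != 0 by rewrite subr_eq0 eq_sym.
    by field; rewrite n1 n2.
  by apply: cvg_eq_dnbhs L; apply: nearW => t; rewrite E1.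
have -> : HH E E' X = \sum_i \sum_k h1 i k *
   (if i == k then \sum_l hess i l x * h l l else dd g hess i k x * h i k) by [].
have L : (\sum_i \sum_k h1 i k * (t^-1 * (u t i k - (i == k)%:R * g i x))) @[t --> 0^'] -->
   \sum_i \sum_k h1 i k * (if i == k then \sum_l hess i l x * h l l else dd g hess i k x * h i k).
  apply: cvg_sumr => i _; apply: cvg_sumr => k _; apply: cvgM; first exact: cvg_cst.
  exact: du.
apply: cvg_eq_dnbhs L; apply: nearW => t.
rewrite GGt GG0 -sumrB scaler_sumr; apply: eq_bigr => i _.
rewrite -sumrB scaler_sumr; apply: eq_bigr => k _; rewrite -mulrBr.
exact: mulrCA.
Qed.

End SpectralFunction.

Section SpectralC2.
Variables (R : realType) (n : nat) (U : set 'rV[R]_n) (f : 'rV[R]_n -> R).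
Hypotheses (oU : open U) (cf : C2_on U f).
Hypothesis fsw : forall x i j, U x -> x 0 i = x 0 j -> \forall y \near x, f (sw i j y) = f y.

Lemma C2_cont_grad k x : U x -> {for x, continuous (partial k f)}.
Proof. by move=> Ux; exact: (C1_continuous oU (C2_partial k oU cf) Ux). Qed.

(** Kept as an identity near [x], not only at [x], so that [C2_hess_sw] can differentiate it once
    more. *)
Lemma C2_grad_sw_near x i j k : U x -> x 0 i = x 0 j ->
  \forall y \near x, partial (tperm i j k) f (sw i j y) = partial k f y.
Proof.
move=> Ux E; have /near_nball[d d0 Hd] := fsw Ux E.
apply: (nearS _ (nball_near x d0)) => y yd.
rewrite -partial_sw; apply: near_eq_derive.
have : (\forall z \near y, `|z - x| < d) by apply: open_nbhs_nbhs; split=> //; exact: open_nball.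
by apply: nearS => z zd; exact: Hd.
Qed.

Lemma C2_hess_sw x i j k l : U x -> x 0 i = x 0 j ->
  partial (tperm i j l) (partial (tperm i j k) f) x = partial l (partial k f) x.
Proof.
move=> Ux E; rewrite -[in LHS](sw_fix E) -partial_sw.
by apply: near_eq_derive; exact: (C2_grad_sw_near k Ux E).
Qed.

Let g k := partial k f.
Let hess k l := partial l (partial k f).

Lemma spectral_derive X E : U (lam X) -> is_derive X E (fun X => f (lam X)) (GG g E X).
Proof.
move=> UX; have [c0 _ _ _ _] := cf.
have st : strict_grad U f g.
  by move=> x e Ux e0; exact: (C1_strict_at oU (C2_C1 oU cf) Ux e0).
exact: (@derive_F R n U f g oU c0 C2_cont_grad st C2_grad_sw_near).
Qed.

Lemma is_derive_vec (F : 'M[R]_n -> R) (w v : 'rV[R]_(n * n)) d :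
  is_derive (vec_mx w) (vec_mx v) F d -> is_derive w v (fun w => F (vec_mx w)) d.
Proof.
move=> /is_deriveP H; apply/is_deriveP.
have -> // : (fun h : R => h^-1 *: (F (vec_mx (h *: v + w)) - F (vec_mx w))) =
  (fun h : R => h^-1 *: (F (h *: vec_mx v + vec_mx w) - F (vec_mx w))).
by apply/funext => h; rewrite linearP.
Qed.

(** Invariance is asked only near each point and only under transpositions of its equal coordinates,
    which is all that local symmetry can give. The derivatives are [GG] and [HH] in the coordinate
    directions. *)
Theorem spectral_C2 : C2_on [set w | U (lam (vec_mx w))] (fun w : 'rV[R]_(n * n) => f (lam (vec_mx w))).
Proof.
set W := [set w | _].
have oW : open W.
  have -> : W = vec_mx @^-1` [set X : 'M[R]_n | U (lam X)] by [].
  apply: open_comp; last exact: (@open_lam R n U oU).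
  by move=> w _; exact: vec_mx_continuous.
have Hcg : forall k x, U x -> {for x, continuous (g k)} by exact: C2_cont_grad.
have Hch : forall k l x, U x -> {for x, continuous (hess k l)}.
  by case: cf => _ _ _ _ c5 k l x Ux; exact: c5.
have Hgst k : strict_grad U (g k) (hess k).
  by move=> x e Ux e0; exact: (C1_strict_at oU (C2_partial k oU cf) Ux e0).
have Hgs : forall x i j k, U x -> x 0 i = x 0 j ->
  \forall y \near x, g (tperm i j k) (sw i j y) = g k y by exact: C2_grad_sw_near.
have Hhs : forall x i j k l, U x -> x 0 i = x 0 j ->
  hess (tperm i j k) (tperm i j l) x = hess k l x by move=> x i j k l; exact: C2_hess_sw.
apply: (C2_intro (dg := fun k w => GG g (vec_mx (ebasis R k)) (vec_mx w)) oW).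
  move=> k w Ww; apply: (@is_derive_vec (fun X => f (lam X)) w (ebasis R k)).
  exact: spectral_derive.
move=> k; apply: (C1_intro (dg := fun l w => HH g hess (vec_mx (ebasis R k)) (vec_mx (ebasis R l)) (vec_mx w)) oW).
  move=> l w Ww; apply: (@is_derive_vec (GG g (vec_mx (ebasis R k))) w (ebasis R l)).
  exact: (@derive_GG R n U g hess oU Hcg Hch Hgst Hgs Hhs).
move=> l w Ww; apply: cont_comp; first exact: vec_mx_continuous.
exact: (@cont_HH R n U g hess Hcg Hch Hgst Hgs Hhs).
Qed.

End SpectralC2.

(** * Local structure of a locally symmetric submanifold *)

Section Jacobians.
Variable R : realType.

Lemma jac_is_derive p q (W : set 'rV[R]_p) (f : 'rV[R]_p -> 'rV[R]_q) w v l :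
  open W -> (forall l, C1_on W (fun w => f w 0 l)) -> W w ->
  is_derive w v (fun w => f w 0 l) ((v *m jac f w) 0 l).
Proof.
move=> oW cf Ww.
have := @C1_derive_comp R 'rV[R]_p p W (fun w => f w 0 l) id w v v oW (cf l) Ww.
have -> : (v *m jac f w) 0 l = \sum_k v 0 k * partial k (fun w => f w 0 l) w.
  by rewrite mxE; apply: eq_bigr => k _; rewrite mxE.
by apply => k; exact: is_derive_coord.
Qed.

Lemma is_derive_unique (V : normedModType R) (f : V -> R) x v a b :
  is_derive x v f a -> is_derive x v f b -> a = b.
Proof. by move=> [_ <-] [_ <-]. Qed.

Lemma jac_comp p q r (W : set 'rV[R]_p) (U : set 'rV[R]_q)
    (f : 'rV[R]_p -> 'rV[R]_q) (g : 'rV[R]_q -> 'rV[R]_r) w :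
  open W -> open U -> (forall l, C1_on W (fun w => f w 0 l)) ->
  (forall l, C1_on U (fun u => g u 0 l)) -> W w -> U (f w) ->
  jac (fun w => g (f w)) w = jac f w *m jac g (f w).
Proof.
move=> oW oU cf cg Ww Ufw; apply/matrixP => k l; rewrite [LHS]mxE.
have H := C1_comp_is_derive k oU cf (cg l) Ww Ufw.
rewrite /partial; have -> := @derive_val _ _ _ _ _ _ _ H.
by rewrite mxE; apply: eq_bigr => m _; rewrite !mxE.
Qed.

Lemma jac_near p q (f g : 'rV[R]_p -> 'rV[R]_q) w :
  (\forall v \near w, f v = g v) -> jac f w = jac g w.
Proof.
move=> E; apply/matrixP => k l; rewrite !mxE; apply: near_eq_derive.
by apply: (nearS _ E) => v ->.
Qed.

Definition affmap p q (a : 'rV[R]_p) (C : 'M[R]_(p, q)) (x : 'rV[R]_p) : 'rV[R]_q := (x - a) *m C.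

Lemma C2_affmap p q (a : 'rV[R]_p) (C : 'M[R]_(p, q)) W l : open W ->
  C2_on W (fun x => affmap a C x 0 l).
Proof.
move=> oW.
apply: (C2_eq oW (g := fun x => \sum_k (x 0 k + - a 0 k) * C k l)).
  by move=> x _; rewrite [RHS]mxE; apply: eq_bigr => k _; rewrite !mxE.
apply: (C2_sum _ oW) => k _; apply: (C2_mul oW _ (C2_cst _ oW)).
exact: (C2_add oW (C2_coord _ oW) (C2_cst _ oW)).
Qed.

Lemma jac_affmap p q (a : 'rV[R]_p) (C : 'M[R]_(p, q)) x : jac (affmap a C) x = C.
Proof.
apply/matrixP => k l; rewrite mxE /partial.
have H : is_derive x (ebasis R k) (fun x => affmap a C x 0 l) (C k l).
  apply/is_deriveP; apply: cvg_near_cst; near=> h.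
  have h0 : h != 0 by near: h; exact: nbhs_dnbhs_neq.
  have -> : affmap a C (h *: ebasis R k + x) = h *: row k C + affmap a C x.
    by rewrite /affmap -addrA mulmxDl -scalemxAl -rowE.
  by rewrite !mxE addrK [LHS]mulrA mulVf// mul1r.
by have := @derive_val _ _ _ _ _ _ _ H.
Unshelve. all: by end_near. Qed.

Lemma cont_affmap p q (a : 'rV[R]_p) (C : 'M[R]_(p, q)) x : {for x, continuous (affmap a C)}.
Proof.
apply: (@C1_continuous_row R p q setT) => //; first exact: openT.
by move=> l; apply: C2_C1; [exact: openT|apply: C2_affmap; exact: openT].
Qed.

Lemma jacobian_rank D a b (phi : 'rV[R]_D -> 'M[R]_(a, b)) w :
  \rank (Defs.jacobian phi w) = D <->
  (forall u : 'rV[R]_D, (forall i j, \sum_k u 0 k * partial k (fun v => phi v i j) w = 0) -> u = 0).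
Proof.
have E (u : 'rV[R]_D) i j : (u *m Defs.jacobian phi w) 0 (mxvec_index i j) =
    \sum_k u 0 k * partial k (fun v => phi v i j) w.
  rewrite mxE; apply: eq_bigr => k _; rewrite mxE; congr (_ * partial k _ w).
  by apply/funext => v; rewrite mxvecE.
split=> [rk u Hu|H].
  have rf : row_free (Defs.jacobian phi w) by rewrite /row_free rk.
  apply/eqP; rewrite -(mulmx_free_eq0 _ rf); apply/eqP/rowP => l.
  by case/mxvec_indexP: l => i j; rewrite E Hu mxE.
apply/eqP; rewrite -[_ == _]/(row_free _); apply: inj_row_free => u Hu; apply: H => i j.
by rewrite -E Hu mxE.
Qed.

Lemma row_sqr0 n (v : 'rV[R]_n) : (v *m v^T) 0 0 = 0 -> v = 0.
Proof.
rewrite mxE => /eqP; rewrite psumr_eq0 => [/allP Hv|k _]; last by rewrite mxE -expr2 sqr_ge0.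
apply/rowP => k; have := Hv k (mem_index_enum k); rewrite !mxE /= mulf_eq0 orbb => /eqP.
by [].
Qed.

(** [u *m J *m J^T *m u^T] is the squared length of [u *m J]. *)
Lemma gram_unit d n (J : 'M[R]_(d, n)) : (forall u : 'rV[R]_d, u *m J = 0 -> u = 0) ->
  J *m J^T \in unitmx.
Proof.
move=> H; rewrite -row_free_unit; apply: inj_row_free => u Hu; apply: H; apply: row_sqr0.
by rewrite trmx_mul mulmxA -(mulmxA u) Hu mul0mx mxE.
Qed.

End Jacobians.

Section LocalGraph.
Variables (R : realType) (n d : nat) (M : set 'rV[R]_n) (xb : 'rV[R]_n).
Hypotheses (Mxb : M xb) (subM : C2_submanifold M d).

(* [rho] retracts a neighbourhood of [xb] onto [M] along the orthogonal complement of the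
   tangent space, the row space of [J]; [C] is the pseudo-inverse of [J]. *)
Definition retraction (J : 'M[R]_(d, n)) (C : 'M[R]_(n, d)) (rho : 'rV[R]_n -> 'rV[R]_n) (r : R) :=
  [/\ 0 < r, J *m C = 1%:M, (C *m J)^T = C *m J &
   (forall l, C2_on [set x | `|x - xb| < r] (fun x => rho x 0 l))] /\
  [/\ (forall x, `|x - xb| < r -> M (rho x)),
      (forall x, `|x - xb| < r -> M x -> rho x = x),
      (forall x, `|x - xb| < r -> (rho x - x) *m C = 0),
      (forall x y, (x - y) *m C = 0 -> rho x = rho y) &
      jac rho xb = C *m J].

(** Let [q] be the chart [phi] followed by the projection to tangent coordinates. Its jacobian at
    [w0] is [J *m C = 1%:M], so [q] is invertible near [w0], and [rho] is the projection followed by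
    the inverse of [q] and by [phi]. *)
Lemma exists_retraction : exists J C rho r, retraction J C rho r.
Proof.
have [U [W [phi [[oU Uxb oW cphi injphi] [imphi rkphi hphi]]]]] := subM Mxb.
have [w0 Ww0 phiw0] : (phi @` W) xb by rewrite imphi.
have cphi2 l : C2_on W (fun w => phi w 0 l) by exact: cphi.
have cphi1 l : C1_on W (fun w => phi w 0 l) := C2_C1 oW (cphi2 l).
pose J := jac phi w0.
have Jfree (u : 'rV[R]_d) : u *m J = 0 -> u = 0.
  move=> Hu; apply: ((jacobian_rank phi w0).1 (rkphi _ Ww0)) => i j; rewrite ord1.
  transitivity ((u *m J) 0 j); last by rewrite Hu mxE.
  by rewrite mxE; apply: eq_bigr => k _; rewrite mxE.
have uG := gram_unit Jfree.
pose C := J^T *m invmx (J *m J^T).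
have JC : J *m C = 1%:M by rewrite /C mulmxA mulmxV.
have PiT : (C *m J)^T = C *m J by rewrite /C !trmx_mul trmxK trmx_inv trmx_mul trmxK mulmxA.
pose q w := affmap xb C (phi w).
have cq2 l : C2_on W (fun w => q w 0 l).
  apply: (C2_comp (U := setT) (f := phi) (g := fun x => affmap xb C x 0 l) oW openT cphi2) => //.
  exact: (C2_affmap _ _ _ openT).
have jq : jac q w0 = 1%:M.
  rewrite (jac_comp (U := setT) oW openT cphi1 _ Ww0)//; last first.
    by move=> l; exact: (C2_C1 openT (C2_affmap _ _ _ openT)).
  by rewrite jac_affmap.
have uq : jac q w0 \in unitmx by rewrite jq unitmx1.
have [V [g [[oV Vw0 VW Vu] [gq qopen cg]]]] := inverse_function oW cq2 Ww0 uq.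
have oF : open (q @` V) by exact: qopen.
have cg1 l : C1_on (q @` V) (fun y => g y 0 l) := C2_C1 oF (cg l).
have q0 : q w0 = 0 by rewrite /q /affmap phiw0 subrr mul0mx.
have F0 : (q @` V) 0 by exists w0.
have gF y : (q @` V) y -> W (g y) by move=> [w Vw <-]; rewrite gq//; exact: VW.
(* The homeomorphism clause enters here: points of [M] in [U] and [OO] come from parameters in [V],
   so no distant parameter returns close to [xb]. *)
have [OO [oO imO]] := hphi V oV.
have Oxb : OO xb by have : (phi @` (W `&` V)) xb by [exists w0]; rewrite imO => -[].
pose rho x := phi (g (affmap xb C x)).
have nF : \forall x \near xb, (q @` V) (affmap xb C x).
  have := @cont_affmap R n d xb C xb; rewrite /prop_for /continuous_at /affmap subrr mul0mx => cf.
  exact: (cf _ (open_nbhs_nbhs (conj oF F0))).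
have nUO : \forall x \near xb, U x /\ OO x.
  by apply: near_and; exact: open_nbhs_nbhs.
have [r r0 Hr] := near_nball (near_and nF nUO).
exists J, C, rho, r; split.
  split=> // l.
  have oB : open [set x | `|x - xb| < r] by exact: open_nball.
  apply: (C2_comp (U := q @` V) (f := affmap xb C) (g := fun y => phi (g y) 0 l) oB oF).
  - by move=> m; exact: (C2_affmap _ _ _ oB).
  - exact: (C2_comp (U := W) (f := g) (g := fun w => phi w 0 l) oF oW cg (cphi2 l) gF).
  - by move=> x /Hr[].
split.
- move=> x /Hr[[w Vw E] _]; rewrite /rho -E gq//.
  by have : (phi @` W) (phi w) by [exists w => //; exact: VW]; rewrite imphi => -[].
- move=> x /Hr[_ [Ux Ox]] Mx.
  have : (phi @` (W `&` V)) x by rewrite imO imphi.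
  by move=> [w [Ww Vw] <-]; rewrite /rho -/(q w) gq.
- move=> x /Hr[[w Vw E] _]; rewrite /rho -E gq//.
  have -> : phi w - x = (phi w - xb) - (x - xb) by rewrite opprB addrA subrK.
  by rewrite mulmxBl -/(affmap xb C (phi w)) -/(affmap xb C x) -E subrr.
- move=> x y xy; rewrite /rho; congr (phi (g _)).
  apply/eqP; rewrite -subr_eq0 /affmap -mulmxBl opprB addrA subrK.
  by apply/eqP.
- have aff1 l : C1_on setT (fun x => affmap xb C x 0 l) := C2_C1 openT (C2_affmap _ _ _ openT).
  have a0 : affmap xb C xb = 0 by rewrite /affmap subrr mul0mx.
  have cpg l : C1_on (q @` V) (fun y => phi (g y) 0 l).
    exact: (C1_comp (U := W) (f := g) (g := fun w => phi w 0 l) oF oW cg1 (cphi1 l) gF).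
  have gw0 : g 0 = w0 by rewrite -q0 gq.
  rewrite /rho (jac_comp (U := q @` V) (g := fun y => phi (g y)) openT oF aff1 cpg I) a0//.
  rewrite jac_affmap (jac_comp oF oW cg1 cphi1 F0) gw0//; congr (_ *m _).
  have : jac (fun w => g (q w)) w0 = 1%:M.
    transitivity (jac (affmap 0 1%:M : 'rV[R]_d -> _) w0); last exact: jac_affmap.
    apply: jac_near; apply: (nearS _ (open_nbhs_nbhs (conj oV Vw0))) => v Vv.
    by rewrite gq// /affmap subr0 mulmx1.
  rewrite (jac_comp oW oF (fun l => C2_C1 oW (cq2 l)) cg1 Ww0) q0// jq mul1mx => ->.
  by rewrite mul1mx.
Qed.

End LocalGraph.

Section EuclideanBall.
Variables (R : realType) (n : nat).

Lemma nball_eball (x : 'rV[R]_n) delta : 0 < delta ->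
  exists2 r, 0 < r & forall y, `|y - x| < r -> eball x delta y.
Proof.
move=> d0; have n0 : 0 < (n.+1%:R : R) by [].
(* With this radius the [n] squares add up to less than [delta ^+ 2], also for [n = 0]. *)
exists (delta / n.+1%:R); first by rewrite divr_gt0.
move=> y yr; rewrite /eball /=.
have H i : (y 0 i - x 0 i) ^+ 2 <= (delta / n.+1%:R) ^+ 2.
  rewrite -[leLHS]real_normK ?num_real// ler_pXn2r ?nnegrE//; last by rewrite ltW// divr_gt0.
  apply: le_trans (ltW yr).
  by have := le_mx_norm (y - x) 0 i; rewrite !mxE.
apply: (@le_lt_trans _ _ (\sum_(i < n) (delta / n.+1%:R) ^+ 2)); first by apply: ler_sum => i _.
rewrite sumr_const card_ord -[ltLHS]mulr_natr expr_div_n.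
rewrite mulrAC ltr_pdivrMr ?exprn_gt0// ltr_pM2l ?exprn_gt0//.
by rewrite -natrX ltr_nat -mulnn; exact: leq_pmulr.
Qed.

Lemma pact_tperm i j (x : 'rV[R]_n) : pact (tperm i j) x = sw i j x.
Proof. by apply/rowP => k; rewrite !mxE tpermV. Qed.

End EuclideanBall.

(** * Transpositions fixing the base point *)

Section LocalSymmetry.
Variables (R : realType) (n d : nat) (M : set 'rV[R]_n) (xb : 'rV[R]_n).
Hypotheses (Mxb : M xb) (lsM : locally_symmetric M).
Variables (J : 'M[R]_(d, n)) (C : 'M[R]_(n, d)) (rho : 'rV[R]_n -> 'rV[R]_n) (r1 : R).
Hypothesis retr : retraction M xb J C rho r1.
Variable Pi : 'M[R]_n.
Hypothesis PiE : Pi = C *m J.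

Definition swmx (i j : 'I_n) : 'M[R]_n := perm_mx (tperm i j).

Lemma swE i j (x : 'rV[R]_n) : sw i j x = x *m swmx i j.
Proof.
apply/rowP => k; rewrite /swmx !mxE (bigD1 (tperm i j k))//= big1 ?addr0.
  by rewrite !mxE tpermK eqxx mulr1.
move=> l lk; rewrite !mxE; case: eqP => [E|]; last by rewrite mulr0.
by rewrite -E tpermK eqxx in lk.
Qed.

Lemma swmxT i j : (swmx i j)^T = swmx i j.
Proof. by rewrite /swmx tr_perm_mx tpermV. Qed.

Lemma sw_norm i j (x : 'rV[R]_n) : `|sw i j x| <= `|x|.
Proof. by apply: mx_norm_le => // a k; rewrite mxE; exact: le_mx_norm. Qed.

Lemma sw_sub i j (x y : 'rV[R]_n) : sw i j (x - y) = sw i j x - sw i j y.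
Proof. by apply/rowP => k; rewrite !mxE. Qed.

Lemma sw_ball i j x : xb 0 i = xb 0 j -> `|sw i j x - xb| <= `|x - xb|.
Proof. by move=> E; rewrite -{1}(sw_fix E) -sw_sub; exact: sw_norm. Qed.

Lemma M_sw : exists2 r, 0 < r & forall i j x, xb 0 i = xb 0 j -> `|x - xb| < r -> M x -> M (sw i j x).
Proof.
have [dl dl0 Hd] := lsM.2 xb Mxb; have [r r0 Hr] := nball_eball xb dl0.
exists r => // i j x E xr Mx.
have xbE : (M `&` eball xb dl) xb by split=> //; apply: Hr; rewrite subrr normr0.
have := Hd xb (tperm i j) xbE; rewrite pact_tperm (sw_fix E) => /(_ erefl) im.
have : (pact (tperm i j) @` (M `&` eball xb dl)) (sw i j x).
  by exists x; [split=> //; exact: Hr|rewrite pact_tperm].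
by rewrite im => -[].
Qed.

Let r10 : 0 < r1. Proof. by case: retr => -[]. Qed.
Let oB : open [set x | `|x - xb| < r1]. Proof. exact: open_nball. Qed.
Let Bxb : [set x | `|x - xb| < r1] xb. Proof. by rewrite /= subrr normr0. Qed.
Let crho l : C1_on [set x | `|x - xb| < r1] (fun x => rho x 0 l).
Proof. by case: retr => -[_ _ _ c] _; exact: (C2_C1 oB (c l)). Qed.

Lemma rho_xb : rho xb = xb.
Proof. by case: retr => _ [_ H _ _ _]; apply: H => //; exact: Bxb. Qed.

Lemma rho_cont x : `|x - xb| < r1 -> {for x, continuous rho}.
Proof. by move=> xr; exact: (C1_continuous_row oB crho xr). Qed.

Lemma rho_near e : 0 < e -> exists2 r, 0 < r <= r1 & forall x, `|x - xb| < r -> `|rho x - xb| < e.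
Proof.
move=> e0; have := rho_cont Bxb; rewrite /prop_for /continuous_at rho_xb => cr.
have [r r0 Hr] := near_nball (cr _ (nball_near xb e0)).
exists (Num.min r r1); first by rewrite lt_min r0 r10 ge_min lexx orbT.
by move=> x; rewrite lt_min => /andP[xr _]; exact: Hr.
Qed.

Lemma PiC : Pi *m C = C.
Proof. by case: retr => -[_ JC _ _] _; rewrite PiE -mulmxA JC mulmx1. Qed.

Lemma PiPi : Pi *m Pi = Pi.
Proof. by rewrite {2}PiE mulmxA PiC -PiE. Qed.

Lemma PiT : Pi^T = Pi.
Proof. by rewrite PiE; case: retr => -[]. Qed.

Lemma mulC0 (v : 'rV[R]_n) : v *m C = 0 <-> v *m Pi = 0.
Proof. by split=> H; [rewrite PiE mulmxA H mul0mx|rewrite -PiC mulmxA H mul0mx]. Qed.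

(* The curve [sw (rho (xb + t v))] stays in [M], so [rho] fixes it; differentiate at [t = 0]. *)
Lemma tangent_sw i j (v : 'rV[R]_n) : xb 0 i = xb 0 j ->
  sw i j (v *m Pi) *m Pi = sw i j (v *m Pi).
Proof.
move=> E; have [r r0 HM] := M_sw; case: retr => _ [rM Mr rC rD jr].
have e0 : 0 < Num.min r r1 by rewrite lt_min r0 r10.
have [r2 /andP[r20 r21] Hr2] := rho_near e0.
pose z (t : R) := sw i j (rho (xb + t *: v)).
have z0 : z 0 = xb by rewrite /z scale0r addr0 rho_xb sw_fix.
have dz l : is_derive (0:R) 1 (fun t => z t 0 l) (sw i j (v *m Pi) 0 l).
  have -> : (fun t => z t 0 l) = (fun t => rho (xb + t *: v) 0 (tperm i j l)).
    by apply/funext => t; rewrite mxE.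
  rewrite [sw _ _ _ 0 l]mxE.
  apply: (@is_derive_line R _ _ (fun x => rho x 0 (tperm i j l)) xb v 0).
  rewrite scale0r addr0 PiE -jr.
  exact: (jac_is_derive _ _ oB crho Bxb).
have nz : \forall t \near (0:R), rho (z t) = z t.
  have cl : {for (0:R), continuous (fun t : R => xb + t *: v)}.
    by apply: cvgD; [exact: cvg_cst|apply: cvgZr_tmp; exact: cvg_id].
  have : \forall t \near (0:R), `|xb + t *: v - xb| < r2.
    have := cl; rewrite /prop_for /continuous_at scale0r addr0 => cl'.
    exact: (cl' _ (nball_near xb r20)).
  apply: nearS => t tr.
  have := Hr2 _ tr; rewrite lt_min => /andP[a1 a2].
  apply: Mr; first exact: le_lt_trans (sw_ball _ E) a2.
  by apply: HM => //; apply: rM; exact: lt_le_trans r21.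
apply/rowP => l.
have d1 : is_derive (0:R) 1 (fun t => rho (z t) 0 l) ((sw i j (v *m Pi) *m Pi) 0 l).
  have := @C1_derive_comp R R n _ (fun x => rho x 0 l) z 0 1 (sw i j (v *m Pi)) oB (crho l).
  rewrite z0 => /(_ Bxb dz); have -> // : \sum_k sw i j (v *m Pi) 0 k * partial k (fun x => rho x 0 l) xb =
    (sw i j (v *m Pi) *m Pi) 0 l.
  move: (sw _ _ _) => u; rewrite PiE -jr [RHS]mxE; apply: eq_bigr => k _.
  by rewrite [jac _ _ _ _]mxE.
have d2 : is_derive (0:R) 1 (fun t => rho (z t) 0 l) (sw i j (v *m Pi) 0 l).
  by apply: near_eq_is_derive (dz l); apply: (nearS _ nz) => t ->.
exact: (is_derive_unique d1 d2).
Qed.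

(** [tangent_sw] makes the tangent space stable under the transposition. Both [Pi] and the
    transposition are symmetric matrices, so transposing that identity yields commutation. *)
Lemma Pi_sw i j (v : 'rV[R]_n) : xb 0 i = xb 0 j -> sw i j (v *m Pi) = sw i j v *m Pi.
Proof.
move=> E; pose S := swmx i j.
have H : Pi *m S *m Pi = Pi *m S.
  apply/row_matrixP => k; rewrite !rowE !mulmxA.
  by have := tangent_sw (delta_mx 0 k) E; rewrite !swE.
have H2 : S *m Pi = Pi *m S.
  have := congr1 trmx H; rewrite !trmx_mul PiT swmxT => HT.
  by rewrite -[LHS]HT mulmxA.
by rewrite !swE -!mulmxA H2.
Qed.

(** The projection [t] of [edif R i j] is tangent, hence so is [t - sw i j t], a multiple of
    [edif R i j]. If the multiple is nonzero, [edif R i j] is tangent; otherwise [t] is orthogonal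
    to [edif R i j], hence to itself. *)
Lemma edif_dich i j : xb 0 i = xb 0 j -> edif R i j *m Pi = 0 \/ edif R i j *m Pi = edif R i j.
Proof.
move=> E; set a := edif R i j; pose t := a *m Pi.
have tP : t *m Pi = t by rewrite /t -mulmxA PiPi.
have H : (t 0 i - t 0 j) *: a *m Pi = (t 0 i - t 0 j) *: a.
  by rewrite -sub_sw mulmxBl -Pi_sw// tP.
have [c0|c0] := eqVneq (t 0 i - t 0 j) 0; last first.
  right; apply: (scalerI c0); rewrite scalemxAl; exact: H.
left; have : (t *m t^T) 0 0 = 0.
  by rewrite {2}/t trmx_mul PiT mulmxA tP edif_dot.
exact: row_sqr0.
Qed.

Definition eta x := rho x - xb - (x - xb) *m Pi.

Lemma eta_C x : `|x - xb| < r1 -> eta x *m C = 0.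
Proof.
move=> xr; case: retr => _ [_ _ rC _ _].
rewrite /eta mulmxBl -mulmxA PiC -mulmxBl opprB addrA subrK.
exact: rC.
Qed.

Lemma eta_Pi x : `|x - xb| < r1 -> eta x *m Pi = 0.
Proof. by move=> /eta_C /mulC0. Qed.

(** [sw i j (rho x)] lies in [M] and has the tangential projection of [sw i j x], because [Pi]
    commutes with the transposition; [rho] depends on that projection only. *)
Lemma rho_sw : exists2 r, 0 < r <= r1 & forall i j x, xb 0 i = xb 0 j -> `|x - xb| < r ->
  rho (sw i j x) = sw i j (rho x).
Proof.
have [r r0 HM] := M_sw; case: (retr) => _ [rM Mr rC rD jr].
have e0 : 0 < Num.min r r1 by rewrite lt_min r0 r10.
have [r2 /andP[r20 r21] Hr2] := rho_near e0.
exists r2; first by rewrite r20.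
move=> i j x E xr; have := Hr2 _ xr; rewrite lt_min => /andP[a1 a2].
have xr1 : `|x - xb| < r1 by exact: lt_le_trans r21.
have <- : rho (sw i j (rho x)) = sw i j (rho x).
  apply: Mr; first exact: le_lt_trans (sw_ball _ E) a2.
  by apply: HM => //; exact: rM.
apply: rD; rewrite -sw_sub; apply/mulC0; rewrite -Pi_sw//.
have -> : (x - rho x) *m Pi = 0.
  by apply/mulC0; rewrite -opprB mulNmx rC// oppr0.
by apply/rowP => k; rewrite !mxE.
Qed.

Lemma rho_block r i j x : (forall i j x, xb 0 i = xb 0 j -> `|x - xb| < r ->
    rho (sw i j x) = sw i j (rho x)) -> xb 0 i = xb 0 j -> `|x - xb| < r ->
  edif R i j *m Pi = 0 -> rho x 0 i = rho x 0 j.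
Proof.
move=> rs E xr a0; case: retr => _ [_ _ _ rD _].
have : rho x = sw i j (rho x).
  rewrite -rs//; apply: rD; apply/mulC0.
  by rewrite sub_sw -scalemxAl a0 scaler0.
by move=> /rowP/(_ i); rewrite mxE tpermL.
Qed.

(** If [edif R i j] is normal, the coordinates [i] and [j] agree both in [rho x] and in the
    projection of [x - xb]; if it is tangent, it is orthogonal to the normal vector [eta x]. *)
Lemma eta_block r i j x : r <= r1 -> (forall i j x, xb 0 i = xb 0 j -> `|x - xb| < r ->
    rho (sw i j x) = sw i j (rho x)) -> xb 0 i = xb 0 j -> `|x - xb| < r ->
  eta x 0 i = eta x 0 j.
Proof.
move=> rr rs E xr; apply/eqP; rewrite -subr_eq0 -edif_dot.
have [a0|a1] := edif_dich E; last first.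
  by rewrite -a1 trmx_mul PiT mulmxA eta_Pi ?mul0mx ?mxE// (lt_le_trans xr rr).
have E0 : (x - xb) *m Pi *m (edif R i j)^T = 0.
  by rewrite -mulmxA -PiT -trmx_mul a0 trmx0 mulmx0.
rewrite /eta mulmxBl E0 subr0.
rewrite edif_dot [X in X - _]mxE [X in _ - X]mxE (rho_block rs E xr a0).
by rewrite ![(- xb) 0 _]mxE E subrr.
Qed.

Lemma eta_sw r i j x : r <= r1 -> (forall i j x, xb 0 i = xb 0 j -> `|x - xb| < r ->
    rho (sw i j x) = sw i j (rho x)) -> xb 0 i = xb 0 j -> `|x - xb| < r ->
  eta (sw i j x) = eta x.
Proof.
move=> rr rs E xr; rewrite -[RHS](sw_fix (eta_block rr rs E xr)) /eta !sw_sub rs//.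
by rewrite Pi_sw// sw_sub (sw_fix E).
Qed.

End LocalSymmetry.

(** * Coordinates that agree along the manifold *)

Section GermEquality.
Variables (R : realType) (n d : nat) (M : set 'rV[R]_n).
Hypotheses (lsM : locally_symmetric M) (subM : C2_submanifold M d) (coM : connected M).

Definition germ_eq (x : 'rV[R]_n) (i j : 'I_n) :=
  exists2 e, 0 < e & forall y, M y -> `|y - x| < e -> y 0 i = y 0 j.

Lemma germ_eq_at x i j : M x -> germ_eq x i j -> x 0 i = x 0 j.
Proof. by move=> Mx [e e0 H]; apply: H => //; rewrite subrr normr0. Qed.

Lemma germ_eq_open x i j : germ_eq x i j ->
  exists2 e, 0 < e & forall y, `|y - x| < e -> germ_eq y i j.
Proof.
move=> [e e0 H]; exists e => // y ye; exists (e - `|y - x|); first by rewrite subr_gt0.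
move=> z Mz zy; apply: H => //; rewrite -(subrK y z) -addrA.
by apply: le_lt_trans (ler_normD _ _) _; rewrite -ltrBrDr.
Qed.

Lemma edif_gap (i j : 'I_n) : i != j -> edif R i j 0 i - edif R i j 0 j = 2.
Proof. by move=> ij; rewrite !mxE !eqxx (negbTE ij) eq_sym (negbTE ij) /= subr0 sub0r opprK. Qed.

Section At.
Variables (xb : 'rV[R]_n).
Hypotheses (Mxb : M xb).
Variables (J : 'M[R]_(d, n)) (C : 'M[R]_(n, d)) (rho : 'rV[R]_n -> 'rV[R]_n) (r1 : R).
Hypothesis retr : retraction M xb J C rho r1.
Variable Pi : 'M[R]_n.
Hypothesis PiE : Pi = C *m J.

Lemma rho_diff r i j x : r <= r1 -> (forall i j x, xb 0 i = xb 0 j -> `|x - xb| < r ->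
    rho (sw i j x) = sw i j (rho x)) -> xb 0 i = xb 0 j -> `|x - xb| < r ->
  edif R i j *m Pi = edif R i j -> rho x 0 i - rho x 0 j = x 0 i - x 0 j.
Proof.
move=> rr rs E xr a1; have eb := eta_block Mxb lsM retr PiE rr rs E xr.
have -> : rho x = eta xb rho Pi x + xb + (x - xb) *m Pi by rewrite /eta addrAC !subrK.
have H : ((x - xb) *m Pi) 0 i - ((x - xb) *m Pi) 0 j = x 0 i - x 0 j.
  rewrite -edif_dot -mulmxA -(PiT retr PiE) -trmx_mul a1 edif_dot !mxE E.
  by rewrite opprD addrACA subrr addr0.
rewrite -[RHS]H ![(_ + (x - xb) *m Pi) 0 _]mxE ![(_ + xb) 0 _]mxE eb E.
by rewrite opprD addrACA subrr add0r.
Qed.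

(* Moving along [edif i j] and retracting separates the coordinates [i] and [j]. *)
Lemma edif_germ_neq i j : xb 0 i = xb 0 j -> i != j -> edif R i j *m Pi = edif R i j ->
  exists2 e, 0 < e & forall y, M y -> `|y - xb| < e -> ~ germ_eq y i j.
Proof.
move=> E ij a1; have [r /andP[r0 rr] rs] := rho_sw Mxb lsM retr PiE.
exists r => // y My yr gy; have yij := germ_eq_at My gy; case: gy => e e0 ge.
have cr := rho_cont retr (lt_le_trans yr rr).
have ry : rho y = y by case: retr => _ [_ H _ _ _]; apply: H => //; exact: lt_le_trans rr.
have cl : {for (0:R), continuous (fun t : R => y + t *: edif R i j)}.
  by apply: cvgD; [exact: cvg_cst|apply: cvgZr_tmp; exact: cvg_id].
have l0 : y + (0:R) *: edif R i j = y by rewrite scale0r addr0.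
have n1 : \forall t \near (0:R), `|y + t *: edif R i j - xb| < r.
  have oB : open [set x | `|x - xb| < r] by exact: open_nball.
  have := cl; rewrite /prop_for /continuous_at l0 => cl'.
  by apply: (cl' [set x | `|x - xb| < r]); exact: open_nbhs_nbhs.
have n2 : \forall t \near (0:R), `|rho (y + t *: edif R i j) - y| < e.
  have cl' := cl; rewrite /prop_for /continuous_at l0 in cl'.
  have cr' := cr; rewrite /prop_for /continuous_at ry in cr'.
  exact: (cl' _ (cr' _ (nball_near y e0))).
have [dl /= dl0 Hd] := near_and n1 n2.
have [] := Hd (dl / 2).
  by rewrite /ball_ /= sub0r normrN gtr0_norm ?divr_gt0// ltr_pdivrMr// ltr_pMr// ltr1n.
set z := y + _ => zr zy.
have Mz : M (rho z).
  by case: retr => _ [H _ _ _ _]; apply: H => //; exact: lt_le_trans rr.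
have := rho_diff rr rs E zr a1; rewrite (ge _ Mz zy) subrr /z => /esym.
have -> : (y + dl / 2 *: edif R i j) 0 i - (y + dl / 2 *: edif R i j) 0 j =
   dl / 2 * (edif R i j 0 i - edif R i j 0 j).
  move: (edif R i j) => a; rewrite !mxE yij mulrBr.
  by rewrite opprD addrACA subrr add0r.
by rewrite (edif_gap ij) -mulrA mulVf ?pnatr_eq0// mulr1 => d0; rewrite d0 ltxx in dl0.
Qed.

Lemma edif_germ_eq i j : xb 0 i = xb 0 j -> edif R i j *m Pi = 0 -> germ_eq xb i j.
Proof.
move=> E a0; have [r /andP[r0 rr] rs] := rho_sw Mxb lsM retr PiE.
exists r => // y My yr.
have ry : rho y = y by case: retr => _ [_ H _ _ _]; apply: H => //; exact: lt_le_trans rr.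
by rewrite -ry; exact: (rho_block retr PiE rs E yr a0).
Qed.

(** Either the two coordinates differ at [xb], which persists by continuity, or [edif R i j] is
    tangent, and then no nearby germ of [M] identifies them. *)
Lemma germ_neq_open i j : ~ germ_eq xb i j ->
  exists2 e, 0 < e & forall y, M y -> `|y - xb| < e -> ~ germ_eq y i j.
Proof.
move=> ng; have [E|E] := eqVneq (xb 0 i) (xb 0 j); last first.
  exists (`|xb 0 i - xb 0 j| / 2); first by rewrite divr_gt0// normr_gt0 subr_eq0.
  move=> y My ye /(germ_eq_at My) yij.
  have hi : `|y 0 i - xb 0 i| <= `|y - xb| by have := le_mx_norm (y - xb) 0 i; rewrite !mxE.
  have hj : `|y 0 j - xb 0 j| <= `|y - xb| by have := le_mx_norm (y - xb) 0 j; rewrite !mxE.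
  have : `|xb 0 i - xb 0 j| <= `|y - xb| + `|y - xb|.
    have -> : xb 0 i - xb 0 j = (y 0 j - xb 0 j) - (y 0 i - xb 0 i).
      by rewrite yij; ring.
    by apply: le_trans (ler_normB _ _) _; apply: lerD.
  by lra.
have ij : i != j.
  by apply/eqP => ij; apply: ng; exists 1 => // y _ _; rewrite ij.
apply: edif_germ_neq => //.
have [a0|//] := edif_dich Mxb lsM retr PiE E.
by case: ng; exact: edif_germ_eq.
Qed.

End At.

Lemma germ_eq_const x y i j : M x -> M y -> germ_eq x i j -> germ_eq y i j.
Proof.
move=> Mx My gx.
(* A union of balls: it presents a stable subset of [M] as the trace of an open set, and its
   complement presents the opposite one as the trace of a closed set, the form in which [connected]
   takes them. *)
pose oc (P : 'rV[R]_n -> Prop) := [set z | exists v e, [/\ 0 < e, M v,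
   forall y, M y -> `|y - v| < e -> P y & `|z - v| < e]].
have oO P : open (oc P).
  have -> : oc P = \bigcup_(ve in [set ve : 'rV[R]_n * R | [/\ 0 < ve.2, M ve.1 &
       forall y, M y -> `|y - ve.1| < ve.2 -> P y]]) [set z | `|z - ve.1| < ve.2].
    apply/seteqP; split=> z /=; first by move=> [v [e [h1 h2 h3 h4]]]; exists (v, e).
    by move=> [[v e] [h1 h2 h3] h4]; exists v, e.
  by apply: bigcup_open => -[v e] _; exact: open_nball.
pose B := [set z | M z /\ germ_eq z i j].
have BM : B = M.
  apply: coM.
  - by exists x.
  - exists (oc (fun z => germ_eq z i j)); first exact: oO.
    apply/seteqP; split=> z.
      move=> [Mz gz]; split=> //; have [e e0 H] := germ_eq_open gz.
      by exists z, e; split=> // [v _|]; [exact: H|rewrite subrr normr0].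
    by move=> [Mz [v [e [e0 Mv H zv]]]]; split=> //; exact: H.
  - exists (~` oc (fun z => ~ germ_eq z i j)); first exact: open_closedC.
    apply/seteqP; split=> z.
      by move=> [Mz gz]; split=> // -[v [e [e0 Mv H zv]]]; exact: (H z).
    move=> [Mz nz]; split=> //; apply: contrapT => ng; apply: nz.
    have [J [C [rho [r1 retr]]]] := exists_retraction Mz subM.
    have [e e0 H] := germ_neq_open Mz retr erefl ng.
    by exists z, e; split=> //; rewrite subrr normr0.
by have : B y by [rewrite BM]; case.
Qed.

Lemma val_partition_eq (s : {perm 'I_n}) (x : 'rV[R]_n) i j :
  val_partition x = porbits s -> (x 0 j == x 0 i) = (j \in porbit s i).
Proof.
move=> E; have : porbit s i \in porbits s by apply/imsetP; exists i.
rewrite -E => /imsetP[k _ Ek].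
have : i \in porbit s i by exact: porbit_id.
by rewrite Ek !inE => /eqP ->.
Qed.

Lemma germ_eqP (s : {perm 'I_n}) x i j : characteristic_perm M s -> M x ->
  germ_eq x i j <-> j \in porbit s i.
Proof.
move=> [xbar [Mxbar [dl dl0 Hd]]] Mx; have [r r0 Hr] := nball_eball xbar dl0.
have vp y : M y -> `|y - xbar| < r -> (y 0 j == y 0 i) = (j \in porbit s i).
  by move=> My yr; apply: val_partition_eq; apply: Hd; split=> //; exact: Hr.
split=> [gx|ji].
  have gb := germ_eq_const Mx Mxbar gx.
  by rewrite -(vp xbar)// ?subrr ?normr0// (germ_eq_at Mxbar gb).
apply: (germ_eq_const Mxbar Mx); exists r => // y My yr.
by apply/esym/eqP; rewrite vp.
Qed.

Section Normal.
Variables (xb : 'rV[R]_n) (s : {perm 'I_n}).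
Hypotheses (Mxb : M xb) (chs : characteristic_perm M s).
Variables (J : 'M[R]_(d, n)) (C : 'M[R]_(n, d)) (rho : 'rV[R]_n -> 'rV[R]_n) (r1 : R).
Hypothesis retr : retraction M xb J C rho r1.
Variable Pi : 'M[R]_n.
Hypothesis PiE : Pi = C *m J.

Lemma porbit_eq i j : j \in porbit s i -> xb 0 i = xb 0 j.
Proof. by move/(germ_eqP i j chs Mxb); exact: germ_eq_at. Qed.

Lemma porbit_edif i j : j \in porbit s i -> edif R i j *m Pi = 0.
Proof.
move=> ji; have E := porbit_eq ji; have [ij|ij] := eqVneq i j.
  by rewrite /edif ij subrr mul0mx.
have [//|a1] := edif_dich Mxb lsM retr PiE E.
have [e e0 H] := edif_germ_neq Mxb retr PiE E ij a1.
have := H xb Mxb; rewrite subrr normr0 => /(_ e0); case.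
by apply/(germ_eqP i j chs Mxb).
Qed.

Lemma nporbit_edif i j : xb 0 i = xb 0 j -> j \notin porbit s i -> edif R i j *m Pi = edif R i j.
Proof.
move=> E ji; have [a0|//] := edif_dich Mxb lsM retr PiE E.
by have /(germ_eqP i j chs Mxb) := edif_germ_eq Mxb retr PiE E a0; rewrite (negbTE ji).
Qed.

End Normal.
End GermEquality.

(** * Charts from local diffeomorphisms *)

Section Flatten.
Variable R : realType.

Lemma cont_mxvec a b (X : 'M[R]_(a, b)) : {for X, continuous (@mxvec R a b)}.
Proof.
apply/cont_mxP => i k; rewrite ord1; case/mxvec_indexP: k => i' j'.
have -> : (fun X : 'M[R]_(a, b) => mxvec X 0 (mxvec_index i' j')) = (fun X => X i' j').
  by apply/funext => Y; rewrite mxvecE.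
exact: cont_coord.
Qed.

Section Affine.
Variables (p D : nat) (z0 : 'rV[R]_p) (L : 'M[R]_(D, p)).

Lemma C2_aff l : C2_on setT (fun u => (z0 + u *m L) 0 l).
Proof.
apply: (C2_eq openT (g := fun u => z0 0 l + affmap 0 L u 0 l)).
  by move=> u _; rewrite /affmap subr0 [RHS]mxE.
exact: (C2_add openT (C2_cst _ openT) (C2_affmap _ _ _ openT)).
Qed.

Lemma cont_aff u : {for u, continuous (fun u : 'rV[R]_D => z0 + u *m L)}.
Proof.
by apply: (@C1_continuous_row R _ _ setT _ u openT) => // l; exact: (C2_C1 openT (C2_aff l)).
Qed.

Lemma jac_aff u : jac (fun u => z0 + u *m L) u = L.
Proof.
rewrite -[RHS](jac_affmap 0 L u); apply/matrixP => k l; rewrite !mxE /partial.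
have H : is_derive u (ebasis R k) (fun u => affmap 0 L u 0 l) (partial k (fun u => affmap 0 L u 0 l) u).
  exact: (C1_is_derive k (C2_C1 openT (C2_affmap _ _ _ openT))).
have -> : (fun v : 'rV[R]_D => (z0 + v *m L) 0 l) = (fun v => z0 0 l + affmap 0 L v 0 l).
  by apply/funext => v; rewrite /affmap subr0 [LHS]mxE.
have H2 := is_deriveD (is_derive_cst (z0 0 l) u (ebasis R k)) H.
by have := @derive_val _ _ _ _ _ _ _ H2; rewrite add0r.
Qed.

End Affine.

(** [C2_submanifold] at a single point, since the construction depends on the point. *)
Definition C2_chart_at a b (S : set 'M[R]_(a, b)) D X : Prop :=
  exists (U : set 'M[R]_(a, b)) (W : set 'rV[R]_D) (phi : 'rV[R]_D -> 'M[R]_(a, b)),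
  [/\ open U, U X, open W,
      (forall i j, C2_on W (fun w => phi w i j))
    & (forall w1 w2, W w1 -> W w2 -> phi w1 = phi w2 -> w1 = w2)] /\
  [/\ phi @` W = S `&` U,
      (forall w, W w -> \rank (Defs.jacobian phi w) = D)
    & (forall V : set 'rV[R]_D, open V ->
         exists O : set 'M[R]_(a, b), open O /\ phi @` (W `&` V) = O `&` phi @` W)].

(** [f] straightens [S]: near [z0] it carries the affine space through [z0] spanned by the rows of
    [L] onto [S]. [K] reads coordinates in that space, whence the membership test by [K] followed by
    [L]. *)
Lemma flatten_chart a b D (S : set 'M[R]_(a, b)) (W : set 'rV[R]_(a * b))
    (f : 'rV[R]_(a * b) -> 'rV[R]_(a * b)) z0 (L : 'M[R]_(D, a * b)) (K : 'M[R]_(a * b, D)) r :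
  open W -> (forall l, C2_on W (fun z => f z 0 l)) -> W z0 -> jac f z0 \in unitmx ->
  L *m K = 1%:M -> 0 < r ->
  (forall z, `|z - z0| < r -> (S (vec_mx (f z)) <-> (z - z0) *m K *m L = z - z0)) ->
  C2_chart_at S D (vec_mx (f z0)).
Proof.
move=> oW cf Wz0 uf LK r0 HS.
pose W1 := W `&` [set z | `|z - z0| < r].
have oW1 : open W1 by apply: openI => //; exact: open_nball.
have W1W : W1 `<=` W by move=> z [].
have cf1 l : C2_on W1 (fun z => f z 0 l) := C2_sub W1W (cf l).
have W1z0 : W1 z0 by split=> //=; rewrite subrr normr0.
have [V [g [[oV Vz0 VW Vu] [gf fopen _]]]] := inverse_function oW1 cf1 W1z0 uf.
pose aff (u : 'rV[R]_D) := z0 + u *m L.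
pose phi u := vec_mx (f (aff u)).
have caff u : {for u, continuous aff} by exact: cont_aff.
have oW2 : open [set u | V (aff u)] by apply: open_comp => // u _; exact: caff.
have affK u : (aff u - z0) *m K = u by rewrite /aff addrAC subrr add0r -mulmxA LK mulmx1.
have Saff u : V (aff u) -> S (phi u).
  by move=> Vu2; apply/HS; [case: (VW _ Vu2)|rewrite affK /aff addrAC subrr add0r].
have affS z : V z -> S (vec_mx (f z)) -> z = aff ((z - z0) *m K).
  by move=> Vz Sz; rewrite /aff ((HS z _).1 Sz) ?subrKC//; case: (VW _ Vz).
have omx (F : set 'rV[R]_(a * b)) : open F -> open [set X : 'M[R]_(a, b) | F (mxvec X)].
  by move=> oF; apply: open_comp => // X _; exact: cont_mxvec.
exists [set X | (f @` V) (mxvec X)], [set u | V (aff u)], phi; split; split.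
- exact/omx/fopen.
- by rewrite /= vec_mxK; exists z0.
- exact: oW2.
- move=> i j.
  apply: (C2_eq oW2 (g := (fun z => f z 0 (mxvec_index i j)) \o aff)).
    by move=> u _; rewrite /= /phi [RHS]mxE.
  apply: (C2_comp oW2 oV (f := aff)) => //.
    by move=> l; apply: (C2_sub _ (C2_aff z0 L l)).
  exact: (C2_sub VW (cf1 _)).
- move=> u v Vau Vav /(congr1 mxvec); rewrite !vec_mxK => /(congr1 g).
  by rewrite !gf// => E; rewrite -(affK u) E affK.
- apply/seteqP; split=> [X [u Vau <-]|X [SX [z Vz fz]]].
    by split; [exact: Saff|rewrite /= vec_mxK; exists (aff u)].
  have Sz : S (vec_mx (f z)) by rewrite fz mxvecK.
  by exists ((z - z0) *m K); rewrite /= /phi -(affS _ Vz Sz)// fz mxvecK.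
- move=> w Vw; apply/jacobian_rank => u Hu.
  have jE : jac (fun w => f (aff w)) w = L *m jac f (aff w).
    rewrite (jac_comp (W := setT) (U := V) (f := aff) (g := f) openT oV)//.
    - by rewrite jac_aff.
    - by move=> l; exact: (C2_C1 openT (C2_aff z0 L l)).
    - by move=> l; exact: (C2_C1 oV (C2_sub VW (cf1 l))).
  have : u *m (L *m jac f (aff w)) = 0.
    apply/rowP => l; rewrite -jE; case/mxvec_indexP: l => i j.
    transitivity (\sum_k u 0 k * partial k (fun v => phi v i j) w); last by rewrite Hu mxE.
    rewrite mxE; apply: eq_bigr => k _; rewrite [jac _ _ _ _]mxE.
    by congr (_ * partial k _ w); apply/funext => v; rewrite /phi [RHS]mxE.
  move=> /(congr1 (fun A => A *m invmx (jac f (aff w)) *m K)).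
  by rewrite (mulmxA u) mulmxK ?Vu// -(mulmxA u) LK mulmx1 !mul0mx.
- move=> V2 oV2; pose V3 := V `&` [set z | V2 ((z - z0) *m K)].
  have oV3 : open V3.
    apply: openI => //; apply: (@open_comp _ _ (affmap z0 K)) => // z _; exact: cont_affmap.
  exists [set X | (f @` V3) (mxvec X)]; split; first by apply/omx/fopen => // z [].
  apply/seteqP; split=> [X [u [Vau V2u] <-]|X [[z [Vz V2z] fz] [u Vau E]]].
    split; last by exists u.
    by rewrite /= vec_mxK; exists (aff u) => //; split=> //=; rewrite affK.
  exists u => //; split=> //.
  have : f z = f (aff u) by rewrite fz -E vec_mxK.
  by move=> /(congr1 g); rewrite !gf// => zE; move: V2z; rewrite /= zE affK.
Qed.

End Flatten.

Section MatrixDerivatives.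
Variables (R : realType) (V : normedModType R).

Definition mder m n (A : V -> 'M[R]_(m, n)) (w v : V) (dA : 'M[R]_(m, n)) :=
  forall i j, is_derive w v (fun w => A w i j) (dA i j).

Lemma mder_mul m n p (A : V -> 'M[R]_(m, n)) (B : V -> 'M[R]_(n, p)) w v dA dB :
  mder A w v dA -> mder B w v dB ->
  mder (fun w => A w *m B w) w v (A w *m dB + dA *m B w).
Proof.
move=> hA hB i j.
have -> : (fun w => (A w *m B w) i j) = (fun w => \sum_k A w i k * B w k j).
  by apply/funext => z; rewrite mxE.
have -> : (A w *m dB + dA *m B w) i j = \sum_k (A w i k * dB k j + B w k j * dA i k).
  rewrite !mxE -big_split /=; apply: eq_bigr => k _; congr (_ + _); exact: mulrC.
have -> : (fun w => \sum_k A w i k * B w k j) = \sum_k (fun w => A w i k * B w k j).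
  by apply/funext => z; rewrite fct_sumE.
apply: is_derive_sum => k; exact: (is_deriveM (hA i k) (hB k j)).
Qed.

Lemma mder_add m n (A B : V -> 'M[R]_(m, n)) w v dA dB :
  mder A w v dA -> mder B w v dB -> mder (fun w => A w + B w) w v (dA + dB).
Proof.
move=> hA hB i j.
have -> : (fun w => (A w + B w) i j) = (fun w => A w i j + B w i j).
  by apply/funext => z; rewrite mxE.
rewrite [X in is_derive _ _ _ X]mxE; exact: (is_deriveD (hA i j) (hB i j)).
Qed.

Lemma mder_trmx m n (A : V -> 'M[R]_(m, n)) w v dA :
  mder A w v dA -> mder (fun w => (A w)^T) w v dA^T.
Proof.
move=> hA i j; have -> : (fun w => (A w)^T i j) = (fun w => A w j i).
  by apply/funext => z; rewrite mxE.
by rewrite mxE; exact: hA.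
Qed.

Lemma mder_cst m n (A : 'M[R]_(m, n)) w v : mder (fun=> A) w v 0.
Proof. by move=> i j; rewrite mxE; exact: is_derive_cst. Qed.

Lemma mder_unique m n (A : V -> 'M[R]_(m, n)) w v dA dB :
  mder A w v dA -> mder A w v dB -> dA = dB.
Proof. by move=> hA hB; apply/matrixP => i j; exact: (is_derive_unique (hA i j) (hB i j)). Qed.

End MatrixDerivatives.

(** * The chart around a symmetric matrix *)

Section BlockEigen.
Variables (R : realType) (n : nat) (xb : 'rV[R]_n).
Implicit Types (Y Q : 'M[R]_n) (x eta : 'rV[R]_n).

Lemma spectral_gap : exists2 g : R, 0 < g & forall i j, `|xb 0 i - xb 0 j| < g -> xb 0 i = xb 0 j.
Proof.
exists (\big[Num.min/1]_(p : 'I_n * 'I_n | xb 0 p.1 != xb 0 p.2) `|xb 0 p.1 - xb 0 p.2|).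
  by apply: lt_bigmin => // p pP; rewrite normr_gt0 subr_eq0.
move=> i j; case: (eqVneq (xb 0 i) (xb 0 j)) => // ij; rewrite ltNge.
by rewrite (@bigmin_le_cond _ _ _ 1 (i, j) _ (fun p : 'I_n * 'I_n => `|xb 0 p.1 - xb 0 p.2|)).
Qed.

(* The part [u] of an eigenvector outside its block is again an eigenvector; comparing it with
   [diag_mx xb], whose other entries stay away from the eigenvalue, forces [u = 0]. *)
Lemma eig_block Y Q x g : 0 < g -> (forall i j, `|xb 0 i - xb 0 j| < g -> xb 0 i = xb 0 j) ->
  (forall i j, xb 0 i != xb 0 j -> Y i j = 0) -> eigsys Y Q x ->
  `|x - xb| < g / 2 -> n%:R * `|Y - diag_mx xb| < g / 2 ->
  forall i k, xb 0 i != xb 0 k -> Q i k = 0.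
Proof.
move=> g0 gap Y0 [oQ YE _] xg Yg i k ik.
have QY j : \sum_i Q i k * Y i j = x 0 k * Q j k.
  have : (Q^T *m Y) k j = (diag_mx x *m Q^T) k j by rewrite YE !mulmxA oQ mul1mx.
  rewrite mul_diag_mx [RHS]mxE [Q^T k j]mxE [LHS]mxE => <-; apply: eq_bigr => l _.
  by rewrite [Q^T k l]mxE.
pose u : 'rV[R]_n := \row_i (if xb 0 i == xb 0 k then 0 else Q i k).
have uE j : (u *m (Y - diag_mx xb)) 0 j = (x 0 k - xb 0 j) * u 0 j.
  rewrite mulmxBr mul_mx_diag mulrBl [LHS]mxE.
  have -> : (- \matrix_(i0, j0) (u i0 j0 * xb 0 j0)) 0 j = - (xb 0 j * u 0 j).
    by move: (u) => u'; rewrite !mxE mulrC.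
  congr (_ + _); rewrite mxE.
  have uj l : u 0 l = if xb 0 l == xb 0 k then 0 else Q l k by rewrite mxE.
  have [jk|jk] := eqVneq (xb 0 j) (xb 0 k).
    rewrite uj jk eqxx mulr0 big1// => l _; rewrite uj; case: eqVneq => [_|lk]; first by rewrite mul0r.
    by rewrite Y0 ?mulr0// jk.
  rewrite uj (negbTE jk) -QY; apply: eq_bigr => l _; rewrite uj; case: eqVneq => [lk|//].
  by rewrite Y0 ?mulr0 // lk eq_sym.
have c0 : 0 <= 2 / g * (n%:R * `|Y - diag_mx xb|).
  by rewrite !mulr_ge0// invr_ge0 ltW.
have c1 : 2 / g * (n%:R * `|Y - diag_mx xb|) < 1.
  rewrite mulrAC ltr_pdivrMr// mul1r mulrC -ltr_pdivlMr//.
have ule : `|u| <= 2 / g * (n%:R * `|Y - diag_mx xb|) * `|u|.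
  apply: mx_norm_le => [|a j]; first exact: mulr_ge0.
  rewrite ord1; have [->|uj] := eqVneq (u 0 j) 0; first by rewrite normr0 mulr_ge0.
  have jk : xb 0 j != xb 0 k by apply: contraNN uj => /eqP jk; rewrite mxE jk eqxx.
  have h1 : g <= `|xb 0 k - xb 0 j|.
    by rewrite leNgt; apply: contraNN jk => /gap ->.
  have h2 : `|x 0 k - xb 0 k| < g / 2.
    by apply: le_lt_trans xg; have := le_mx_norm (x - xb) 0 k; rewrite !mxE.
  have h3 : g / 2 <= `|x 0 k - xb 0 j|.
    have : `|xb 0 k - xb 0 j| <= `|x 0 k - xb 0 j| + `|x 0 k - xb 0 k|.
      have -> : xb 0 k - xb 0 j = (x 0 k - xb 0 j) - (x 0 k - xb 0 k) by ring.
      exact: ler_normB.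
    by move: h1 h2; lra.
  have h4 : `|(x 0 k - xb 0 j) * u 0 j| <= n%:R * `|Y - diag_mx xb| * `|u|.
    by rewrite -uE; apply: le_trans (le_mx_norm _ _ _) (norm_mulmx_le _ _).
  rewrite normrM in h4.
  have h5 : g / 2 * `|u 0 j| <= n%:R * `|Y - diag_mx xb| * `|u|.
    by apply: le_trans h4; apply: ler_wpM2r.
  have -> : 2 / g * (n%:R * `|Y - diag_mx xb|) * `|u| = (n%:R * `|Y - diag_mx xb| * `|u|) * 2 / g.
    by ring.
  by rewrite ler_pdivlMr// mulrC -ler_pdivrMr// mulrAC.
have u0 : `|u| = 0.
  apply/eqP; rewrite eq_le normr_ge0 andbT leNgt; apply/negP => u0.
  by move: ule; rewrite leNgt gtr_pMl// c1.
have /rowP/(_ i) : u = 0 by apply/eqP; rewrite -normr_eq0 u0.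
by rewrite !mxE (negbTE ik).
Qed.

Lemma block_conj_diag Q eta : Q *m Q^T = 1%:M -> (forall i k, xb 0 i != xb 0 k -> Q i k = 0) ->
  (forall i j, xb 0 i = xb 0 j -> eta 0 i = eta 0 j) -> Q *m diag_mx eta *m Q^T = diag_mx eta.
Proof.
move=> oQ Q0 eb; have -> : Q *m diag_mx eta = diag_mx eta *m Q.
  rewrite mul_mx_diag mul_diag_mx; apply/matrixP => i k; rewrite !mxE mulrC.
  have [ik|ik] := eqVneq (xb 0 i) (xb 0 k); first by rewrite (eb _ _ ik).
  by rewrite Q0// !mulr0.
by rewrite -mulmxA oQ mulmx1.
Qed.

(** A block constant diagonal commutes with [Q], so the eigenvectors are kept. The order survives
    because a block is shifted as a whole and the gap separates different blocks. *)
Lemma eigsys_shift Y Q x eta g : nonincr xb -> eigsys Y Q x ->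
  (forall i j, `|xb 0 i - xb 0 j| < g -> xb 0 i = xb 0 j) ->
  (forall i k, xb 0 i != xb 0 k -> Q i k = 0) ->
  (forall i j, xb 0 i = xb 0 j -> eta 0 i = eta 0 j) ->
  `|x + eta - xb| < g / 2 -> eigsys (Y + diag_mx eta) Q (x + eta).
Proof.
move=> sxb [oQ YE sx] gap Q0 eb xg; split=> //.
  by rewrite linearD /= mulmxDr mulmxDl -YE (block_conj_diag (orthC oQ) Q0 eb).
move=> i j ij; rewrite ![(x + eta) 0 _]mxE.
have [E|E] := eqVneq (xb 0 i) (xb 0 j); first by rewrite (eb _ _ E) lerD2r; exact: sx.
have H k : `|x 0 k + eta 0 k - xb 0 k| < g / 2.
  by apply: le_lt_trans xg; have := le_mx_norm (x + eta - xb) 0 k; rewrite !mxE.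
have h1 : g <= xb 0 i - xb 0 j.
  rewrite -[leRHS]ger0_norm ?subr_ge0 ?sxb// leNgt; apply: contraNN E => /gap ->.
  by [].
have := H i; have := H j; rewrite !ltr_norml => /andP[_ h2] /andP[h3 _].
by move: h1 h2 h3; lra.
Qed.

End BlockEigen.

(** * Tangency of the eigenvalues as a linear condition *)

Section TangentBlock.
Variables (R : realType) (n d : nat) (M : set 'rV[R]_n).
Hypotheses (lsM : locally_symmetric M) (subM : C2_submanifold M d) (coM : connected M).
Variables (xb : 'rV[R]_n) (s : {perm 'I_n}).
Hypotheses (Mxb : M xb) (chs : characteristic_perm M s).
Variables (J : 'M[R]_(d, n)) (C : 'M[R]_(n, d)) (rho : 'rV[R]_n -> 'rV[R]_n) (r1 : R).
Hypothesis retr : retraction M xb J C rho r1.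
Variable Pi : 'M[R]_n.
Hypothesis PiE : Pi = C *m J.

(* The block of [i] in [xb] is a single orbit of [s]; otherwise all orbits in it are singletons. *)
Definition pure (i : 'I_n) := [forall k, (xb 0 k == xb 0 i) ==> (k \in porbit s i)].

Lemma pureP i k : pure i -> xb 0 k = xb 0 i -> k \in porbit s i.
Proof. by move=> /forallP/(_ k)/implyP H E; apply: H; rewrite E. Qed.

Lemma pure_block i k : xb 0 i = xb 0 k -> pure i = pure k.
Proof.
wlog suff H : i k / xb 0 i = xb 0 k -> pure i -> pure k.
  by move=> E; apply/idP/idP; apply: H.
move=> E pi; apply/forallP => l; apply/implyP => /eqP lk.
have := pureP pi (etrans lk (esym E)); have := pureP pi (esym E).
by rewrite -!eq_porbit_mem => /eqP <-.
Qed.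

Lemma pure_tangent i k (v : 'rV[R]_n) : pure i -> xb 0 k = xb 0 i -> v *m Pi = v -> v 0 i = v 0 k.
Proof.
move=> pi E vP; apply/eqP; rewrite -subr_eq0 -edif_dot -vP -mulmxA -(PiT retr PiE) -trmx_mul.
by rewrite (porbit_edif lsM subM coM Mxb chs retr PiE (pureP pi E)) trmx0 mulmx0 mxE.
Qed.

(** Two indices of one orbit are joined through an index [l] of the block in another orbit, which
    exists since the block is not pure; [nporbit_edif] applies to both legs. *)
Lemma npure_edif i k : ~~ pure i -> xb 0 k = xb 0 i -> edif R i k *m Pi = edif R i k.
Proof.
move=> npi E; have ne := nporbit_edif lsM subM coM Mxb chs retr PiE.
have [ki|] := boolP (k \in porbit s i); last exact: ne.
move: npi; rewrite negb_forall => /existsP[l]; rewrite negb_imply => /andP[/eqP li nl].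
have -> : edif R i k = edif R i l + edif R l k by rewrite /edif addrA subrK.
rewrite mulmxDl !ne// ?li//.
apply: contra nl; move: ki; rewrite -!eq_porbit_mem => /eqP <-.
by rewrite eq_sym.
Qed.

(** Otherwise [edif R i k] would be nonzero and both tangent and normal. *)
Lemma npure_porbit i k : ~~ pure i -> k \in porbit s i -> i = k.
Proof.
move=> npi ki; have E := porbit_eq lsM subM coM Mxb chs ki.
have := npure_edif npi (esym E); rewrite (porbit_edif lsM subM coM Mxb chs retr PiE ki) => e0.
have [//|/(edif_gap R)] := eqVneq i k; rewrite -e0 !mxE subr0 => /eqP.
by rewrite eq_sym pnatr_eq0.
Qed.

Lemma tangentP (v : 'rV[R]_n) : v *m Pi = v <-> forall l, \sum_i v 0 i * (1%:M - Pi) i l = 0.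
Proof.
have E : v *m (1%:M - Pi) = v - v *m Pi by rewrite mulmxBr mulmx1.
split=> [vP l|H].
  have : (v *m (1%:M - Pi)) 0 l = 0 by rewrite E vP subrr mxE.
  by rewrite mxE.
apply/esym/eqP; rewrite -subr_eq0 -E; apply/eqP/rowP => l.
by move: (1%:M - Pi) H => N H; rewrite !mxE.
Qed.

Lemma npure_normal i k l : ~~ pure i -> xb 0 k = xb 0 i -> (1%:M - Pi) i l = (1%:M - Pi) k l.
Proof.
move=> npi E; have := npure_edif npi E => H.
have : edif R i k *m (1%:M - Pi) = 0 by rewrite mulmxBr mulmx1 H subrr.
move: (1%:M - Pi) => N; rewrite /edif mulmxBl /ebasis -!rowE => /rowP/(_ l); rewrite !mxE.
by move/eqP; rewrite subr_eq0 => /eqP.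
Qed.

(** Where [nu] is constant on a block, only the sum of the diagonal entries of the block counts, and
    this trace is the sum of its eigenvalues. *)
Lemma block_trace (Q : 'M[R]_n) (x y nu : 'rV[R]_n) : Q^T *m Q = 1%:M ->
  (forall i k, xb 0 i != xb 0 k -> Q i k = 0) ->
  (forall i, pure i -> y 0 i = x 0 i) ->
  (forall i k, ~~ pure i -> xb 0 k = xb 0 i -> nu 0 k = nu 0 i) ->
  (forall i, y 0 i = \sum_k Q i k * x 0 k * Q i k) ->
  \sum_i y 0 i * nu 0 i = \sum_i x 0 i * nu 0 i.
Proof.
move=> oQ Q0 yx nub yE.
rewrite (bigID pure) [RHS](bigID pure) /=; congr (_ + _).
  by apply: eq_bigr => i pi; rewrite yx.
rewrite big_mkcond [RHS]big_mkcond /=.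
pose G i k := if pure k then 0 else Q i k * Q i k * (x 0 k * nu 0 k).
transitivity (\sum_i \sum_k G i k).
  apply: eq_bigr => i _; case: ifPn => pi.
    rewrite yE mulr_suml; apply: eq_bigr => k _; rewrite /G.
    have [E|E] := eqVneq (xb 0 i) (xb 0 k).
      by rewrite -(pure_block E) (negbTE pi) (nub i k pi (esym E)); ring.
    by rewrite Q0// !mul0r; case: ifP.
  rewrite big1// => k _; rewrite /G; have [E|E] := eqVneq (xb 0 i) (xb 0 k).
    by rewrite -(pure_block E); move: pi; rewrite negbK => ->.
  by rewrite Q0// !mul0r; case: ifP.
rewrite exchange_big /=; apply: eq_bigr => k _; rewrite /G; have [pk|pk] := boolP (pure k); first by rewrite big1.
have /matrixP/(_ k k) := oQ; rewrite !mxE eqxx => Qk.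
rewrite -mulr_suml -[RHS]mul1r; congr (_ * _); rewrite -[RHS]Qk; apply: eq_bigr => i _.
by rewrite mxE.
Qed.

(** Each direction first settles the pure blocks, where the eigenvalues turn out to be the diagonal
    entries. This is the premise of the auxiliary fact [tr], which leaves the other blocks to
    [block_trace]. *)
Lemma tangent_eig (Y Q : 'M[R]_n) (x : 'rV[R]_n) : eigsys Y Q x ->
  (forall i k, xb 0 i != xb 0 k -> Q i k = 0) ->
  (x - xb) *m Pi = x - xb <->
  ((\row_i Y i i - xb) *m Pi = \row_i Y i i - xb /\
   forall i j, i != j -> j \in porbit s i -> Y i j = 0).
Proof.
move=> eY Q0; have [oQ YE _] := eY; have oQ' := orthC oQ.
set y : 'rV[R]_n := \row_i Y i i.
have Yij i j : Y i j = \sum_k Q i k * x 0 k * Q j k.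
  rewrite YE mul_mx_diag mxE; apply: eq_bigr => k _; rewrite !mxE.
  by [].
have yE i : y 0 i = \sum_k Q i k * x 0 k * Q i k by rewrite mxE Yij.
have tr : (forall i, pure i -> y 0 i = x 0 i) -> (x - xb) *m Pi = x - xb <-> (y - xb) *m Pi = y - xb.
  move=> yx.
  have H l : \sum_i (y - xb) 0 i * (1%:M - Pi) i l = \sum_i (x - xb) 0 i * (1%:M - Pi) i l.
    have sb (z : 'rV[R]_n) : \sum_i (z - xb) 0 i * (1%:M - Pi) i l =
        \sum_i z 0 i * (col l (1%:M - Pi))^T 0 i - \sum_i xb 0 i * (col l (1%:M - Pi))^T 0 i.
      rewrite -sumrB; apply: eq_bigr => i _; move: (1%:M - Pi) => N.
      by rewrite !mxE mulrBl.
    rewrite !sb; congr (_ - _); apply: (block_trace oQ Q0 yx) => // i k pi E.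
    have cE m : (col l (1%:M - Pi))^T 0 m = (1%:M - Pi) m l by rewrite [LHS]mxE [LHS]mxE.
    by rewrite !cE (npure_normal _ pi E).
  by split=> /tangentP T; apply/tangentP => l; rewrite ?H// -H.
split=> [xT|[yT Y0]].
  have px i j : pure i -> Y i j = x 0 i * (i == j)%:R.
    move=> pi; rewrite Yij.
    have /matrixP/(_ i j) := oQ'; rewrite !mxE => QQ; rewrite -QQ mulr_sumr.
    apply: eq_bigr => k _; rewrite [Q^T _ _]mxE.
    have [E|E] := eqVneq (xb 0 i) (xb 0 k); last by rewrite Q0// !mul0r mulr0.
    have := pure_tangent pi (esym E) xT; rewrite !mxE E => /addIr ->.
    by ring.
  split.
    apply/tr => // i pi; first by rewrite mxE px// eqxx mulr1.
  move=> i j ij ji; have [pi|npi] := boolP (pure i); first by rewrite px// (negbTE ij) mulr0.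
  by rewrite (npure_porbit npi ji) eqxx in ij.
apply/tr => // k pk.
have /matrixP/(_ k k) := eigsys_diag eY; rewrite formE [RHS]mxE eqxx mulr1n => <-.
have /matrixP/(_ k k) := oQ; rewrite !mxE eqxx => QQ.
rewrite -[LHS]mul1r -[1]QQ mulr_suml; apply: eq_bigr => i _.
rewrite [Q^T _ _]mxE.
have [E|E] := eqVneq (xb 0 i) (xb 0 k); last first.
  by rewrite Q0// !mul0r big1// => j _; rewrite !mul0r.
have pi : pure i by rewrite (pure_block E).
rewrite (bigD1 i)//= big1 ?addr0.
  have := pure_tangent pi (esym E) yT; rewrite !mxE E => /addIr ->.
  by ring.
move=> j ji; have [E2|E2] := eqVneq (xb 0 j) (xb 0 k); last by rewrite (Q0 j k)// mulr0.
by rewrite Y0 ?mulr0 ?mul0r// 1?eq_sym//; apply: pureP => //; rewrite E2.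
Qed.

End TangentBlock.

Section LinearMaps.
Variable R : realType.

Definition is_lin (U V : lmodType R) (f : U -> V) := forall h u v, f (h *: u + v) = h *: f u + f v.

Section Row.
Variables (p m n : nat) (f : 'rV[R]_p -> 'M[R]_(m, n)).
Hypothesis lf : is_lin f.

Lemma is_lin0 : f 0 = 0.
Proof. by have := lf (-1) 0 0; rewrite scaleN1r oppr0 addr0 scaleN1r addNr. Qed.

Lemma lin_expand v : f v = \sum_k v 0 k *: f (ebasis R k).
Proof.
rewrite {1}[v]row_sum_delta; elim/big_rec2: _ => [|k y1 y2 _ <-]; first exact: is_lin0.
by rewrite lf.
Qed.

Lemma C2_lin (W : set 'rV[R]_p) i j : open W -> C2_on W (fun w => f w i j).
Proof.
move=> oW; apply: (C2_eq oW (g := fun w => \sum_k w 0 k * f (ebasis R k) i j)).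
  by move=> w _; rewrite [in RHS]lin_expand summxE; apply: eq_bigr => k _; rewrite [RHS]mxE.
by apply: (C2_sum _ oW) => k _; exact: (C2_mul oW (C2_coord _ oW) (C2_cst _ oW)).
Qed.

Lemma cont_lin (w : 'rV[R]_p) : {for w, continuous f}.
Proof.
apply/cont_mxP => i j; exact: (C1_continuous openT (C2_C1 openT (C2_lin i j openT))).
Qed.

Lemma mder_lin w v : mder f w v (f v).
Proof.
move=> i j; apply/is_deriveP; apply: cvg_near_cst; near=> h.
have h0 : h != 0 by near: h; exact: nbhs_dnbhs_neq.
by rewrite lf !mxE addrK [LHS]mulrA mulVf// mul1r.
Unshelve. all: by end_near. Qed.

End Row.

Lemma lin_rowmx p q (f : 'rV[R]_p -> 'rV[R]_q) : is_lin f ->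
  forall u, u *m (\matrix_k f (ebasis R k)) = f u.
Proof.
move=> lf u; rewrite (lin_expand lf) mulmx_sum_row; apply: eq_bigr => k _.
by rewrite rowK.
Qed.

Lemma C1_mder p m n (W : set 'rV[R]_p) (A : 'rV[R]_p -> 'M[R]_(m, n)) w v :
  open W -> (forall i j, C1_on W (fun w => A w i j)) -> W w -> exists dA, mder A w v dA.
Proof.
move=> oW cA Ww.
exists (\matrix_(i, j) \sum_k v 0 k * partial k (fun w => A w i j) w) => i j; rewrite mxE.
have := @C1_derive_comp R 'rV[R]_p p W (fun w => A w i j) id w v v oW (cA i j) Ww.
by apply => k; exact: is_derive_coord.
Qed.

Lemma vec_is_lin m n q r (f : 'M[R]_(m, n) -> 'M[R]_(q, r)) : is_lin f ->
  is_lin (fun w : 'rV[R]_(m * n) => f (vec_mx w)).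
Proof. by move=> lf h u v; rewrite linearP lf. Qed.

End LinearMaps.

Section Cayley.
Variables (R : realType) (n : nat).

(** A rational parametrization of orthogonal matrices near the identity, so its smoothness reduces
    to that of the matrix inverse. *)
Definition cayley (A : 'M[R]_n) := invmx (1%:M - A) *m (1%:M + A).

(** If [u = u *m A], then [u *m u^T = u *m A *m u^T], which equals its own opposite. *)
Lemma skew_unit (A : 'M[R]_n) : A^T = - A -> 1%:M - A \in unitmx.
Proof.
move=> sA; rewrite -row_free_unit; apply: inj_row_free => u.
rewrite mulmxBr mulmx1 => /eqP; rewrite subr_eq0 => /eqP uE.
apply: row_sqr0.
have E : (u *m A *m u^T) 0 0 = - (u *m A *m u^T) 0 0.
  have {1}-> : (u *m A *m u^T) 0 0 = ((u *m A *m u^T)^T) 0 0 by rewrite [RHS]mxE.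
  by rewrite !trmx_mul trmxK sA mulNmx mulmxN mulmxA [LHS]mxE.
rewrite {1}uE; move: E; lra.
Qed.

Lemma cayley_orth (A : 'M[R]_n) : A^T = - A -> (cayley A)^T *m cayley A = 1%:M.
Proof.
move=> sA; apply: mulmx1C; have u1 := skew_unit sA.
have E1 : (1%:M - A)^T = 1%:M + A by rewrite linearB /= trmx1 sA opprK.
have E2 : (1%:M + A)^T = 1%:M - A by rewrite linearD /= trmx1 sA.
have u2 : 1%:M + A \in unitmx by rewrite -E1 unitmx_tr.
rewrite /cayley trmx_mul trmx_inv E1 E2 mulmxA -(mulmxA (invmx _)).
have -> : (1%:M + A) *m (1%:M - A) = (1%:M - A) *m (1%:M + A).
  rewrite !mulmxDl !mulmxDr !mul1mx !mulmx1 mulNmx mulmxN.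
  by rewrite [LHS]addrA subrK [RHS]addrA addrK.
by rewrite !mulmxA mulVmx// mul1mx mulmxV.
Qed.

Lemma cayley0 : cayley 0 = 1%:M.
Proof. by rewrite /cayley subr0 addr0 invmx1 mulmx1. Qed.

Lemma eigvals_conj (Q D : 'M[R]_n) : Q^T *m Q = 1%:M -> eigvals (Q *m D *m Q^T) = eigvals D.
Proof. by move=> oQ; rewrite /eigvals /is_eigvals char_poly_conj. Qed.

Lemma eig_preimage_conj M (Q D : 'M[R]_n) : Q^T *m Q = 1%:M ->
  eig_preimage M (Q *m D *m Q^T) <-> eig_preimage M D.
Proof.
move=> oQ; rewrite /eig_preimage /= eigvals_conj// /Defs.symmetric !trmx_mul trmxK mulmxA.
split=> -[sD MD]; split=> //; last by rewrite sD.
have := congr1 (fun X => Q^T *m X *m Q) sD.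
by rewrite /= !mulmxA oQ !mul1mx -!mulmxA oQ !mulmx1.
Qed.

End Cayley.

Section ChartPieces.
Variables (R : realType) (n : nat) (xb : 'rV[R]_n).
Implicit Types (Z E H : 'M[R]_n).

(* A neighbourhood of [diag_mx xb] has four coordinates: the symmetric and skew parts, inside
   and outside the blocks of [xb]. [bdp] and [offa] drive the chart; [resid] collects the other
   two, arranged as a skew matrix, so that it vanishes exactly when the image is symmetric. *)
Definition bdp Z : 'M[R]_n := \matrix_(i, j) (if xb 0 i == xb 0 j then (Z i j + Z j i) / 2 else 0).
Definition offa Z : 'M[R]_n := \matrix_(i, j) (if xb 0 i == xb 0 j then 0 else (Z i j - Z j i) / 2).
Definition resid Z : 'M[R]_n := \matrix_(i, j) (if xb 0 i == xb 0 j then (Z i j - Z j i) / 2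
  else if (i < j)%N then (Z i j + Z j i) / 2 else - ((Z i j + Z j i) / 2)).

Lemma bdp_lin : is_lin bdp.
Proof. by move=> h u v; apply/matrixP => i j; rewrite !mxE; case: ifP => _; ring. Qed.

Lemma offa_lin : is_lin offa.
Proof. by move=> h u v; apply/matrixP => i j; rewrite !mxE; case: ifP => _; ring. Qed.

Lemma resid_lin : is_lin resid.
Proof.
by move=> h u v; apply/matrixP => i j; rewrite !mxE; do 2?[case: ifP => _]; ring.
Qed.

Lemma bdp_sym Z : Defs.symmetric (bdp Z).
Proof. by apply/matrixP => i j; rewrite !mxE eq_sym addrC. Qed.

Lemma offa_skew Z : (offa Z)^T = - offa Z.
Proof. by apply/matrixP => i j; rewrite !mxE eq_sym; case: ifP => _; ring. Qed.

Lemma resid_skew Z : (resid Z)^T = - resid Z.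
Proof.
apply/matrixP => i j; rewrite !mxE eq_sym; case: (eqVneq (xb 0 i)) => [_|E]; first by ring.
have ij : i != j by apply: contraNN E => /eqP ->.
have [h|h|h] := ltngtP i j; [ring|ring|].
by move/val_inj: h => h; rewrite h eqxx in ij.
Qed.

Definition flip (i j : 'I_n) : R := if xb 0 i == xb 0 j then 1 else -1.

Lemma resid0P Z : resid Z = 0 <-> forall i j, Z i j = flip i j * Z j i.
Proof.
split=> [/matrixP H i j|H]; last first.
  apply/matrixP => i j; rewrite !mxE; have := H i j; rewrite /flip.
  case: ifP => _ ->; first by rewrite mul1r subrr mul0r.
  by rewrite mulN1r addNr mul0r oppr0 if_same.
have := H i j; rewrite !mxE /flip; case: ifP => _; first by lra.
by case: ifP => _; lra.
Qed.

Lemma bdp_diag : bdp (diag_mx xb) = diag_mx xb.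
Proof.
apply/matrixP => i j; rewrite !mxE; have [->|ij] := eqVneq i j.
  by rewrite !eqxx !mulr1n; field.
by rewrite /= !mulr0n addr0 mul0r if_same.
Qed.

Lemma offa_diag : offa (diag_mx xb) = 0.
Proof.
apply/matrixP => i j; rewrite !mxE; have [->|ij] := eqVneq i j; first by rewrite eqxx.
by rewrite /= !mulr0n subrr mul0r if_same.
Qed.

(* The linear part of the chart at [diag_mx xb]; its terms have disjoint supports or
   opposite symmetry. *)
Lemma chart_deriv_inj E :
  2 *: offa E *m diag_mx xb + diag_mx xb *m (2 *: offa E)^T + bdp E + resid E = 0 -> E = 0.
Proof.
move=> H.
have F i j : 2 * offa E i j * (xb 0 j - xb 0 i) + bdp E i j + resid E i j = 0.
  have := congr1 (fun A : 'M[R]_n => A i j) H; rewrite mul_mx_diag mul_diag_mx.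
  have : offa E j i = - offa E i j.
    by have := congr1 (fun A : 'M[R]_n => A i j) (offa_skew E); move: (offa E) => A; rewrite !mxE.
  move: (offa E) (bdp E) (resid E) => A B D Aji; rewrite !mxE Aji => <-.
  by ring.
apply/matrixP => i j; have := F i j; have := F j i; rewrite !mxE eq_sym.
have [<-|E0] := eqVneq (xb 0 i) (xb 0 j); first by lra.
have ij : i != j by apply: contraNN E0 => /eqP ->.
have xij : xb 0 j - xb 0 i != 0 by rewrite subr_eq0 eq_sym.
have X (a b : R) : 2 * a * (xb 0 j - xb 0 i) + b = 0 -> 2 * a * (xb 0 j - xb 0 i) - b = 0 -> a = 0 /\ b = 0.
  move=> h1 h2; have : a * (xb 0 j - xb 0 i) = 0 by lra.
  by move=> /eqP; rewrite mulf_eq0 (negbTE xij) orbF => /eqP a0; split=> //; move: h1; rewrite a0; lra.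
have [h|h|h] := ltngtP i j; last by move/val_inj: h => h; rewrite h eqxx in ij.
  move=> h1 h2.
  have [] := X ((E i j - E j i) / 2) ((E i j + E j i) / 2); [lra|lra|lra].
move=> h1 h2.
have [] := X ((E i j - E j i) / 2) ((E i j + E j i) / 2); [lra|lra|lra].
Qed.

End ChartPieces.

(** * The linear space of parameters *)

Section ParameterSpace.
Variables (R : realType) (n d : nat) (xb : 'rV[R]_n) (s : {perm 'I_n}).
Variables (J : 'M[R]_(d, n)) (C : 'M[R]_(n, d)).
Hypothesis JC : J *m C = 1%:M.

Definition crossing : {set 'I_n * 'I_n} := [set p : 'I_n * 'I_n | (p.1 < p.2)%N && (p.2 \notin porbit s p.1)]%SET.
Let c := #|crossing|.

(* The matrices [lmx u] parametrize the preimage under the chart: a tangent vector of [M] on the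
   diagonal, and one free entry per pair of indices in different orbits, extended
   symmetrically inside the blocks of [xb] and skew-symmetrically outside. *)
Definition pv (u : 'rV[R]_(d + c)) (i j : 'I_n) : R :=
  \sum_(q < c) rsubmx u 0 q * (enum_val q == (i, j))%:R.

Definition lmx (u : 'rV[R]_(d + c)) : 'M[R]_n := \matrix_(i, j)
  ((if i == j then (lsubmx u *m J) 0 i else 0) + pv u i j + flip xb i j * pv u j i).

Definition kmx (H : 'M[R]_n) : 'rV[R]_(d + c) :=
  row_mx ((\row_i H i i) *m C) (\row_q H (enum_val q).1 (enum_val q).2).

Lemma pv0 u i j : (i, j) \notin crossing -> pv u i j = 0.
Proof.
move=> ij; rewrite /pv big1// => q _; case: eqP => [E|]; last by rewrite mulr0.
by move: ij; rewrite -E enum_valP.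
Qed.

Lemma pv_val u (q : 'I_c) : pv u (enum_val q).1 (enum_val q).2 = rsubmx u 0 q.
Proof.
rewrite /pv -surjective_pairing (bigD1 q)//= eqxx mulr1 big1 ?addr0// => q' qq.
by rewrite (inj_eq enum_val_inj) (negbTE qq) mulr0.
Qed.

Lemma pv_lin h u v i j : pv (h *: u + v) i j = h * pv u i j + pv v i j.
Proof.
rewrite /pv mulr_sumr -big_split /=; apply: eq_bigr => q _; rewrite !mxE.
by rewrite mulrDl mulrA.
Qed.

Lemma lmx_lin : is_lin lmx.
Proof.
move=> h u v; apply/matrixP => i j; rewrite !mxE !pv_lin.
have -> : \sum_j0 lsubmx (h *: u + v) 0 j0 * J j0 i =
  h * (\sum_j0 lsubmx u 0 j0 * J j0 i) + \sum_j0 lsubmx v 0 j0 * J j0 i.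
  rewrite mulr_sumr -big_split /=; apply: eq_bigr => q _; rewrite !mxE.
  by rewrite mulrDl mulrA.
by case: ifP => _; ring.
Qed.

Lemma kmx_lin : is_lin kmx.
Proof.
move=> h u v; rewrite /kmx -[_ *: row_mx _ _]/(h *: _) scale_row_mx add_row_mx; congr row_mx.
  rewrite scalemxAl -mulmxDl; congr (_ *m _).
  by apply/rowP => i; rewrite !mxE.
by apply/rowP => q; rewrite !mxE.
Qed.

Lemma crossing_diag i : (i, i) \notin crossing.
Proof. by rewrite inE /= ltnn. Qed.

Lemma porbit_crossing i j : j \in porbit s i -> (i, j) \notin crossing /\ (j, i) \notin crossing.
Proof. by move=> ji; have ij : i \in porbit s j by [rewrite porbit_sym]; rewrite !inE /= ji ij !andbF. Qed.

Lemma lmxK u : kmx (lmx u) = u.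
Proof.
rewrite /kmx -[RHS]hsubmxK; congr row_mx.
  have -> : (\row_i lmx u i i) = lsubmx u *m J.
    apply/rowP => i; rewrite [LHS]mxE [LHS]mxE eqxx !pv0 ?crossing_diag//.
    by rewrite addr0 mulr0 addr0.
  by rewrite -mulmxA JC mulmx1.
apply/rowP => q; rewrite [LHS]mxE [LHS]mxE pv_val.
have := enum_valP q; rewrite inE => /andP[lt _].
have -> : ((enum_val q).1 == (enum_val q).2) = false.
  by apply/negbTE; rewrite -val_eqE /= neq_ltn lt.
rewrite add0r pv0; first by rewrite mulr0 addr0.
by rewrite inE /= ltnNge (ltnW lt).
Qed.

Lemma pv_kmx H i j : (i, j) \in crossing -> pv (kmx H) i j = H i j.
Proof.
move=> ij; have := pv_val (kmx H) (enum_rank_in ij (i, j)).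
by rewrite enum_rankK_in//= => ->; rewrite /kmx row_mxKr mxE enum_rankK_in.
Qed.

Lemma flipC i j : flip xb i j = flip xb j i.
Proof. by rewrite /flip eq_sym. Qed.

Lemma flipM i j : flip xb i j * flip xb i j = 1.
Proof. by rewrite /flip; case: ifP => _; ring. Qed.

(** The fixed points of [lmx] after [kmx] form the range of [lmx]; here they are described by
    equations on entries, in the form that [tangent_eig] and [resid0P] deliver. *)
Lemma lmx_kmxP H : lmx (kmx H) = H <->
  [/\ (\row_i H i i) *m C *m J = \row_i H i i,
      forall i j, i != j -> H i j = flip xb i j * H j i &
      forall i j, i != j -> j \in porbit s i -> H i j = 0].
Proof.
have le i j : lmx (kmx H) i j = (if i == j then ((\row_i H i i) *m C *m J) 0 i else 0) +
   pv (kmx H) i j + flip xb i j * pv (kmx H) j i.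
  by rewrite [LHS]mxE {1}/kmx row_mxKl.
have ld i : lmx (kmx H) i i = ((\row_i H i i) *m C *m J) 0 i.
  by rewrite le eqxx !pv0 ?crossing_diag// mulr0 !addr0.
split=> [E|[h1 h2 h3]].
  split.
  - by apply/rowP => i; rewrite -ld E [RHS]mxE.
  - move=> i j ij; rewrite -E !le (negbTE ij) eq_sym (negbTE ij) (flipC j i) !add0r.
    by rewrite mulrDr mulrA flipM mul1r addrC.
  - move=> i j ij ji; have [n1 n2] := porbit_crossing ji.
    by rewrite -E le (negbTE ij) !pv0// mulr0 !addr0.
apply/matrixP => i j; have [<-|ij] := eqVneq i j; first by rewrite ld h1 mxE.
rewrite le (negbTE ij) add0r; have [ji|nji] := boolP (j \in porbit s i).
  by have [n1 n2] := porbit_crossing ji; rewrite (h3 i j ij ji) !pv0// mulr0 addr0.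
have [h|h|h] := ltngtP i j; last by move/val_inj: h => h; rewrite h eqxx in ij.
  rewrite pv_kmx; last by rewrite inE /= h.
  by rewrite pv0 ?mulr0 ?addr0// inE /= ltnNge (ltnW h).
rewrite pv0; last by rewrite inE /= ltnNge (ltnW h).
by rewrite add0r pv_kmx -?h2// inE /= h porbit_sym.
Qed.

End ParameterSpace.

(** * Counting index pairs in different orbits *)

Section CrossCount.
Local Open Scope nat_scope.

(** The order of the indices and the enumeration of the orbits are unrelated, so the two counts are
    compared after symmetrization, as sums over ordered pairs. *)
Lemma sum_ltn_double k (F : nat -> nat -> nat) : (forall i j, F i j = F j i) ->
  (\sum_(i < k) \sum_(j < k | i < j) F i j).*2 = \sum_(i < k) \sum_(j < k | i != j) F i j.
Proof.
move=> FC; rewrite -addnn.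
have -> : \sum_(i < k) \sum_(j < k | i != j) F i j =
    \sum_(i < k) \sum_(j < k | i < j) F i j + \sum_(i < k) \sum_(j < k | j < i) F i j.
  rewrite -big_split; apply: eq_bigr => i _ /=.
  rewrite (bigID (fun j : 'I_k => i < j)) /=; congr addn; apply: eq_bigl => j.
    by rewrite -val_eqE /= neq_ltn; case: ltngtP.
  by rewrite -val_eqE /= neq_ltn; case: ltngtP.
congr addn; rewrite [RHS](exchange_big_dep xpredT)//=.
by apply: eq_bigr => j _; apply: eq_bigr => i _.
Qed.

Variables (n : nat) (s : {perm 'I_n}).

Lemma card_crossing_double :
  #|crossing s|.*2 = \sum_(i < n) \sum_(j < n | j \notin porbit s i) 1.
Proof.
have -> : #|crossing s| = \sum_(i < n) \sum_(j < n | i < j) (j \notin porbit s i).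
  rewrite -sum1_card (eq_bigl (fun p : 'I_n * 'I_n => xpredT p.1 && ((p.1 < p.2) && (p.2 \notin porbit s p.1)))); last first.
    by move=> p; rewrite inE.
  rewrite -(pair_big_dep xpredT (fun i j : 'I_n => (i < j) && (j \notin porbit s i)) (fun _ _ => 1)) /=.
  by apply: eq_bigr => i _; rewrite big_mkcondr /=; apply: eq_bigr => j _; case: (_ \notin _).
(* [sum_ltn_double] speaks of functions on the naturals, so the indicator is extended by [0] beyond
   [n]. *)
pose F i j := if insub i is Some i' then if insub j is Some j' then nat_of_bool (j' \notin porbit s (i' : 'I_n)) else 0 else 0.
have FE (i j : 'I_n) : F i j = (j \notin porbit s i) by rewrite /F !valK.
have FC i j : F i j = F j i.
  rewrite /F; case: insubP => [i' _ _|_]; case: insubP => [j' _ _|_] //.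
  by rewrite porbit_sym.
transitivity (\sum_(i < n) \sum_(j < n | i < j) F i j).*2.
  by congr double; apply: eq_bigr => i _; apply: eq_bigr => j _; rewrite FE.
rewrite sum_ltn_double//; apply: eq_bigr => i _.
rewrite big_mkcond [RHS]big_mkcond; apply: eq_bigr => j _; rewrite FE.
by case: eqVneq => [->|_]; [rewrite porbit_id|case: (_ \notin _)].
Qed.

Lemma cross_card_double :
  (cross_card s).*2 = \sum_(A in porbits s) \sum_(B in porbits s | A != B) #|A| * #|B|.
Proof.
rewrite /cross_card; set I := enum _.
rewrite (@sum_ltn_double _ (fun i j => #|nth finset.set0 I i| * #|nth finset.set0 I j|)); last first.
  by move=> i j; rewrite mulnC.
rewrite -[RHS]big_enum /= -/I (big_nth finset.set0) big_mkord; apply: eq_bigr => i _.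
rewrite [RHS]big_mkcondr /= -[RHS]big_enum /= -/I (big_nth finset.set0) big_mkord [LHS]big_mkcond /=.
apply: eq_bigr => j _; rewrite nth_uniq ?enum_uniq//.
Qed.

(** Ordered pairs of indices are grouped by the orbits [A] and [B] of their components. *)
Lemma card_crossing : #|crossing s| = cross_card s.
Proof.
apply: double_inj; rewrite card_crossing_double cross_card_double.
have fib B j : B \in porbits s -> (porbit s j == B) = (j \in B).
  by move=> /imsetP[k _ ->]; rewrite eq_porbit_mem.
have mP i : porbit s i \in porbits s by apply/imsetP; exists i.
rewrite (partition_big (porbit s) (fun A => A \in porbits s))//=.
apply: eq_bigr => A PA.
transitivity (\sum_(i < n | porbit s i == A) \sum_(B in porbits s | A != B) #|B|).
  apply: eq_bigr => i /eqP iA.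
  rewrite (partition_big (porbit s) (fun B => (B \in porbits s) && (A != B))); last first.
    by move=> j; rewrite mP -iA -eq_porbit_mem eq_sym.
  apply: eq_bigr => B /andP[PB AB]; rewrite -sum1_card; apply: eq_bigl => j.
  rewrite fib//; case: (boolP (j \in B)) => jB; rewrite ?andbF// andbT.
  by rewrite -eq_porbit_mem iA; move: jB; rewrite -fib// => /eqP ->; rewrite eq_sym.
rewrite sum_nat_cond_const -big_distrr /=; congr muln; apply: eq_card => i.
by rewrite inE fib.
Qed.

End CrossCount.

Lemma cont_nball (R : realType) (T : topologicalType) m n (f : T -> 'M[R]_(m, n)) x y e :
  {for x, continuous f} -> f x = y -> 0 < e -> \forall z \near x, `|f z - y| < e.
Proof. by move=> cf <- e0; exact: (cf _ (nball_near (f x) e0)). Qed.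

Section EtaCalculus.
Variables (R : realType) (n d : nat) (M : set 'rV[R]_n) (xb : 'rV[R]_n).
Variables (J : 'M[R]_(d, n)) (C : 'M[R]_(n, d)) (rho : 'rV[R]_n -> 'rV[R]_n) (r1 : R).
Hypotheses (Mxb : M xb) (retr : retraction M xb J C rho r1).
Variable Pi : 'M[R]_n.
Hypothesis PiE : Pi = C *m J.

Let et := eta xb rho Pi.
Let oB : open [set x | `|x - xb| < r1]. Proof. exact: open_nball. Qed.
Let Bxb : [set x | `|x - xb| < r1] xb.
Proof. by rewrite /= subrr normr0; case: retr => -[]. Qed.
Let crho l : C2_on [set x | `|x - xb| < r1] (fun x => rho x 0 l).
Proof. by case: retr => -[_ _ _ c] _; exact: (c l). Qed.

Lemma etaE x l : et x 0 l = rho x 0 l + (- xb 0 l) + (-1) * affmap xb Pi x 0 l.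
Proof. by rewrite /et /eta /affmap; move: (_ *m Pi) => v; rewrite !mxE mulN1r. Qed.

Lemma C2_eta l : C2_on [set x | `|x - xb| < r1] (fun x => et x 0 l).
Proof.
apply: (C2_eq oB (g := fun x => rho x 0 l + (- xb 0 l) + (-1) * affmap xb Pi x 0 l)).
  by move=> x _; rewrite etaE.
apply: (C2_add oB (C2_add oB (crho l) (C2_cst _ oB))).
exact: (C2_mul oB (C2_cst _ oB) (C2_affmap _ _ _ oB)).
Qed.

Lemma eta_xb : et xb = 0.
Proof. by rewrite /et /eta (rho_xb Mxb retr) !subrr mul0mx subrr. Qed.

Lemma partial_eta k l : partial k (fun x => et x 0 l) xb = 0.
Proof.
have H1 : is_derive xb (ebasis R k) (fun x => rho x 0 l) (Pi k l).
  have := C1_is_derive k (C2_C1 oB (crho l)) Bxb.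
  have -> // : partial k (fun x => rho x 0 l) xb = Pi k l.
  by have [_ [_ _ _ _ jr]] := retr; rewrite PiE -jr [RHS]mxE.
have H2 : is_derive xb (ebasis R k) (fun x => affmap xb Pi x 0 l) (Pi k l).
  have := C1_is_derive k (C2_C1 oB (C2_affmap xb Pi l oB)) Bxb.
  have -> // : partial k (fun x => affmap xb Pi x 0 l) xb = Pi k l.
  by rewrite -[in RHS](jac_affmap xb Pi xb) [RHS]mxE.
have H3 := is_deriveB (is_deriveB H1 (is_derive_cst (xb 0 l) xb (ebasis R k))) H2.
have E : (fun x => et x 0 l) = (fun x => rho x 0 l) - cst (xb 0 l) - (fun x => affmap xb Pi x 0 l).
  by apply/funext => x; rewrite etaE mulN1r.
rewrite /partial E; have -> := @derive_val _ _ _ _ _ _ _ H3.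
by rewrite subr0 subrr.
Qed.

(* [eta] measures the deviation of [rho] from its linearization, so subtracting it flattens [M]. *)
Lemma shift_in_M x : `|x - xb| < r1 -> `|x + et x - xb| < r1 ->
  M (x + et x) <-> (x - xb) *m Pi = x - xb.
Proof.
move=> xr yr; have [_ [rM Mr rC rD _]] := retr.
have xe : x + et x = rho x + ((x - xb) - (x - xb) *m Pi).
  by rewrite /et /eta; move: (_ *m Pi) => v; apply/rowP => i; rewrite !mxE; ring.
split=> [My|H]; last by rewrite xe H subrr addr0; exact: rM.
have yE : rho (x + et x) = x + et x by exact: Mr.
have : rho (x + et x) = rho x.
  by apply: rD; rewrite addrAC subrr add0r; exact: (eta_C retr PiE xr).
by rewrite yE xe => /eqP; rewrite -subr_eq0 addrAC subrr add0r subr_eq0 => /eqP.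
Qed.

End EtaCalculus.

(** * Assembly of the chart *)

Section Chart.
Variables (R : realType) (n d : nat) (M : set 'rV[R]_n).
Hypotheses (lsM : locally_symmetric M) (subM : C2_submanifold M d) (coM : connected M).
Variables (xb : 'rV[R]_n) (s : {perm 'I_n}).
Hypotheses (Mxb : M xb) (chs : characteristic_perm M s) (sxb : nonincr xb).
Variables (J : 'M[R]_(d, n)) (C : 'M[R]_(n, d)) (rho : 'rV[R]_n -> 'rV[R]_n) (r1 : R).
Hypothesis retr : retraction M xb J C rho r1.
Variable Pi : 'M[R]_n.
Hypothesis PiE : Pi = C *m J.
Variables (r g r2 : R).
Hypotheses (rr : r <= r1) (rs : forall i j x, xb 0 i = xb 0 j -> `|x - xb| < r ->
    rho (sw i j x) = sw i j (rho x)).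
Hypotheses (g0 : 0 < g) (gap : forall i j, `|xb 0 i - xb 0 j| < g -> xb 0 i = xb 0 j).
Hypotheses (r20 : 0 < r2) (r2r : r2 <= r) (r2g : r2 <= g / 2).
Variable Q0 : 'M[R]_n.
Hypothesis oQ0 : Q0^T *m Q0 = 1%:M.

Let et := eta xb rho Pi.
Let Xb := diag_mx xb.
Let z0 : 'rV[R]_(n * n) := mxvec Xb.
Let U := [set x : 'rV[R]_n | `|x - xb| < r2].
Let oU : open U. Proof. exact: open_nball. Qed.
Let Uxb : U xb. Proof. by rewrite /U /= subrr normr0. Qed.
Let UB : U `<=` [set x | `|x - xb| < r1].
Proof. by move=> x Ux; apply: lt_le_trans Ux (le_trans r2r rr). Qed.

(** Near [xb] equal coordinates may split, but distinct ones cannot merge. Hence the transpositions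
    fixing [xb] include those fixing any [x] in [U]. *)
Lemma U_eq x i j : U x -> x 0 i = x 0 j -> xb 0 i = xb 0 j.
Proof.
move=> Ux E; apply: gap.
have H k : `|x 0 k - xb 0 k| < g / 2.
  apply: lt_le_trans r2g; apply: le_lt_trans Ux.
  by have := le_mx_norm (x - xb) 0 k; rewrite !mxE.
have := H i; have := H j; rewrite E !ltr_norml => /andP[h1 h2] /andP[h3 h4].
by apply/andP; split; move: h1 h2 h3 h4; lra.
Qed.

Lemma eta_sw_near l x i j : U x -> x 0 i = x 0 j -> \forall y \near x, et (sw i j y) 0 l = et y 0 l.
Proof.
move=> Ux E; have Eb := U_eq Ux E.
have : \forall y \near x, U y by exact: open_nbhs_nbhs.
apply: nearS => y Uy; congr (_ 0 l).
have yr : `|y - xb| < r := lt_le_trans Uy r2r.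
by have := eta_sw Mxb lsM retr PiE rr rs Eb yr; rewrite /et => ->.
Qed.

Lemma C2_spectral_eta l : C2_on [set w : 'rV[R]_(n * n) | U (lam (vec_mx w))]
  (fun w => et (lam (vec_mx w)) 0 l).
Proof.
exact: (spectral_C2 oU (C2_sub UB (C2_eta retr Pi l)) (eta_sw_near l)).
Qed.

Lemma lam_diag : lam Xb = xb.
Proof.
have sX : Defs.symmetric Xb by exact: tr_diag_mx.
rewrite /lam (symp_id sX); apply: (@eigvalsE _ _ _ 1%:M); split=> //.
  by rewrite trmx1 mulmx1.
by rewrite trmx1 mulmx1 mul1mx.
Qed.

(** [bdp] moves within block diagonal symmetric matrices and the Cayley factor tilts the blocks;
    together they reach the nearby symmetric matrices, and [resid] fills the directions that
    remain. *)
Definition chart (Z : 'M[R]_n) : 'M[R]_n :=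
  cayley (offa xb Z) *m (bdp xb Z + diag_mx (et (lam (bdp xb Z)))) *m (cayley (offa xb Z))^T
  + resid xb Z.

Definition fchart (z : 'rV[R]_(n * n)) : 'rV[R]_(n * n) := mxvec (Q0 *m chart (vec_mx z) *m Q0^T).

Let W := [set z : 'rV[R]_(n * n) | U (lam (bdp xb (vec_mx z)))].
Let bl := vec_is_lin (bdp_lin xb).
Let ol := vec_is_lin (offa_lin xb).
Let rl := vec_is_lin (resid_lin xb).

Lemma open_W : open W.
Proof.
have H (z : 'rV[R]_(n * n)) : {for z, continuous (fun z : 'rV[R]_(n * n) => lam (bdp xb (vec_mx z)))}.
  apply: (cont_comp (f := fun z : 'rV[R]_(n * n) => bdp xb (vec_mx z)) (g := @lam R n)).
    exact: (@cont_lin R (n * n) n n (fun z : 'rV[R]_(n * n) => bdp xb (vec_mx z)) bl z).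
  exact: cont_lam.
by apply: open_comp => // z _; exact: H.
Qed.
Let oW := open_W.

Lemma W_z0 : W z0.
Proof. by rewrite /W /= mxvecK bdp_diag lam_diag. Qed.

Lemma C2_cayley i j : C2_on setT (fun z : 'rV[R]_(n * n) => cayley (offa xb (vec_mx z)) i j).
Proof.
apply: (C2_mulmx openT).
  apply: (C2_invmx openT); last by move=> w _; exact/skew_unit/offa_skew.
  move=> a b; apply: (C2_eq openT (g := fun z => 1%:M a b + (-1) * offa xb (vec_mx z) a b)).
    by move=> w _; rewrite [RHS]mxE [X in _ = _ + X]mxE mulN1r.
  exact: (C2_add openT (C2_cst _ openT) (C2_mul openT (C2_cst _ openT) (C2_lin ol a b openT))).
move=> a b; apply: (C2_eq openT (g := fun z => 1%:M a b + offa xb (vec_mx z) a b)).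
  by move=> w _; rewrite [RHS]mxE.
exact: (C2_add openT (C2_cst _ openT) (C2_lin ol a b openT)).
Qed.

Let ev z := et (lam (bdp xb (vec_mx z))).

Lemma evE l : (fun z => ev z 0 l) =
  (fun w : 'rV[R]_(n * n) => et (lam (vec_mx w)) 0 l) \o (fun z => mxvec (bdp xb (vec_mx z))).
Proof. by apply/funext => z; rewrite /= mxvecK. Qed.

Let bl2 : is_lin (fun z : 'rV[R]_(n * n) => mxvec (bdp xb (vec_mx z))).
Proof. by move=> h u v; rewrite bl linearP. Qed.
Let oU2 : open [set w : 'rV[R]_(n * n) | U (lam (vec_mx w))].
Proof.
apply: (@open_comp _ _ (fun w : 'rV[R]_(n * n) => lam (vec_mx w))) => // w _.
exact: (cont_comp (@vec_mx_continuous R n n w) (@cont_lam R n _)).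
Qed.

Lemma C2_ev l : C2_on W (fun z => ev z 0 l).
Proof.
rewrite evE; apply: (C2_comp oW oU2 _ (C2_spectral_eta l)).
  by move=> k; exact: (C2_lin bl2 0 k oW).
by move=> z Wz; rewrite /= mxvecK.
Qed.

(** The gradient of each coordinate of [eta] vanishes at [xb], hence so does the derivative [GG] of
    its lift. *)
Lemma ev_derive l v : is_derive z0 v (fun z => ev z 0 l) 0.
Proof.
rewrite evE.
have Uz : [set w : 'rV[R]_(n * n) | U (lam (vec_mx w))] (mxvec (bdp xb (vec_mx z0))).
  by rewrite /= mxvecK; exact: W_z0.
have := @C1_derive_comp R 'rV[R]_(n * n) _ _ _ (fun z => mxvec (bdp xb (vec_mx z))) z0 v
  (mxvec (bdp xb (vec_mx v))) oU2 (C2_C1 oU2 (C2_spectral_eta l)) Uz (mder_lin bl2 z0 v 0).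
have -> // : \sum_k mxvec (bdp xb (vec_mx v)) 0 k *
    partial k (fun w : 'rV[R]_(n * n) => et (lam (vec_mx w)) 0 l) (mxvec (bdp xb (vec_mx z0))) = 0.
rewrite big1// => k _; rewrite mxvecK bdp_diag -/z0.
have Ux : U (lam Xb) by rewrite lam_diag.
have H := spectral_derive oU (C2_sub UB (C2_eta retr Pi l)) (eta_sw_near l) (vec_mx (ebasis R k)) Ux.
have H' : is_derive (vec_mx z0) (vec_mx (ebasis R k)) (fun X => et (lam X) 0 l)
   (GG (fun k => partial k (fun x => et x 0 l)) (vec_mx (ebasis R k)) Xb) by rewrite mxvecK.
have H2 := is_derive_vec H'.
rewrite /partial; have -> := @derive_val _ _ _ _ _ _ _ H2.
by rewrite /GG /Gform lam_diag big1 ?mulr0// => j _; rewrite (partial_eta retr PiE) mul0r.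
Qed.

Lemma C2_chart i j : C2_on W (fun z => chart (vec_mx z) i j).
Proof.
have cc a b : C2_on W (fun z : 'rV[R]_(n * n) => cayley (offa xb (vec_mx z)) a b).
  exact: (@C2_sub R _ setT W _ (fun _ _ => I) (C2_cayley a b)).
apply: (C2_eq oW (g := fun z => (cayley (offa xb (vec_mx z)) *m (bdp xb (vec_mx z) + diag_mx (ev z)) *m
   (cayley (offa xb (vec_mx z)))^T) i j + resid xb (vec_mx z) i j)).
  by move=> z _; rewrite [RHS]mxE.
apply: (C2_add oW _ (C2_lin rl i j oW)).
apply: (C2_mulmx oW); last first.
  move=> a b; apply: (C2_eq oW (g := fun z => cayley (offa xb (vec_mx z)) b a)) => [z _|].
    by rewrite [RHS]mxE.
  exact: cc.
apply: (C2_mulmx oW cc) => a b.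
apply: (C2_eq oW (g := fun z => bdp xb (vec_mx z) a b + ev z 0 a * (a == b)%:R)) => [z _|].
  by rewrite [RHS]mxE [X in _ = _ + X]mxE mulr_natr.
exact: (C2_add oW (C2_lin bl a b oW) (C2_mul oW (C2_ev a) (C2_cst _ oW))).
Qed.

Lemma C2_fchart l : C2_on W (fun z => fchart z 0 l).
Proof.
case/mxvec_indexP: l => i j.
apply: (C2_eq oW (g := fun z => (Q0 *m chart (vec_mx z) *m Q0^T) i j)) => [z _|].
  by rewrite mxvecE.
apply: (C2_mulmx oW); last by move=> a b; exact: (C2_cst _ oW).
by apply: (C2_mulmx oW) => a b; [exact: (C2_cst _ oW)|exact: C2_chart].
Qed.

Lemma cayley_deriv v : mder (fun z : 'rV[R]_(n * n) => cayley (offa xb (vec_mx z))) z0 v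
  (2 *: offa xb (vec_mx v)).
Proof.
have [dO HO] := C1_mder v openT (fun i j => C2_C1 openT (C2_cayley i j)) (I : [set: 'rV[R]_(n * n)] z0).
have nl : is_lin (fun z : 'rV[R]_(n * n) => - offa xb (vec_mx z)).
  by move=> h a b; rewrite ol opprD scalerN.
have H1 := mder_mul (mder_add (mder_cst (1%:M : 'M[R]_n) z0 v) (mder_lin nl z0 v)) HO.
have H2 := mder_add (mder_cst (1%:M : 'M[R]_n) z0 v) (mder_lin ol z0 v).
(* Differentiating this identity avoids the derivative of an inverse; at [z0], where [offa]
   vanishes, it reads [dO - offa xb (vec_mx v) = offa xb (vec_mx v)]. *)
have E : (fun z : 'rV[R]_(n * n) => (1%:M - offa xb (vec_mx z)) *m cayley (offa xb (vec_mx z))) =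
   (fun z => 1%:M + offa xb (vec_mx z)).
  by apply/funext => z; rewrite /cayley mulKVmx//; exact/skew_unit/offa_skew.
rewrite E in H1; have := mder_unique H1 H2.
rewrite mxvecK offa_diag cayley0 subr0 mul1mx mulmx1 !add0r => /eqP.
by rewrite subr_eq => /eqP dE; rewrite scaler_nat mulr2n -dE.
Qed.

Lemma chart_deriv v : mder (fun z => chart (vec_mx z)) z0 v
  (2 *: offa xb (vec_mx v) *m Xb + Xb *m (2 *: offa xb (vec_mx v))^T + bdp xb (vec_mx v)
   + resid xb (vec_mx v)).
Proof.
have hD : mder (fun z => diag_mx (ev z)) z0 v 0.
  move=> i j; have -> : (fun z => diag_mx (ev z) i j) = (fun z => ev z 0 i * (i == j)%:R).
    by apply/funext => z; rewrite mxE mulr_natr.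
  have := is_deriveM (ev_derive i v) (is_derive_cst ((i == j)%:R : R) z0 v).
  by rewrite !scaler0 addr0 mxE.
have hO := cayley_deriv v.
have H := mder_add (mder_mul (mder_mul hO (mder_add (mder_lin bl z0 v) hD)) (mder_trmx hO)) (mder_lin rl z0 v).
have e0 : ev z0 = 0 by rewrite /ev mxvecK bdp_diag lam_diag; exact: (eta_xb Mxb retr).
move: H; rewrite e0 !mxvecK offa_diag cayley0 bdp_diag trmx1 mul1mx !mulmx1 mul1mx.
have -> : diag_mx (0 : 'rV[R]_n) = 0 by rewrite linear0.
rewrite !addr0 -/Xb => H.
have -> // : 2 *: offa xb (vec_mx v) *m Xb + Xb *m (2 *: offa xb (vec_mx v))^T + bdp xb (vec_mx v) =
  Xb *m (2 *: offa xb (vec_mx v))^T + (bdp xb (vec_mx v) + 2 *: offa xb (vec_mx v) *m Xb).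
by rewrite [RHS]addrA [RHS]addrC [RHS]addrA.
Qed.

Lemma fchart_jac : jac fchart z0 \in unitmx.
Proof.
rewrite -row_free_unit; apply: inj_row_free => v v0.
have H1 : mder (fun z => Q0 *m chart (vec_mx z) *m Q0^T) z0 v 0.
  move=> i j; have := jac_is_derive v (mxvec_index i j) oW (fun l => C2_C1 oW (C2_fchart l)) W_z0.
  rewrite v0 !mxE; have -> // : (fun z => fchart z 0 (mxvec_index i j)) =
     (fun z => (Q0 *m chart (vec_mx z) *m Q0^T) i j).
  by apply/funext => z; rewrite mxvecE.
have H2 := mder_mul (mder_mul (mder_cst Q0 z0 v) (chart_deriv v)) (mder_cst Q0^T z0 v).
have := mder_unique H1 H2; rewrite mulmx0 add0r mul0mx addr0.
set D := (_ + resid _ _) => /(congr1 (fun X => Q0^T *m X *m Q0)).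
rewrite mulmx0 mul0mx !mulmxA oQ0 mul1mx -mulmxA oQ0 mulmx1 => /esym /chart_deriv_inj.
by move=> /(congr1 mxvec); rewrite vec_mxK linear0.
Qed.

Lemma near_chart : exists2 e, 0 < e & forall z, `|z - z0| < e ->
  [/\ n%:R * `|bdp xb (vec_mx z) - Xb| < g / 2, W z &
      `|lam (bdp xb (vec_mx z)) + ev z - xb| < Num.min r1 (g / 2)].
Proof.
pose hz (z : 'rV[R]_(n * n)) := bdp xb (vec_mx z).
have hz0 : hz z0 = Xb by rewrite /hz mxvecK bdp_diag.
have cz : {for z0, continuous hz} := @cont_lin R (n * n) n n hz bl z0.
have cl : {for z0, continuous (fun z => lam (hz z) + ev z)}.
  apply: cont_addmx.
    exact: (cont_comp (f := hz) (g := @lam R n) cz (@cont_lam R n _)).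
  by apply/cont_mxP => a l; rewrite ord1; exact: (C1_continuous oW (C2_C1 oW (C2_ev l)) W_z0).
have l0 : lam (hz z0) + ev z0 = xb.
  by rewrite hz0 lam_diag /ev mxvecK bdp_diag lam_diag /et (eta_xb Mxb retr) addr0.
have g20 : 0 < g / 2 by rewrite divr_gt0.
have n1 : \forall z \near z0, n%:R * `|hz z - Xb| < g / 2.
  have e0 : 0 < g / 2 / n.+1%:R by rewrite divr_gt0.
  apply: (nearS _ (cont_nball cz hz0 e0)) => z.
  rewrite ltr_pdivlMr// => h; apply: le_lt_trans h.
  by rewrite [leLHS]mulrC; apply: ler_wpM2l => //; rewrite ler_nat.
have n2 : \forall z \near z0, W z by apply: open_nbhs_nbhs; split; [exact: oW|exact: W_z0].
have n3 : \forall z \near z0, `|lam (hz z) + ev z - xb| < Num.min r1 (g / 2).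
  have e0 : 0 < Num.min r1 (g / 2) by rewrite lt_min g20 andbT; case: retr => -[].
  exact: (cont_nball cl l0 e0).
have [e e0 H] := near_nball (near_and n1 (near_and n2 n3)).
by exists e => // z /H[h1 [h2 h3]].
Qed.

(** The conjugated part is symmetric and [resid] is skew. *)
Lemma chart_sym Z : Defs.symmetric (chart Z) <-> resid xb Z = 0.
Proof.
rewrite /Defs.symmetric /chart linearD /= resid_skew.
set B := _ *m _ *m _; have -> : B^T = B.
  have sS : (bdp xb Z + diag_mx (et (lam (bdp xb Z))))^T = bdp xb Z + diag_mx (et (lam (bdp xb Z))).
    by rewrite [LHS]linearD /= tr_diag_mx; congr (_ + _); exact: bdp_sym.
  by rewrite /B; move: (cayley _) (_ + diag_mx _) sS => A S sS; rewrite !trmx_mul trmxK sS mulmxA.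
split=> [/addrI H|->]; last by rewrite oppr0.
by apply/matrixP => i j; have := congr1 (fun A : 'M[R]_n => A i j) H; move: (resid xb Z) => A; rewrite !mxE; lra.
Qed.

(** [shift_in_M] replaces [M] by its tangent space, [tangent_eig] replaces eigenvalues by entries,
    and [lmx_kmxP] recognizes the resulting equations; [resid] accounts for symmetry. *)
Lemma chartP z : n%:R * `|bdp xb (vec_mx z) - Xb| < g / 2 -> W z ->
  `|lam (bdp xb (vec_mx z)) + ev z - xb| < Num.min r1 (g / 2) ->
  eig_preimage M (chart (vec_mx z)) <->
  lmx xb (s := s) J (kmx s C (vec_mx z - Xb)) = vec_mx z - Xb.
Proof.
set Z := vec_mx z; set Y := bdp xb Z; set x := lam Y; set et' := ev z.
move=> Yg Wz; rewrite lt_min => /andP[yr1 yg].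
have sY : Defs.symmetric Y by exact: bdp_sym.
have [Q eQ] : exists Q, eigsys Y Q x by have := lam_spec Y; rewrite (symp_id sY).
have [oQ _ _] := eQ.
have Y0 i j : xb 0 i != xb 0 j -> Y i j = 0 by move=> /negbTE E; rewrite mxE E.
have xU : `|x - xb| < r2 by exact: Wz.
have xg : `|x - xb| < g / 2 by exact: lt_le_trans r2g.
have xr : `|x - xb| < r by exact: lt_le_trans r2r.
have Q00 := eig_block g0 gap Y0 eQ xg Yg.
have eb i j : xb 0 i = xb 0 j -> et' 0 i = et' 0 j.
  by move=> E; exact: (eta_block Mxb lsM retr PiE rr rs E xr).
have eY : eigvals (Y + diag_mx et') = x + et'.
  exact: (eigvalsE (eigsys_shift sxb eQ gap Q00 eb yg)).
have ecv : resid xb Z = 0 -> eigvals (chart Z) = x + et'.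
  move=> r0; have oC := cayley_orth (offa_skew xb Z).
  by rewrite /chart r0 addr0 (eigvals_conj _ oC); exact: eY.
have MP : M (x + et') <-> (x - xb) *m Pi = x - xb.
  exact: (shift_in_M retr PiE (lt_le_trans xr rr) yr1).
have TP := tangent_eig lsM subM coM Mxb chs retr PiE eQ Q00.
have Hd : \row_i (Z - Xb) i i = \row_i Y i i - xb.
  by apply/rowP => i; rewrite !mxE !eqxx mulr1n; congr (_ - _); field.
have Ho i j : i != j -> (Z - Xb) i j = Z i j.
  by move=> ij; rewrite [LHS]mxE [X in _ + X]mxE [X in - X]mxE (negbTE ij) mulr0n subr0.
have rP : resid xb Z = 0 <-> forall i j, i != j -> (Z - Xb) i j = flip xb i j * (Z - Xb) j i.
  split=> [/resid0P H i j ij|H].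
    have ji : j != i by rewrite eq_sym.
    by rewrite (Ho i j ij) (Ho j i ji); exact: H.
  apply/resid0P => i j; have [<-|ij] := eqVneq i j; first by rewrite /flip eqxx mul1r.
  have ji : j != i by rewrite eq_sym.
  by rewrite -(Ho i j ij) -(Ho j i ji); exact: H.
split=> [[sc Mc]|/(lmx_kmxP xb s J C) [h1 h2 h3]].
  have r0 := (chart_sym Z).1 sc; rewrite ecv// in Mc.
  have [t1 t2] := TP.1 (MP.1 Mc); apply/(lmx_kmxP xb s J C); split.
  - by rewrite Hd -mulmxA -PiE.
  - exact/rP.
  - move=> i j ij ji; rewrite Ho//; have := t2 i j ij ji.
    have E := porbit_eq lsM subM coM Mxb chs ji.
    rewrite mxE E eqxx; have := ((resid0P xb Z).1 r0) i j; rewrite /flip E eqxx mul1r.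
    by move=> ->; lra.
have r0 := rP.2 h2; split; first exact/chart_sym.
rewrite ecv//; apply/MP/TP; split; first by rewrite -Hd PiE mulmxA.
move=> i j ij ji; have E := porbit_eq lsM subM coM Mxb chs ji.
have ji' : j != i by rewrite eq_sym.
have ij' : i \in porbit s j by rewrite porbit_sym.
have := h3 i j ij ji; have := h3 j i ji' ij'; rewrite (Ho i j ij) (Ho j i ji') => z1 z2.
by rewrite mxE E eqxx z1 z2 addr0 mul0r.
Qed.

Lemma eig_preimage_chart :
  C2_chart_at (eig_preimage M) (d + #|crossing s|) (Q0 *m Xb *m Q0^T).
Proof.
have JC : J *m C = 1%:M by case: retr => -[].
have ll : is_lin (fun u => mxvec (lmx xb (s := s) J u)).
  by move=> h u v; rewrite (@lmx_lin R n d xb s J) linearP.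
have kl : is_lin (fun z : 'rV[R]_(n * n) => kmx s C (vec_mx z)).
  by move=> h u v; rewrite linearP (@kmx_lin R n d s C).
have [e e0 He] := near_chart.
have c0 : vec_mx (fchart z0) = Q0 *m Xb *m Q0^T.
  rewrite /fchart mxvecK mxvecK /chart offa_diag bdp_diag lam_diag /et (eta_xb Mxb retr) cayley0.
  have -> : resid xb Xb = 0.
    apply/resid0P => i j; rewrite /Xb !mxE; have [->|ij] := eqVneq i j; first by rewrite /flip !eqxx mul1r.
    by rewrite !mulr0n mulr0.
  by rewrite linear0 !addr0 mul1mx trmx1 mulmx1.
rewrite -c0; apply: (flatten_chart oW C2_fchart W_z0 fchart_jac
  (L := \matrix_k mxvec (lmx xb (s := s) J (ebasis R k)))
  (K := \matrix_k kmx s C (vec_mx (ebasis R k))) _ e0).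
  apply/row_matrixP => k; rewrite !rowE mulmxA (lin_rowmx ll) (lin_rowmx kl) mxvecK mulmx1.
  exact: lmxK.
move=> z /He[h1 h2 h3]; rewrite (lin_rowmx kl) (lin_rowmx ll).
have -> : vec_mx (z - z0) = vec_mx z - Xb by rewrite linearB /= mxvecK.
rewrite /fchart mxvecK.
split=> [/(eig_preimage_conj _ _ oQ0)/(chartP h1 h2 h3) ->|H].
  by rewrite linearB /= vec_mxK.
apply/(eig_preimage_conj _ _ oQ0)/(chartP h1 h2 h3).
by move/(congr1 vec_mx): H; rewrite mxvecK linearB /= mxvecK.
Qed.

End Chart.

Theorem theorem4p21 (R : realType) (n : nat) (M : set 'rV[R]_n) (d : nat)
  (s : {perm 'I_n}) :
  loc_sym_C2_submanifold M d ->
  characteristic_perm M s ->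
  C2_submanifold (eig_preimage M) (d + cross_card s)%N.
Proof.
move=> [coM subM lsM] chs; rewrite -card_crossing => X [sX MX].
have [Q0 eQ0] := eigvals_spec sX; have [oQ0 XE sxb] := eQ0.
have [J [C [rho [r1 retr]]]] := exists_retraction MX subM.
have [r /andP[r0 rr] rs] := rho_sw MX lsM retr erefl.
have [g g0 gap] := spectral_gap (eigvals X).
(* The radius has to respect both the ball on which [rho] commutes with the transpositions and half
   of the spectral gap. *)
have r20 : 0 < Num.min r (g / 2) by rewrite lt_min r0 divr_gt0.
have r2r : Num.min r (g / 2) <= r by rewrite ge_min lexx.
have r2g : Num.min r (g / 2) <= g / 2 by rewrite ge_min lexx orbT.
have := eig_preimage_chart lsM subM coM MX chs sxb retr erefl rr rs g0 gap r20 r2r r2g oQ0.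
by rewrite -XE.
Qed.
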